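(* Let $A\subset\mathbb{C}$ be a Cantor set and $V$ a connected (open) neighborhood of $A$. Let $\mathcal{G}$ be a collection of holomorphic IFS $(G,\Omega_G)$ such that: (1) for every $G\in\mathcal{G}$, $A_G=A$ and $V\subset\Omega_G$; (2) at least one of the following two conditions holds: (a) there exists $r>0$ such that for every $G\in\mathcal{G}$ and any two different $g,\tilde g\in G$, the Euclidean distance between $g(A)$ and $\tilde g(A)$ is at least $r$ (in particular, the strong separation condition holds); (b) $A\subset\mathbb{R}$, $A\subset V\cap\mathbb{R}$, the collection $\mathcal{G}$ consists of real IFS that satisfy the strong separation condition, and $\sup\{\#G: G\in\mathcal{G}\}<\infty$. Then the collection $\{g|_V: g\in G\text{ for some }G\in\mathcal{G}\}$ is finite.
   Context: A holomorphic IFS is a pair $(G,\Omega)$ where $\Omega$ is a bounded domain in $\mathbb{C}$ and $G=\{g_i:\Omega\to\Omega\}_{i\in\Lambda}$ is a finite collection of univalent (holomorphic injective) maps with $\overline{g_i(\Omega)}\subset\Omega$ for all $i$; $\#G$ is the number of its maps. (Each $g_i$ is then a strict contraction of $\Omega$ in its hyperbolic metric.) Its attractor $A_G$ is the unique non-empty compact set $A\subset\Omega$ with $A=\bigcup_{i\in\Lambda}g_i(A)$. The strong separation condition (SSC) means $g_i(A_G)\cap g_j(A_G)=\emptyset$ for all $i\neq j$. A holomorphic IFS $(G,\Omega_G)$ is real if $\Omega_G$ is symmetric with respect to $\mathbb{R}$ and $g(\bar z)=\overline{g(z)}$ for all $g\in G$ and $z\in\Omega_G$. *)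

(* Defs.v *)
From HB Require Import structures.
From mathcomp Require Import all_boot all_order all_algebra.
From mathcomp Require Import all_classical all_reals all_analysis.
From mathcomp Require Import complex.

Set Implicit Arguments.
Unset Strict Implicit.
Unset Printing Implicit Defensive.

Import Order.TTheory GRing.Theory Num.Theory.
Import numFieldNormedType.Exports.

Local Open Scope classical_set_scope.
Local Open Scope ring_scope.

(* The complex plane is R[i]^o: R[i] as a one-dimensional normed module over
   itself. In particular, derivability below is complex derivability. *)

Definition is_cantor_set (R : realType) (A : set R[i]^o) : Prop :=
  [/\ A !=set0, compact A, perfect_set A & totally_disconnected A].

Definition is_domain (R : realType) (U : set R[i]^o) : Prop :=
  [/\ U !=set0, open U & connected U].

Definition univalent_on (R : realType) (U : set R[i]^o)
    (g : R[i]^o -> R[i]^o) : Prop :=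
  (forall z, U z -> derivable g z 1) /\ set_inj U g.

(* A map with domain Omega is represented by the total function that agrees
   with it on Omega and takes the fixed value point outside Omega, so that
   equality of functions is equality of maps on Omega, and ifs_maps is a
   genuine finite set of maps. *)
Record holomorphic_ifs (R : realType) := HolomorphicIFS {
  ifs_dom : set R[i]^o;
  ifs_maps : set (R[i]^o -> R[i]^o);
  ifs_dom_domain : is_domain ifs_dom;
  ifs_dom_bounded : bounded_set ifs_dom;
  ifs_maps_finite : finite_set ifs_maps;
  ifs_maps_restrict : forall g, ifs_maps g -> g \_ ifs_dom = g;
  ifs_maps_univalent : forall g, ifs_maps g -> univalent_on ifs_dom g;
  ifs_maps_closure :
    forall g, ifs_maps g -> closure (g @` ifs_dom) `<=` ifs_dom
}.

(* At most one set satisfies this, as the maps are strict contractions of the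
   domain in its hyperbolic metric; is_attractor G A expresses A_G = A. *)
Definition is_attractor (R : realType) (G : holomorphic_ifs R)
    (A : set R[i]^o) : Prop :=
  [/\ A !=set0, compact A, A `<=` ifs_dom G
    & A = \bigcup_(g in ifs_maps G) (g @` A)].

(* To be used with A the attractor of G. *)
Definition strong_separation (R : realType) (G : holomorphic_ifs R)
    (A : set R[i]^o) : Prop :=
  forall g h, ifs_maps G g -> ifs_maps G h -> g <> h ->
    (g @` A) `&` (h @` A) = set0.

Definition real_ifs (R : realType) (G : holomorphic_ifs R) : Prop :=
  (forall z, ifs_dom G z -> ifs_dom G (conjc z)) /\
  (forall g z, ifs_maps G g -> ifs_dom G z -> g (conjc z) = conjc (g z)).

Definition real_line (R : realType) : set R[i]^o :=
  [set z | complex.Im z = 0].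
Arguments real_line R : clear implicits.

(* The R-valued modulus normc is used because the norm `|z| of z : R[i] has
   values in R[i]. *)
Definition set_dist (R : realType) (X Y : set R[i]^o) : R :=
  inf [set ComplexField.Normc.normc (x - y) | x in X & y in Y].

(* Main.v *)
Require Import Defs.
From HB Require Import structures.
From mathcomp Require Import all_boot all_order all_algebra.
From mathcomp Require Import all_classical all_reals all_analysis.
From mathcomp Require Import complex.
From mathcomp Require Import ring lra.

(* In both cases the systems satisfy the strong separation condition and have
   at most N maps, and this is all that is used.  Suppose that infinitely many
   restrictions occur, take a sequence of systems G_n realizing them, and let
   f_i be the limit along a free ultrafilter of the i-th map of G_n.

   - Bounds: the Caratheodory metric of any domain containing V is comparable
     at any two points of A, up to a factor depending only on A and V (a Harnack
     inequality obtained by dividing f - f a by z - a), and maps of the domain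
     into itself contract it.  Hence the maps are equi-Lipschitz near A, the
     limits f_i are holomorphic near A, and A is the union of the f_i A.
   - Uniform disconnectedness: by the argument of Earle and Hamilton the words of
     one system contract exponentially, so their distortion is bounded and every
     point of A has, at each scale s, a neighbourhood in A of size s separated
     from the rest of A by a gap of order s.
   - Rigidity: if f i A contains a piece of A open in A, then g = the i-th map of
     G_n satisfies g A <= f A near some point, for most n.  Let u = g - f, which
     has a small Lipschitz constant.  If u a <> 0, take s comparable to the
     distance from a to the zeros of u; the self-map x |-> f^-1 (g x) moves points
     by much less than s, so it preserves a piece of A of size s around a.  But a
     primitive Phi of f' / u increases by almost 1 along this map, which is
     impossible as Phi is bounded on the piece.  So g = f on V.
   - The pieces f_i A without such an open part can be discarded, so A is covered
     by images of maps that do not depend on n, and by strong separation these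
     are all the maps of G_n: the sequence repeats. *)

Set Implicit Arguments.
Unset Strict Implicit.
Unset Printing Implicit Defensive.

Import Order.TTheory GRing.Theory Num.Theory.
Import numFieldNormedType.Exports.

Local Open Scope classical_set_scope.
Local Open Scope ring_scope.

(** * Modulus and ultralimits *)

(** No bound on the domains is uniform over the systems, so the maps do not form a normal family on
    V for free. The Caratheodory metric is a supremum over maps into the disc. It needs no
    uniformization, and an inequality proved for every domain that contains V is automatically
    uniform in n. It controls the maps only near A, so the limits f_i live only there; a statement
    on all of V always compares two maps of the sequence.

    The set A is the same for all systems. Hence a single system yields the gap constants, and these
    serve for every n. The gaps are what rigidity needs: they trap the orbit of f^-1 g in one piece
    of A, so that g close to f in the Lipschitz sense is enough and no rate of convergence enters.

    A free ultrafilter gives a limit to every bounded sequence at once, which replaces diagonal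
    extraction over the N indices and all points of the plane. It also decides, for each property of
    n, whether it holds for most n. *)

Section Modulus.
Variable R : realType.
Implicit Types z w x y : R[i].

Definition modc z : R := ComplexField.Normc.normc z.

Lemma modcE z : modc z = Num.sqrt (complex.Re z ^+ 2 + complex.Im z ^+ 2).
Proof. by case: z. Qed.

Lemma modc_ge0 z : 0 <= modc z.
Proof. by rewrite modcE sqrtr_ge0. Qed.

Lemma modc0 : modc 0 = 0. Proof. exact: ComplexField.Normc.normc0. Qed.

Lemma modc1 : modc 1 = 1. Proof. exact: ComplexField.Normc.normc1. Qed.

Lemma modc0_eq0 z : modc z = 0 -> z = 0.
Proof. exact: ComplexField.Normc.eq0_normc. Qed.

Lemma modcM z w : modc (z * w) = modc z * modc w.
Proof. exact: ComplexField.Normc.normcM. Qed.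

Lemma modcV z : modc z^-1 = (modc z)^-1.
Proof. exact: ComplexField.Normc.normcV. Qed.

Lemma modcN z : modc (- z) = modc z.
Proof. exact: normcN. Qed.

Lemma modcD z w : modc (z + w) <= modc z + modc w.
Proof. exact: le_normcD. Qed.

Lemma modcX z n : modc (z ^+ n) = modc z ^+ n.
Proof. by elim: n => [|n IH]; rewrite ?expr0 ?modc1 // !exprS modcM IH. Qed.

Lemma modcB z w : modc (z - w) <= modc z + modc w.
Proof. by rewrite -[modc w]modcN modcD. Qed.

Lemma modcBC z w : modc (z - w) = modc (w - z).
Proof. by rewrite -modcN opprB. Qed.

Lemma modc_tri y z w : modc (z - w) <= modc (z - y) + modc (y - w).
Proof. by rewrite -[z - w](subrKA y) modcD. Qed.

Lemma modc_lowD z w : modc z - modc w <= modc (z + w).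
Proof. by have := modcB (z + w) w; rewrite addrK lerBlDr. Qed.

Lemma modc_lowB z w : modc z - modc w <= modc (z - w).
Proof. by rewrite -[modc w]modcN modc_lowD. Qed.

Lemma modc_gt0 z : z != 0 -> 0 < modc z.
Proof.
move=> z0; rewrite lt_neqAle modc_ge0 andbT eq_sym.
by apply: contra z0 => /eqP/modc0_eq0 ->.
Qed.

Lemma modc_real (r : R) : modc (r%:C)%C = `|r|.
Proof. by rewrite modcE /= expr0n /= addr0 sqrtr_sqr. Qed.

Lemma modc_nat n : modc (n%:R : R[i]) = n%:R.
Proof.
have -> : (n%:R : R[i]) = ((n%:R : R)%:C)%C by rewrite rmorph_nat.
by rewrite modc_real ger0_norm.
Qed.

Lemma modc_i : modc ('i)%C = 1.
Proof. by rewrite modcE /= expr0n expr1n /= add0r sqrtr1. Qed.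

Lemma ReB z w : complex.Re (z - w) = complex.Re z - complex.Re w.
Proof. by case: z w => a b [c d]. Qed.

Lemma ImB z w : complex.Im (z - w) = complex.Im z - complex.Im w.
Proof. by case: z w => a b [c d]. Qed.

Lemma Re_le_modc z : `|complex.Re z| <= modc z.
Proof.
by rewrite modcE -sqrtr_sqr ler_sqrt ?addr_ge0 ?sqr_ge0 // lerDl sqr_ge0.
Qed.

Lemma Im_le_modc z : `|complex.Im z| <= modc z.
Proof.
by rewrite modcE -sqrtr_sqr ler_sqrt ?addr_ge0 ?sqr_ge0 // lerDr sqr_ge0.
Qed.

Lemma modc_le_ReIm z : modc z <= `|complex.Re z| + `|complex.Im z|.
Proof.
rewrite modcE -[X in _ <= X]ger0_norm ?addr_ge0 // -sqrtr_sqr.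
rewrite ler_sqrt ?sqr_ge0 // sqrrD !real_normK ?num_real //.
by rewrite addrAC lerDl mulrn_wge0 ?mulr_ge0.
Qed.

Lemma modc_half z : modc (z / 2%:R) = modc z / 2.
Proof. by rewrite modcM modcV modc_nat. Qed.

Lemma modc_le0 z : modc z <= 0 -> z = 0.
Proof. by move=> h; apply: modc0_eq0; apply/eqP; rewrite eq_le h modc_ge0. Qed.

Lemma modc_arch z : (forall e, 0 < e -> modc z <= e) -> z = 0.
Proof.
move=> h; apply: modc_le0; rewrite leNgt; apply/negP => z0.
have := h (modc z / 2); rewrite divr_gt0 // => /(_ isT); lra.
Qed.

Lemma exists_at_dist z (t : R) : 0 < t -> exists w, modc (w - z) = t.
Proof. by move=> t0; exists (z + (t%:C)%C); rewrite addrC addKr modc_real gtr0_norm. Qed.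

End Modulus.
Arguments modc {R} z : simpl never.

Lemma eq_lexx (R : realType) (x y : R) : x = y -> x <= y.
Proof. by move->. Qed.

Lemma exists_lt3 (R : realType) (a b c : R) : 0 < a -> 0 < b -> 0 < c ->
  exists t, [/\ 0 < t, t < a, t < b & t < c].
Proof.
move=> a0 b0 c0; pose m := Num.min a (Num.min b c).
have m0 : 0 < m by rewrite !lt_min a0 b0.
have [ma mb mc] : [/\ m <= a, m <= b & m <= c] by rewrite /m !ge_min !lexx !orbT.
by exists (m / 2); split; lra.
Qed.

Section UltraLimit.
Variable R : realType.

Definition ulim (U : set_system nat) (x : nat -> R[i]) (l : R[i]) :=
  forall e : R, 0 < e -> U [set n | modc (x n - l) < e].

Definition free_ultra (U : set_system nat) := UltraFilter U /\ \oo `<=` U.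

Lemma free_ultra_exists : exists U, free_ultra U.
Proof. by have [U [? ?]] := @ultraFilterLemma nat \oo _; exists U. Qed.

Section Free.
Variables (U : set_system nat) (hU : free_ultra U).

Local Instance ultraU : UltraFilter U := hU.1.

Lemma ultraI (P Q : set nat) : U P -> U Q -> U (P `&` Q).
Proof. exact: filterI. Qed.

Lemma ultraS (P Q : set nat) : (forall n, P n -> Q n) -> U P -> U Q.
Proof. by move=> PQ; apply: filterS. Qed.

Lemma ultra_ex (P : set nat) : U P -> exists n, P n.
Proof. exact: filter_ex. Qed.

Lemma ultraC (P : set nat) : ~ U P -> U [set n | ~ P n].
Proof. by move=> nP; have [//|//] := in_ultra_setVsetC P ultraU. Qed.

Lemma ultra_ge m : U [set n | (m <= n)%N].
Proof. by apply: hU.2; exists m. Qed.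

Lemma ultra_all (P : set nat) : (forall n, P n) -> U P.
Proof. by move=> h; apply: ultraS (ultra_ge 0) => n _. Qed.

(** Pigeonhole for the ultrafilter: an index that depends on n becomes constant for U-many n. *)
Lemma ultra_fin (I : Type) (s : seq I) (P : I -> set nat) (Q : set nat) :
  U Q -> (forall n, Q n -> exists2 i, List.In i s & P i n) ->
  exists2 i, List.In i s & U (P i).
Proof.
elim: s Q => [|i s IH] Q UQ h.
  by have [n /h [? []]] := ultra_ex UQ.
have [Ui|/ultraC Ui] := pselect (U (P i)); first by exists i => //; left.
have [|j js Uj] := IH _ (ultraI UQ Ui).
  by move=> n [/h [j [<- //|js] Pj] _]; exists j.
by exists j => //; right.
Qed.

Lemma ulim_uniq x l l' : ulim U x l -> ulim U x l' -> l = l'.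
Proof.
move=> h h'; apply/eqP; rewrite -subr_eq0; apply/eqP/modc_arch => e e0.
have e2 : 0 < e / 2 by lra.
have [n [/= h1 h2]] := ultra_ex (ultraI (h _ e2) (h' _ e2)).
by have := modc_tri (x n) l l'; rewrite modcBC in h1; lra.
Qed.

(** The limit is the supremum of those t that lie below [x n] for U-many n. *)
Lemma real_ulim (x : nat -> R) (B : R) : (forall n, `|x n| <= B) ->
  exists l : R, forall e, 0 < e -> U [set n | `|x n - l| < e].
Proof.
move=> hB; pose S := [set t : R | U [set n | t <= x n]].
have S0 : S (- B).
  by apply: ultra_all => n /=; have := hB n; rewrite ler_norml => /andP[].
have Sub : ubound S B.
  move=> t /ultra_ex [n /= tx]; have := hB n; rewrite ler_norml => /andP[_].
  exact: le_trans.
have supS : has_sup S by split; [exists (- B)|exists B].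
exists (sup S) => e e0.
have [t St te] := sup_adherent e0 supS.
have nS : U [set n | ~ (sup S + e / 2 <= x n)].
  apply: ultraC => h; have := ub_le_sup supS.2 h; lra.
apply: ultraS (ultraI St nS) => n [/= h1 h2].
rewrite ltr_norml; move/negP: h2; rewrite -ltNge => h2; lra.
Qed.

Lemma ulim_ex (x : nat -> R[i]) (B : R) : (forall n, modc (x n) <= B) ->
  exists l, ulim U x l.
Proof.
move=> hB.
have [|a ha] := @real_ulim (fun n => complex.Re (x n)) B.
  by move=> n; apply: le_trans (hB n); apply: Re_le_modc.
have [|b hb] := @real_ulim (fun n => complex.Im (x n)) B.
  by move=> n; apply: le_trans (hB n); apply: Im_le_modc.
exists (a +i* b)%C => e e0; have e2 : 0 < e / 2 by lra.
apply: ultraS (ultraI (ha _ e2) (hb _ e2)) => n [/= h1 h2].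
apply: le_lt_trans (modc_le_ReIm _) _; rewrite ReB ImB /=; lra.
Qed.

Lemma ulim_le x l (a : R[i]) (B : R) :
  ulim U x l -> U [set n | modc (x n - a) <= B] -> modc (l - a) <= B.
Proof.
move=> h h'; rewrite leNgt; apply/negP => lB.
have e0 : 0 < modc (l - a) - B by lra.
have [n [/= h1 h2]] := ultra_ex (ultraI (h _ e0) h').
by have := modc_tri (x n) l a; rewrite modcBC in h1; lra.
Qed.

Lemma ultra_inv_lt (e : R) : 0 < e -> U [set n | n.+1%:R^-1 < e].
Proof.
move=> e0; have [m hm] := ltr_add_invr e0; rewrite add0r in hm.
apply: ultraS (ultra_ge m) => n /= mn; apply: le_lt_trans hm.
by rewrite lef_pV2 ?posrE ?ltr0n // ler_nat ltnS.
Qed.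

End Free.

(** The common engine of the local-to-global arguments: [c] is the base point of a datum and [r] its
    size, and Q says that the datum violates the claim. If each violation contains one of half the
    size nearby, violations accumulate at a point p, where a local estimate refutes them. The base
    points converge because the moves form a geometric series. *)
Lemma bisection (S : Type) (c : S -> R[i]) (r : S -> R) (Q : S -> Prop) x0 :
  (forall x, Q x -> 0 <= r x) ->
  (forall x, Q x -> exists y, [/\ Q y, r y <= r x / 2
     & modc (c y - c x) <= r x]) -> Q x0 ->
  exists p, forall d, 0 < d ->
    exists y, [/\ Q y, modc (c y - p) <= 2 * r y & r y < d].
Proof.
move=> r0 hQ Q0.
have hQ' x : exists y, Q x -> [/\ Q y, r y <= r x / 2 & modc (c y - c x) <= r x].
  by have [/hQ[y hy]|nQ] := pselect (Q x); [exists y|exists x].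
have [nx hn] := choice hQ'; pose y n := iter n nx x0.
have Qy n : Q (y n) by elim: n => //= n /hn[].
have yS n : r (y n.+1) <= r (y n) / 2 /\ modc (c (y n.+1) - c (y n)) <= r (y n).
  by have [_] := hn _ (Qy n).
have ry n : 0 <= r (y n) by exact: r0.
have cy n k : modc (c (y (n + k)%N) - c (y n)) <= 2 * r (y n) - 2 * r (y (n + k)%N).
  elim: k => [|k IH]; first by rewrite addn0 subrr modc0; lra.
  rewrite addnS; have [h1 h2] := yS (n + k)%N.
  by have := modc_tri (c (y (n + k)%N)) (c (y (n + k).+1)) (c (y n)); lra.
have [U hU] := free_ultra_exists.
have [|p hp] := @ulim_ex _ hU (c \o y) (modc (c x0) + 2 * r x0).
  move=> n /=; have := cy 0%N n; rewrite add0n /=.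
  by have := ry n; have := modcD (c (y n) - c x0) (c x0); rewrite subrK; lra.
have py n : modc (c (y n) - p) <= 2 * r (y n).
  rewrite modcBC; apply: (ulim_le hU hp).
  apply: ultraS (ultra_ge hU n) => // m /= nm.
  by have := cy n (m - n)%N; rewrite subnKC //; have := ry m; lra.
(* Halving gives much more, but decay like 1 / (n + 1) is all that is needed to get below d. *)
have rn n : r (y n) * n.+1%:R <= 2 * r x0.
  elim: n => [|n IH]; first by rewrite /= mulr1; have := ry 0%N; rewrite /=; lra.
  have [h1 _] := yS n; rewrite mulrS; move: IH; rewrite [n.+1%:R]mulrS => IH.
  have n0 : 0 <= n%:R :> R by [].
  have := ry n.+1; have := ry n; have := ry 0%N; rewrite /= in h1 *; nra.
exists p => d d0.
have e0 : 0 < d / (2 * r x0 + 1) by rewrite divr_gt0 //; have := r0 _ Q0; lra.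
have [n /=] := ultra_ex hU (ultra_inv_lt hU e0).
have x00 := r0 _ Q0.
have n0 : 0 < n.+1%:R :> R by [].
rewrite ltr_pdivlMr; last lra.
rewrite mulrC ltr_pdivrMr // => hn1.
exists (y n); split => //.
rewrite -(@ltr_pM2r _ n.+1%:R) //; apply: le_lt_trans (rn n) _; lra.
Qed.

End UltraLimit.

(** * Complex derivatives *)

Section Derivative.
Variable R : realType.
Implicit Types (f g : R[i] -> R[i]) (z w l p : R[i]) (K : set R[i]).

(** The product form with [<=] includes w = z and avoids division, so it feeds directly into
    estimates. *)
Definition hasD f z l := forall e : R, 0 < e -> exists2 d : R, 0 < d &
  forall w, modc (w - z) < d -> modc (f w - f z - l * (w - z)) <= e * modc (w - z).

(** Differentiability is meant in the full plane even when K is closed, whereas [contin] is relative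
    to K. *)
Definition holo K f := forall z, K z -> exists l, hasD f z l.

Definition contin K f := forall p, K p -> forall e : R, 0 < e ->
  exists2 d : R, 0 < d & forall w, K w -> modc (w - p) < d -> modc (f w - f p) <= e.

Lemma hasD_lip f z l : hasD f z l -> exists2 d : R, 0 < d &
  forall w, modc (w - z) < d -> modc (f w - f z) <= (modc l + 1) * modc (w - z).
Proof.
move=> /(_ 1 ltr01)[d d0 h]; exists d => // w /h {}h.
have := modcD (f w - f z - l * (w - z)) (l * (w - z)).
by rewrite subrK modcM; lra.
Qed.

Lemma hasD_contin f z l (e : R) : hasD f z l -> 0 < e -> exists2 d : R, 0 < d &
  forall w, modc (w - z) < d -> modc (f w - f z) <= e.
Proof.
move=> /hasD_lip[d d0 h] e0; have l0 := modc_ge0 l.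
have l1 : 0 < modc l + 1 by lra.
exists (Num.min d (e / (modc l + 1))) => [|w].
  by rewrite lt_min d0 divr_gt0.
by rewrite lt_min => /andP[/h {}h]; rewrite ltr_pdivlMr // => h'; lra.
Qed.

Lemma holo_contin K f : holo K f -> contin K f.
Proof.
move=> h p Kp e e0; have [l hl] := h p Kp.
by have [d d0 hd] := hasD_contin hl e0; exists d => // w _; exact: hd.
Qed.

Lemma holoS K K' f : (forall z, K' z -> K z) -> holo K f -> holo K' f.
Proof. by move=> KK h z /KK; exact: h. Qed.

Lemma hasD_eq f z l l' : hasD f z l -> l = l' -> hasD f z l'.
Proof. by move=> h <-. Qed.

Lemma hasD_uniq f z l l' : hasD f z l -> hasD f z l' -> l = l'.
Proof.
move=> h h'; apply/eqP; rewrite -subr_eq0; apply/eqP/modc_arch => e e0.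
have e2 : 0 < e / 2 by lra.
have [d d0 hd] := h _ e2; have [d' d'0 hd'] := h' _ e2.
have [t [t0 td td' _]] := exists_lt3 d0 d'0 d'0.
have [w tw] := exists_at_dist z t0.
have h1 := hd w; have h2 := hd' w; rewrite tw in h1 h2.
have {}h1 := h1 td; have {}h2 := h2 td'.
rewrite -(ler_pM2r t0) -[X in _ * X]tw -modcM.
have -> : (l - l') * (w - z) =
  (f w - f z - l' * (w - z)) - (f w - f z - l * (w - z)) by ring.
by have := modcB (f w - f z - l' * (w - z)) (f w - f z - l * (w - z)); lra.
Qed.

Lemma hasD_ext f g z l : (exists2 d : R, 0 < d &
  forall w, modc (w - z) < d -> f w = g w) -> hasD f z l -> hasD g z l.
Proof.
move=> [d d0 fg] h e e0; have [d' d'0 h'] := h e e0.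
exists (Num.min d d'); first by rewrite lt_min d0.
move=> w; rewrite lt_min => /andP[w1 w2].
by rewrite -!fg ?subrr ?modc0 //; exact: h'.
Qed.

Lemma hasD_cst (c : R[i]) z : hasD (fun=> c) z 0.
Proof. by move=> e e0; exists 1 => // w _; rewrite mul0r !subrr modc0 mulr_ge0 ?modc_ge0 ?ltW. Qed.

Lemma hasD_id z : hasD (fun x => x) z 1.
Proof. by move=> e e0; exists 1 => // w _; rewrite mul1r subrr modc0 mulr_ge0 ?modc_ge0 ?ltW. Qed.

Lemma hasDD f g z l l' : hasD f z l -> hasD g z l' ->
  hasD (fun x => f x + g x) z (l + l').
Proof.
move=> h h' e e0; have e2 : 0 < e / 2 by lra.
have [d d0 hd] := h _ e2; have [d' d'0 hd'] := h' _ e2.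
exists (Num.min d d'); first by rewrite lt_min d0.
move=> w; rewrite lt_min => /andP[/hd h1 /hd' h2].
have -> : f w + g w - (f z + g z) - (l + l') * (w - z) =
  (f w - f z - l * (w - z)) + (g w - g z - l' * (w - z)) by ring.
by apply: le_trans (modcD _ _) _; lra.
Qed.

Lemma hasDM f g z l l' : hasD f z l -> hasD g z l' ->
  hasD (fun x => f x * g x) z (l * g z + f z * l').
Proof.
move=> h h' e e0.
have [d1 d10 hd1] := hasD_lip h; have [d2 d20 hd2] := hasD_lip h'.
pose k := (modc l + 1) * (modc l' + 1) + modc (f z) + modc (g z) + 1.
have l0 := modc_ge0 l; have l'0 := modc_ge0 l'.
have fz0 := modc_ge0 (f z); have gz0 := modc_ge0 (g z).
have ll0 : 0 <= (modc l + 1) * (modc l' + 1) by rewrite mulr_ge0 //; lra.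
have k0 : 0 < k by rewrite /k; lra.
have ek : 0 < e / k by rewrite divr_gt0.
have [d d0 hd] := h _ ek; have [d' d'0 hd'] := h' _ ek.
exists (Num.min (Num.min d d') (Num.min (Num.min d1 d2) (e / k))).
  by rewrite !lt_min d0 d'0 d10 d20.
move=> w; rewrite !lt_min => /andP[/andP[/hd w1 /hd' w2] /andP[/andP[/hd1 w3 /hd2 w4] w5]].
have -> : f w * g w - f z * g z - (l * g z + f z * l') * (w - z) =
  (f w - f z - l * (w - z)) * g z + f z * (g w - g z - l' * (w - z)) +
  (f w - f z) * (g w - g z) by ring.
apply: le_trans (modcD _ _) _; apply: (le_trans (lerD (modcD _ _) (lexx _))).
rewrite !modcM.
have m0 := modc_ge0 (w - z).
have E : e = (e / k) * k by rewrite divfK // gt_eqF.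
have A1 : modc (f w - f z - l * (w - z)) * modc (g z) <= e / k * modc (w - z) * modc (g z).
  by rewrite ler_wpM2r.
have A2 : modc (f z) * modc (g w - g z - l' * (w - z)) <= modc (f z) * (e / k * modc (w - z)).
  by rewrite ler_wpM2l.
have A3 : modc (f w - f z) * modc (g w - g z) <=
   ((modc l + 1) * modc (w - z)) * ((modc l' + 1) * modc (w - z)).
  by apply: ler_pM => //; exact: modc_ge0.
have A4 : ((modc l + 1) * modc (w - z)) * ((modc l' + 1) * modc (w - z)) <=
   (modc l + 1) * (modc l' + 1) * (e / k) * modc (w - z).
  rewrite [X in X <= _](_ : _ = (modc l + 1) * (modc l' + 1) * modc (w - z) * modc (w - z)); last ring.
  by rewrite ler_wpM2r // ler_wpM2l // ltW.
have A5 : 0 <= e / k * modc (w - z) by rewrite mulr_ge0 // ltW.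
rewrite [X in _ <= X * _]E; move: (e / k) A1 A2 A4 A5 => t; rewrite /k; lra.
Qed.

Lemma hasDZ (c : R[i]) f z l : hasD f z l -> hasD (fun x => c * f x) z (c * l).
Proof.
by move=> h; apply: hasD_eq (hasDM (hasD_cst c z) h) _; rewrite mul0r add0r.
Qed.

Lemma hasDN f z l : hasD f z l -> hasD (fun x => - f x) z (- l).
Proof.
move=> h; apply: hasD_ext (hasD_eq (hasDZ (-1) h) (mulN1r _)).
by exists 1 => // w _; rewrite mulN1r.
Qed.

Lemma hasDB f g z l l' : hasD f z l -> hasD g z l' ->
  hasD (fun x => f x - g x) z (l - l').
Proof. by move=> h /hasDN; exact: hasDD. Qed.

Lemma hasD_comp f g z l l' : hasD g z l' -> hasD f (g z) l ->
  hasD (fun x => f (g x)) z (l * l').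
Proof.
move=> h' h e e0.
have [d1 d10 hd1] := hasD_lip h'.
pose k := modc l + modc l' + 1.
have l0 := modc_ge0 l; have l'0 := modc_ge0 l'.
have k0 : 0 < k by rewrite /k; lra.
have ek : 0 < e / k by rewrite divr_gt0.
have [d d0 hd] := h _ ek; have [d' d'0 hd'] := h' _ ek.
have dk : 0 < d / (modc l' + 1) by rewrite divr_gt0 //; lra.
exists (Num.min (Num.min d1 d') (d / (modc l' + 1))).
  by rewrite !lt_min dk d'0 d10.
move=> w; rewrite !lt_min => /andP[/andP[/hd1 w1 /hd' w2] w3].
have w4 : modc (g w - g z) < d.
  apply: le_lt_trans w1 _; rewrite mulrC -ltr_pdivlMr //; lra.
have {}w4 := hd _ w4.
have -> : f (g w) - f (g z) - l * l' * (w - z) =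
  (f (g w) - f (g z) - l * (g w - g z)) + l * (g w - g z - l' * (w - z)) by ring.
apply: le_trans (modcD _ _) _; rewrite modcM.
have m0 := modc_ge0 (w - z).
have A1 : e / k * modc (g w - g z) <= e / k * ((modc l' + 1) * modc (w - z)).
  by rewrite ler_wpM2l // ltW.
have A2 : modc l * modc (g w - g z - l' * (w - z)) <= modc l * (e / k * modc (w - z)).
  by rewrite ler_wpM2l.
have E : e = (e / k) * k by rewrite divfK // gt_eqF.
have A5 : 0 <= e / k * modc (w - z) by rewrite mulr_ge0 // ltW.
rewrite [X in _ <= X * _]E; move: (e / k) w2 A1 A2 A5 w4 => t; rewrite /k; lra.
Qed.

Lemma hasDV z : z != 0 -> hasD (fun x => x^-1) z (- (z ^+ 2)^-1).
Proof.
move=> z0 e e0; have mz := modc_gt0 z0.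
have z2 : 0 < modc z / 2 by lra.
pose d := e * modc z ^+ 3 / 2.
have d0 : 0 < d by rewrite /d !mulr_gt0 ?exprn_gt0.
exists (Num.min (modc z / 2) d); first by rewrite lt_min z2.
move=> w; rewrite lt_min => /andP[w1 w2].
have w3 : modc z / 2 < modc w.
  by have := modc_tri w z 0; rewrite !subr0 modcBC; lra.
have w0 : w != 0.
  by apply/eqP => w0; move: w3; rewrite w0 modc0; lra.
have -> : w^-1 - z^-1 - - (z ^+ 2)^-1 * (w - z) = (w - z) ^+ 2 / (w * z ^+ 2).
  by field; rewrite z0 w0.
rewrite modcM modcV modcM !modcX ler_pdivrMr; last by rewrite mulr_gt0 ?exprn_gt0 //; lra.
have A1 : modc (w - z) * modc (w - z) <= modc (w - z) * d by rewrite ler_wpM2l ?modc_ge0 // ltW.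
have A2 : (e * modc (w - z) * modc z ^+ 2) * (modc z / 2) <=
          (e * modc (w - z) * modc z ^+ 2) * modc w.
  by rewrite ler_wpM2l ?(ltW w3) // !mulr_ge0 ?modc_ge0 ?exprn_ge0 // ltW.
rewrite /d in A1; rewrite expr2; nra.
Qed.

End Derivative.

(** * Closed convex sets and the mean value inequality *)

Section Convex.
Variable R : realType.
Implicit Types (f g : R[i] -> R[i]) (z w l p : R[i]) (K : set R[i]).

(** Closed convex sets, encoded by the only two properties that bisection of segments uses. *)
Definition cvxc K := (forall z w, K z -> K w -> K ((z + w) / 2%:R)) /\
  (forall p, (forall e : R, 0 < e -> exists2 z, K z & modc (z - p) < e) -> K p).

Lemma half_midl z w : (z + w) / 2%:R - z = (w - z) / 2%:R.
Proof. by field. Qed.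

Lemma half_midr z w : w - (z + w) / 2%:R = (w - z) / 2%:R.
Proof. by field. Qed.

Definition cball z (r : R) : set R[i] := [set w | modc (w - z) <= r].
Definition oball z (r : R) : set R[i] := [set w | modc (w - z) < r].

Lemma oball_center z (r : R) : 0 < r -> oball z r z.
Proof. by rewrite /oball /= subrr modc0. Qed.

Lemma cvxc_cball z (r : R) : cvxc (cball z r).
Proof.
split=> [x y|p h].
  rewrite /cball /= => h h'; rewrite (_ : (x + y) / 2%:R - z = ((x - z) + (y - z)) / 2%:R); last by field.
  by rewrite modc_half; have := modcD (x - z) (y - z); lra.
rewrite /cball /= leNgt; apply/negP => lt.
have e0 : 0 < modc (p - z) - r by lra.
by have [x] := h _ e0; rewrite /cball /= => h1 h2; have := modc_tri x p z; rewrite modcBC in h2; lra.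
Qed.

Lemma cvxcI K K' : cvxc K -> cvxc K' -> cvxc (K `&` K').
Proof.
move=> [h1 h2] [h3 h4]; split=> [z w [? ?] [? ?]|p h].
  by split; [exact: h1|exact: h3].
by split; [apply: h2|apply: h4] => e /h[z []]; exists z.
Qed.

(** In the local hypothesis p lies within two lengths of the short segment [x, y]. An error that is
    small compared with the distance to p is therefore small compared with the length, so that
    differentiability or continuity at the single point p suffices. *)
Lemma cvxc_bisect K (Q : R[i] -> R[i] -> Prop) z w : cvxc K -> K z -> K w ->
  (forall x y, K x -> K y -> Q x ((x + y) / 2%:R) -> Q ((x + y) / 2%:R) y -> Q x y) ->
  (forall p, K p -> exists2 d : R, 0 < d & forall x y, K x -> K y ->
     modc (x - p) <= 2 * modc (y - x) -> modc (y - x) < d -> Q x y) ->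
  Q z w.
Proof.
move=> cK Kz Kw hmid hloc; apply: contrapT => nQ.
pose B (x : R[i] * R[i]) := [/\ K x.1, K x.2 & ~ Q x.1 x.2].
have [|||p hp] := @bisection R _ fst (fun x => modc (x.2 - x.1)) B (z, w).
- by move=> x _; exact: modc_ge0.
- move=> [x y] [/= Kx Ky nxy]; pose m := (x + y) / 2%:R.
  have Km : K m by exact: cK.1.
  have [Qxm|nxm] := pselect (Q x m).
    have [Qmy|nmy] := pselect (Q m y).
      by exfalso; apply: nxy; exact: hmid.
    exists (m, y); split; rewrite //= ?half_midr ?half_midl modc_half; have := modc_ge0 (y - x); lra.
  exists (x, m); split; rewrite //= ?half_midl ?modc_half ?subrr ?modc0 ?modc_ge0 //; lra.
- by [].
have Kp : K p.
  apply: cK.2 => e e0; have [|y [[Ky _ _] h1 h2]] := hp (e / 2); first lra.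
  by exists y.1 => //; lra.
have [d d0 hd] := hloc p Kp.
have [[x y] [[/= Kx Ky nxy] h1 h2]] := hp d d0.
exact/nxy/hd.
Qed.

Lemma mvt_cvx K f (L : R) : cvxc K ->
  (forall z, K z -> exists2 l, hasD f z l & modc l <= L) ->
  forall z w, K z -> K w -> modc (f w - f z) <= L * modc (w - z).
Proof.
move=> cK h z w Kz Kw.
suff H (e : R) : 0 < e -> modc (f w - f z) <= (L + e) * modc (w - z).
  have m0 := modc_ge0 (w - z); rewrite leNgt; apply/negP => lt.
  have e0 : 0 < (modc (f w - f z) - L * modc (w - z)) / (modc (w - z) + 1).
    by rewrite divr_gt0 ?subr_gt0 // ltr_wpDl.
  have := H _ e0; rewrite mulrDl => {}H.
  have : (modc (f w - f z) - L * modc (w - z)) / (modc (w - z) + 1) * modc (w - z) <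
         modc (f w - f z) - L * modc (w - z); last lra.
  rewrite -mulrA gtr_pMr ?subr_gt0 // mulrC ltr_pdivrMr ?mul1r; lra.
move=> e0.
apply: (@cvxc_bisect K (fun x y => modc (f y - f x) <= (L + e) * modc (y - x)) z w cK) => //.
  move=> x y Kx Ky h1 h2.
  have := modc_tri (f ((x + y) / 2%:R)) (f y) (f x).
  by rewrite half_midl half_midr modc_half in h1 h2; lra.
move=> p Kp; have [l hl lL] := h p Kp.
(* The ends x and y are within 2 and 3 lengths of p, so the errors add up to 5 e / 8 of the
   length. *)
have e8 : 0 < e / 8 by lra.
have [d d0 hd] := hl _ e8; exists (d / 4) => [|x y Kx Ky h1 h2]; first lra.
have xp : modc (x - p) < d by lra.
have yp : modc (y - p) <= 3 * modc (y - x) by have := modc_tri x y p; lra.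
have yd : modc (y - p) < d by lra.
have {}xp := hd _ xp; have {}yd := hd _ yd.
have -> : f y - f x = (f y - f p - l * (y - p)) - (f x - f p - l * (x - p)) + l * (y - x).
  by ring.
have := modcD ((f y - f p - l * (y - p)) - (f x - f p - l * (x - p))) (l * (y - x)).
have := modcB (f y - f p - l * (y - p)) (f x - f p - l * (x - p)).
have : modc l * modc (y - x) <= L * modc (y - x) by rewrite ler_wpM2r ?modc_ge0.
rewrite modcM; have E1 : e / 8 * modc (x - p) <= e / 8 * (2 * modc (y - x)).
  by rewrite ler_wpM2l // ltW.
have E2 : e / 8 * modc (y - p) <= e / 8 * (3 * modc (y - x)).
  by rewrite ler_wpM2l // ltW.
have m0 : 0 <= e * modc (y - x) by rewrite mulr_ge0 ?modc_ge0 // ltW.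
lra.
Qed.

End Convex.

(** * Integrals along segments *)

Section SegmentIntegral.
Variable R : realType.
Implicit Types (f g : R[i] -> R[i]) (z w l p : R[i]) (K : set R[i]).

(* Midpoint Riemann sum of f over 2 ^ n equal pieces of the segment [z, w]. *)
Fixpoint rsum f (n : nat) z w : R[i] :=
  if n is n'.+1 then rsum f n' z ((z + w) / 2%:R) + rsum f n' ((z + w) / 2%:R) w
  else f ((z + w) / 2%:R) * (w - z).

Lemma rsum_rev f n z w : rsum f n w z = - rsum f n z w.
Proof.
elim: n z w => [|n IH] z w; rewrite /= [w + z]addrC.
  by ring.
by rewrite (IH _ w) (IH z) opprD [LHS]addrC.
Qed.

Lemma rsum_lin (a : R[i]) f g n z w :
  rsum (fun x => a * f x + g x) n z w = a * rsum f n z w + rsum g n z w.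
Proof.
elim: n z w => [|n IH] z w /=.
  by ring.
by rewrite !IH; ring.
Qed.

(** Midpoints are sampled for the sake of this exactness: in Goursat's lemma the affine part of f
    then cancels around a triangle by algebra alone. *)
Lemma rsum_aff (a b : R[i]) n z w :
  rsum (fun x => a * x + b) n z w = a * (w ^+ 2 - z ^+ 2) / 2%:R + b * (w - z).
Proof.
elim: n z w => [|n IH] z w /=.
  by field.
by rewrite !IH; field.
Qed.

Lemma rsum_cst (b : R[i]) n z w : rsum (fun=> b) n z w = b * (w - z).
Proof.
elim: n z w => [|n IH] z w //=.
by rewrite !IH; field.
Qed.

Lemma eq_rsum K f g n z w : cvxc K -> K z -> K w -> (forall x, K x -> f x = g x) ->
  rsum f n z w = rsum g n z w.
Proof.
move=> cK + + fg; elim: n z w => [|n IH] z w Kz Kw /=.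
  by rewrite fg //; exact: cK.1.
have Km : K ((z + w) / 2%:R) by exact: cK.1.
by rewrite !IH.
Qed.

Lemma rsum_le K f (M : R) n z w : cvxc K -> K z -> K w ->
  (forall x, K x -> modc (f x) <= M) -> modc (rsum f n z w) <= M * modc (w - z).
Proof.
move=> cK + + fM; elim: n z w => [|n IH] z w Kz Kw /=.
  by rewrite modcM ler_wpM2r ?modc_ge0 // fM //; exact: cK.1.
have Km : K ((z + w) / 2%:R) by exact: cK.1.
have := IH _ _ Kz Km; have := IH _ _ Km Kw.
rewrite half_midl half_midr modc_half.
have := modcD (rsum f n z ((z + w) / 2%:R)) (rsum f n ((z + w) / 2%:R) w).
lra.
Qed.

Lemma rsum_near K f (M : R) (c : R[i]) n z w : cvxc K -> K z -> K w ->
  (forall x, K x -> modc (f x - c) <= M) ->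
  modc (rsum f n z w - c * (w - z)) <= M * modc (w - z).
Proof.
move=> cK Kz Kw fM.
have -> : rsum f n z w - c * (w - z) = rsum (fun x => 1 * f x + - c) n z w.
  by rewrite rsum_lin rsum_cst; ring.
by apply: rsum_le cK Kz Kw _ => x /fM; rewrite mul1r.
Qed.

(** Bisection replaces uniform continuity: near p the sums of every depth are within e / 2 of
    [f p * (y - x)], and a sum of depth n + 1 on a segment is the total of the sums of depth n on
    its halves. *)
Lemma rsum_cauchy K f z w (e : R) : cvxc K -> K z -> K w -> contin K f -> 0 < e ->
  exists n0, forall n m, (n0 <= n)%N ->
    modc (rsum f (n + m) z w - rsum f n z w) <= e * modc (w - z).
Proof.
move=> cK Kz Kw cf e0.
pose Q z w := exists n0, forall n m, (n0 <= n)%N ->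
    modc (rsum f (n + m) z w - rsum f n z w) <= e * modc (w - z).
apply: (@cvxc_bisect _ K Q) => //.
  move=> x y Kx Ky [n1 h1] [n2 h2]; exists (maxn n1 n2).+1 => -[//|n] m.
  rewrite ltnS geq_max => /andP[/h1 {}h1 /h2 {}h2]; rewrite addSn /=.
  have := h1 m; have := h2 m; rewrite half_midl half_midr modc_half.
  set a := rsum _ _ _ _; set b := rsum _ _ _ _; set c := rsum _ _ _ _; set d := rsum _ _ _ _.
  have -> : c + a - (d + b) = (c - d) + (a - b) by ring.
  have := modcD (c - d) (a - b); lra.
move=> p Kp; have e2 : 0 < e / 2 by lra.
have [d d0 hd] := cf p Kp _ e2.
exists (d / 4) => [|x y Kx Ky h1 h2]; first lra.
have m0 := modc_ge0 (y - x).
pose K' := K `&` cball p (3 * modc (y - x)).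
have cK' : cvxc K' by apply: cvxcI => //; exact: cvxc_cball.
have K'x : K' x by split=> //; rewrite /cball /=; lra.
have K'y : K' y by split=> //; rewrite /cball /=; have := modc_tri x y p; lra.
have near n : modc (rsum f n x y - f p * (y - x)) <= e / 2 * modc (y - x).
  apply: (rsum_near _ cK') => // t [Kt]; rewrite /cball /= => tp.
  by apply: hd => //; lra.
exists 0%N => n m _.
have := modc_tri (f p * (y - x)) (rsum f (n + m) x y) (rsum f n x y).
have := near n; have := near (n + m)%N.
by rewrite [modc (f p * _ - _)]modcBC; lra.
Qed.

Definition isint f z w l := forall e : R, 0 < e ->
  exists n0, forall n, (n0 <= n)%N -> modc (rsum f n z w - l) <= e.

Definition segint f z w := xget 0 [set l | isint f z w l].

Lemma isint_uniq f z w l l' : isint f z w l -> isint f z w l' -> l = l'.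
Proof.
move=> h h'; apply/eqP; rewrite -subr_eq0; apply/eqP/modc_arch => e e0.
have e2 : 0 < e / 2 by lra.
have [n {}h] := h _ e2; have [n' {}h'] := h' _ e2.
have := h _ (leq_maxl n n'); have := h' _ (leq_maxr n n').
by have := modc_tri (rsum f (maxn n n') z w) l l'; rewrite [modc (l - rsum _ _ _ _)]modcBC; lra.
Qed.

Lemma segintE f z w l : isint f z w l -> segint f z w = l.
Proof. by move=> h; apply: isint_uniq (h); exact: (@xgetPex _ 0 _ (ex_intro _ l h)). Qed.

Section On.
Variables (K : set R[i]) (cK : cvxc K).

Lemma segintP f z w : contin K f -> K z -> K w -> isint f z w (segint f z w).
Proof.
move=> cf Kz Kw.
suff [l hl] : exists l, isint f z w l by rewrite (segintE hl).
have [U hU] := free_ultra_exists.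
have [n0 h0] := rsum_cauchy cK Kz Kw cf ltr01.
(* The ultralimit only proposes a value; the Cauchy property then makes it a genuine limit. *)
have [n|l hl] := @ulim_ex R _ hU (fun n => rsum f (n0 + n) z w)
  (modc (rsum f n0 z w) + 1 * modc (w - z)).
  have := modcD (rsum f (n0 + n) z w - rsum f n0 z w) (rsum f n0 z w).
  by rewrite subrK; have := h0 n0 n (leqnn _); lra.
exists l => e e0; have m0 := modc_ge0 (w - z).
have em : 0 < e / (modc (w - z) + 1) by rewrite divr_gt0 //; lra.
have [n1 h1] := rsum_cauchy cK Kz Kw cf em.
exists n1 => n nn; rewrite modcBC; apply: (ulim_le hU hl).
apply: ultraS (ultra_ge hU n) => // k /= nk.
have nk' : (n <= n0 + k)%N by apply: leq_trans nk (leq_addl _ _).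
have := h1 n (n0 + k - n)%N nn; rewrite subnKC // => h; apply: le_trans h _.
rewrite -mulrA ler_piMr ?(ltW e0) // mulrC ler_pdivrMr ?mul1r; lra.
Qed.

Lemma segint_lin (a : R[i]) f g z w : contin K f -> contin K g -> K z -> K w ->
  segint (fun x => a * f x + g x) z w = a * segint f z w + segint g z w.
Proof.
move=> cf cg Kz Kw; apply: segintE => e e0.
have a0 := modc_ge0 a.
have e1 : 0 < e / 2 / (modc a + 1) by rewrite divr_gt0 //; lra.
have e2 : 0 < e / 2 by lra.
have [n1 h1] := segintP cf Kz Kw e1; have [n2 h2] := segintP cg Kz Kw e2.
exists (maxn n1 n2) => n; rewrite geq_max => /andP[/h1 {}h1 /h2 {}h2].
rewrite rsum_lin; set u := rsum f _ _ _ in h1 *; set v := rsum g _ _ _ in h2 *.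
have -> : a * u + v - (a * segint f z w + segint g z w) =
  a * (u - segint f z w) + (v - segint g z w) by ring.
have := modcD (a * (u - segint f z w)) (v - segint g z w); rewrite modcM.
have : modc a * modc (u - segint f z w) <= modc a * (e / 2 / (modc a + 1)).
  by rewrite ler_wpM2l.
have : modc a * (e / 2 / (modc a + 1)) <= e / 2.
  by rewrite mulrCA ler_piMr ?(ltW e2) // ler_pdivrMr ?mul1r; lra.
lra.
Qed.

Lemma segint_aff (a b : R[i]) z w :
  segint (fun x => a * x + b) z w = a * (w ^+ 2 - z ^+ 2) / 2%:R + b * (w - z).
Proof.
apply: segintE => e e0; exists 0%N => n _.
by rewrite rsum_aff subrr modc0 ltW.
Qed.

Lemma segint_cst (b : R[i]) z w : segint (fun=> b) z w = b * (w - z).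
Proof.
by apply: segintE => e e0; exists 0%N => n _; rewrite rsum_cst subrr modc0 ltW.
Qed.

Lemma eq_segint f g z w : contin K f -> K z -> K w -> (forall x, K x -> f x = g x) ->
  segint g z w = segint f z w.
Proof.
move=> cf Kz Kw fg; apply: segintE => e e0.
have [n0 h] := segintP cf Kz Kw e0; exists n0 => n /h.
by rewrite (eq_rsum n cK Kz Kw fg).
Qed.

Lemma segint_le f (M : R) z w : contin K f -> K z -> K w ->
  (forall x, K x -> modc (f x) <= M) -> modc (segint f z w) <= M * modc (w - z).
Proof.
move=> cf Kz Kw fM; rewrite leNgt; apply/negP => lt.
have e0 : 0 < (modc (segint f z w) - M * modc (w - z)) / 2 by lra.
have [n0 /(_ n0 (leqnn _)) h] := segintP cf Kz Kw e0.
have := rsum_le n0 cK Kz Kw fM.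
have := modc_tri (rsum f n0 z w) (segint f z w) 0; rewrite !subr0.
by rewrite modcBC in h; lra.
Qed.

Lemma segint_rev f z w : contin K f -> K z -> K w -> segint f w z = - segint f z w.
Proof.
move=> cf Kz Kw; apply: segintE => e e0.
have [n0 h] := segintP cf Kz Kw e0; exists n0 => n /h.
by rewrite (rsum_rev _ _ z w) -opprD modcN.
Qed.

Lemma segint_mid f z w : contin K f -> K z -> K w ->
  segint f z w = segint f z ((z + w) / 2%:R) + segint f ((z + w) / 2%:R) w.
Proof.
move=> cf Kz Kw; have Km : K ((z + w) / 2%:R) by exact: cK.1.
apply: segintE => e e0; have e2 : 0 < e / 2 by lra.
have [n1 h1] := segintP cf Kz Km e2; have [n2 h2] := segintP cf Km Kw e2.
exists (maxn n1 n2).+1 => -[//|n]; rewrite ltnS geq_max => /andP[/h1 {}h1 /h2 {}h2] /=.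
rewrite opprD addrACA; apply: le_trans (modcD _ _) _; lra.
Qed.

End On.

Lemma segint_near K f (M : R) (c : R[i]) z w : cvxc K -> contin K f -> K z -> K w ->
  (forall x, K x -> modc (f x - c) <= M) ->
  modc (segint f z w - c * (w - z)) <= M * modc (w - z).
Proof.
move=> cK cf Kz Kw fM.
have cc : contin K (fun=> - c).
  by move=> p _ e e0; exists 1 => // x _ _; rewrite subrr modc0 ltW.
have cfc : contin K (fun x => 1 * f x + - c).
  move=> p Kp e /(cf p Kp)[d d0 hd]; exists d => // x Kx /hd => /(_ Kx).
  by have -> : 1 * f x + - c - (1 * f p + - c) = f x - f p by ring.
have -> : segint f z w - c * (w - z) = segint (fun x => 1 * f x + - c) z w.
  by rewrite (segint_lin cK) // segint_cst; ring.
by apply: (segint_le cK) => // x /fM; rewrite mul1r.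
Qed.

Lemma contin_sub K K' f : (forall x, K' x -> K x) -> contin K f -> contin K' f.
Proof.
move=> KK cf p /KK Kp e /(cf p Kp)[d d0 hd]; exists d => // x /KK; exact: hd.
Qed.

Lemma ftc K F f z w : cvxc K -> contin K f -> (forall x, K x -> hasD F x (f x)) -> K z -> K w ->
  segint f z w = F w - F z.
Proof.
move=> cK cf FD Kz Kw; apply/eqP; rewrite eq_sym -subr_eq0; apply/eqP/modc_arch => e' e'0.
pose e := e' / (modc (w - z) + 1); have m0 := modc_ge0 (w - z).
have e0 : 0 < e by rewrite /e divr_gt0 //; lra.
apply: (@le_trans _ _ (e * modc (w - z))); last first.
  by rewrite /e -mulrA ler_piMr ?(ltW e'0) // mulrC ler_pdivrMr ?mul1r; lra.
pose Q z w := modc (F w - F z - segint f z w) <= e * modc (w - z).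
apply: (@cvxc_bisect _ K Q) => //; rewrite /Q.
  move=> x y Kx Ky; rewrite half_midl half_midr modc_half (segint_mid cK cf Kx Ky).
  set m := _ / _; set I1 := segint _ _ _; set I2 := segint _ _ _.
  have -> : F y - F x - (I1 + I2) = (F m - F x - I1) + (F y - F m - I2) by ring.
  have := modcD (F m - F x - I1) (F y - F m - I2); lra.
(* The errors of F at y and x and of the integral are 3 e / 8, 2 e / 8 and e / 8 of the length. *)
move=> p Kp; have e8 : 0 < e / 8 by lra.
have [d d0 hd] := FD p Kp _ e8; have [d' d'0 hd'] := cf p Kp _ e8.
exists (Num.min d d' / 4) => [|x y Kx Ky h1 h2].
  by rewrite divr_gt0 // lt_min d0.
have dd : Num.min d d' <= d /\ Num.min d d' <= d' by rewrite !ge_min !lexx orbT.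
have mm := modc_ge0 (y - x).
have yp : modc (y - p) <= 3 * modc (y - x) by have := modc_tri x y p; lra.
pose K' := K `&` cball p (3 * modc (y - x)).
have cK' : cvxc K' by apply: cvxcI => //; exact: cvxc_cball.
have K'x : K' x by split=> //; rewrite /cball /=; lra.
have K'y : K' y by split=> //; rewrite /cball /=; lra.
have near' : modc (segint f x y - f p * (y - x)) <= e / 8 * modc (y - x).
  apply: (segint_near cK') => // [|t [Kt]].
    by apply: contin_sub cf => t [].
  by rewrite /cball /= => tp; apply: hd' => //; lra.
have xd : modc (x - p) < d by lra.
have yd : modc (y - p) < d by lra.
have {}xd := hd _ xd; have {}yd := hd _ yd.
have E1 : e / 8 * modc (x - p) <= e / 8 * (2 * modc (y - x)).
  by rewrite ler_wpM2l // ltW.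
have E2 : e / 8 * modc (y - p) <= e / 8 * (3 * modc (y - x)).
  by rewrite ler_wpM2l // ltW.
have -> : F y - F x - segint f x y = (F y - F p - f p * (y - p)) -
  (F x - F p - f p * (x - p)) - (segint f x y - f p * (y - x)) by ring.
have := modcB ((F y - F p - f p * (y - p)) - (F x - F p - f p * (x - p)))
   (segint f x y - f p * (y - x)).
have := modcB (F y - F p - f p * (y - p)) (F x - F p - f p * (x - p)).
have e8m : 0 <= e * modc (y - x) by rewrite mulr_ge0 // ltW.
lra.
Qed.

End SegmentIntegral.

(** * Goursat's lemma and primitives *)

Section Goursat.
Variable R : realType.
Implicit Types (f g : R[i] -> R[i]) (z w l p : R[i]) (K : set R[i]).

Definition tper x y z : R := modc (y - x) + modc (z - y) + modc (x - z).

Lemma tper_ge0 x y z : 0 <= tper x y z.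
Proof. by rewrite /tper !addr_ge0 ?modc_ge0. Qed.

Lemma tper_corner x y z :
  tper x ((x + y) / 2%:R) ((z + x) / 2%:R) = tper x y z / 2.
Proof.
rewrite /tper (_ : (x + y) / 2%:R - x = (y - x) / 2%:R); last by field.
rewrite (_ : (z + x) / 2%:R - (x + y) / 2%:R = (z - y) / 2%:R); last by field.
rewrite (_ : x - (z + x) / 2%:R = (x - z) / 2%:R); last by field.
by rewrite !modc_half -!mulrDl.
Qed.

Lemma tper_rot x y z : tper y z x = tper x y z.
Proof. by rewrite /tper [LHS]addrC addrA. Qed.

Lemma tper_medial x y z :
  tper ((x + y) / 2%:R) ((y + z) / 2%:R) ((z + x) / 2%:R) = tper x y z / 2.
Proof.
rewrite /tper (_ : (y + z) / 2%:R - (x + y) / 2%:R = - ((x - z) / 2%:R)); last by field.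
rewrite (_ : (z + x) / 2%:R - (y + z) / 2%:R = - ((y - x) / 2%:R)); last by field.
rewrite (_ : (x + y) / 2%:R - (z + x) / 2%:R = - ((z - y) / 2%:R)); last by field.
by rewrite !modcN !modc_half -!mulrDl -[in LHS]addrA; congr (_ / _); exact: addrC.
Qed.

Definition tint f x y z := segint f x y + segint f y z + segint f z x.

Lemma tint_split K f x y z : cvxc K -> contin K f -> K x -> K y -> K z ->
  tint f x y z = tint f x ((x + y) / 2%:R) ((z + x) / 2%:R) +
                 tint f y ((y + z) / 2%:R) ((x + y) / 2%:R) +
                 tint f z ((z + x) / 2%:R) ((y + z) / 2%:R) +
                 tint f ((x + y) / 2%:R) ((y + z) / 2%:R) ((z + x) / 2%:R).
Proof.
move=> cK cf Kx Ky Kz; rewrite /tint.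
have K1 : K ((x + y) / 2%:R) by exact: cK.1.
have K2 : K ((y + z) / 2%:R) by exact: cK.1.
have K3 : K ((z + x) / 2%:R) by exact: cK.1.
rewrite (segint_mid cK cf Kx Ky) (segint_mid cK cf Ky Kz) (segint_mid cK cf Kz Kx).
rewrite (segint_rev cK cf K1 K2) (segint_rev cK cf K2 K3) (segint_rev cK cf K3 K1).
ring.
Qed.

(** The four medial triangles have half the perimeter, so their thresholds [q] add up to the
    threshold of the whole triangle and cannot all be respected. *)
Lemma tint_quarter K f x y z (e : R) : cvxc K -> contin K f -> K x -> K y -> K z ->
  e * tper x y z ^+ 2 < modc (tint f x y z) ->
  exists u v w, [/\ K u, K v & K w] /\ [/\ e * tper u v w ^+ 2 < modc (tint f u v w),
    tper u v w <= tper x y z / 2 & modc (u - x) <= tper x y z].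
Proof.
move=> cK cf Kx Ky Kz h.
have K1 : K ((x + y) / 2%:R) by exact: cK.1.
have K2 : K ((y + z) / 2%:R) by exact: cK.1.
have K3 : K ((z + x) / 2%:R) by exact: cK.1.
have T := tint_split cK cf Kx Ky Kz.
have P1 := tper_corner x y z; have P2 := tper_corner y z x.
have P3 := tper_corner z x y; have P4 := tper_medial x y z.
rewrite (tper_rot x y z) in P2; rewrite -(tper_rot z x y) in P3.
have D : modc ((x + y) / 2%:R - x) <= modc (y - x).
  by rewrite half_midl modc_half; have := modc_ge0 (y - x); lra.
have Pxy : tper x y z = modc (y - x) + modc (z - y) + modc (x - z) by [].
have t1 := modc_ge0 (y - x); have t2 := modc_ge0 (z - y); have t3 := modc_ge0 (x - z).
move: P1 P2 P3 P4 K1 K2 K3 T D.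
set m1 := (x + y) / 2%:R; set m2 := (y + z) / 2%:R; set m3 := (z + x) / 2%:R.
move: m1 m2 m3 => m1 m2 m3 P1 P2 P3 P4 K1 K2 K3 T D.
move: Pxy P1 P2 P3 P4 h; set P := tper x y z => Pxy P1 P2 P3 P4 h.
pose q := e * (P / 2) ^+ 2.
have [L1|L1] := leP (modc (tint f x m1 m3)) q; last first.
  by exists x, m1, m3; split=> //; rewrite P1; split => //; rewrite subrr modc0 Pxy !addr_ge0.
have [L2|L2] := leP (modc (tint f y m2 m1)) q; last first.
  by exists y, m2, m1; split=> //; rewrite P2; split => //; rewrite Pxy -addrA lerDl addr_ge0.
have [L3|L3] := leP (modc (tint f z m3 m2)) q; last first.
  by exists z, m3, m2; split=> //; rewrite P3; split => //; rewrite Pxy modcBC lerDr addr_ge0.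
have [L4|L4] := leP (modc (tint f m1 m2 m3)) q; last first.
  exists m1, m2, m3; split=> //; rewrite P4; split => //.
  by apply: le_trans D _; rewrite Pxy -addrA lerDl addr_ge0.
exfalso; move: h; apply/negP; rewrite -leNgt T.
have E : q + q + q + q = e * P ^+ 2 by rewrite /q; field.
rewrite -E; apply: le_trans (modcD _ _) _; apply: lerD L4.
apply: le_trans (modcD _ _) _; apply: lerD L3.
by apply: le_trans (modcD _ _) _; apply: lerD L2.
Qed.

(** The affine part of f at p contributes nothing. What remains is at most e times 3 perimeters,
    along a contour whose length is one perimeter. *)
Lemma tint_near K f x y z p l (e : R) : cvxc K -> holo K f -> K x -> K y -> K z ->
  0 <= e -> modc (x - p) <= 2 * tper x y z ->
  (forall t, K t -> modc (t - p) <= 3 * tper x y z ->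
     modc (f t - f p - l * (t - p)) <= e * modc (t - p)) ->
  modc (tint f x y z) <= 3 * e * tper x y z ^+ 2.
Proof.
move=> cK hf Kx Ky Kz e0 xp hd.
have Pxy : tper x y z = modc (y - x) + modc (z - y) + modc (x - z) by [].
have t1 := modc_ge0 (y - x); have t2 := modc_ge0 (z - y); have t3 := modc_ge0 (x - z).
have P0 := tper_ge0 x y z.
pose K' := K `&` cball p (3 * tper x y z).
have cK' : cvxc K' by apply: cvxcI => //; exact: cvxc_cball.
have K'x : K' x by split=> //; rewrite /cball /=; lra.
have K'y : K' y by split=> //; rewrite /cball /=; have := modc_tri x y p; lra.
have K'z : K' z.
  by split=> //; rewrite /cball /=; have := modc_tri x z p; rewrite [modc (z - x)]modcBC; lra.
have caff : contin K' (fun t => (- l) * t + (l * p - f p)).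
  apply: (@holo_contin _ K') => t _; exists ((- l) * 1 + 0).
  by apply: hasDD; [apply: hasDZ; exact: hasD_id|exact: hasD_cst].
have cf' : contin K' f by apply: contin_sub (holo_contin hf) => t [].
pose g t := 1 * f t + ((- l) * t + (l * p - f p)).
have cg : contin K' g.
  apply: (@holo_contin _ K') => t [/hf[lt hlt] _]; exists (1 * lt + ((- l) * 1 + 0)).
  apply: hasDD; first exact: hasDZ.
  by apply: hasDD; [apply: hasDZ; exact: hasD_id|exact: hasD_cst].
have gle t : K' t -> modc (g t) <= e * (3 * tper x y z).
  move=> [Kt]; rewrite /cball /= => tp.
  have -> : g t = f t - f p - l * (t - p) by rewrite /g; ring.
  by apply: le_trans (hd _ _ _) _ => //; rewrite ler_wpM2l.
have G : tint f x y z = segint g x y + segint g y z + segint g z x.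
  by rewrite /tint !(segint_lin cK' 1 cf' caff) // !segint_aff; field.
have L1 := segint_le cK' cg K'x K'y gle; have L2 := segint_le cK' cg K'y K'z gle.
have L3 := segint_le cK' cg K'z K'x gle.
rewrite G; apply: le_trans (modcD _ _) _.
apply: le_trans (lerD (modcD _ _) (lexx _)) _.
apply: le_trans (lerD (lerD L1 L2) L3) _.
rewrite -!mulrDr -Pxy [X in X <= _](_ : _ = 3 * e * tper x y z ^+ 2) //; ring.
Qed.

Lemma goursat K f a b c : cvxc K -> holo K f -> K a -> K b -> K c ->
  segint f a b + segint f b c + segint f c a = 0.
Proof.
move=> cK hf Ka Kb Kc; rewrite -/(tint f a b c).
apply: modc_arch => e' e'0.
pose e := e' / (tper a b c ^+ 2 + 1).
have p20 : 0 <= tper a b c ^+ 2 by rewrite sqr_ge0.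
have e0 : 0 < e by rewrite /e divr_gt0 //; lra.
apply: (@le_trans _ _ (e * tper a b c ^+ 2)); last first.
  by rewrite /e -mulrA ler_piMr ?(ltW e'0) // mulrC ler_pdivrMr ?mul1r; lra.
rewrite leNgt; apply/negP => lt.
pose Q (x : R[i] * R[i] * R[i]) := [/\ K x.1.1, K x.1.2, K x.2 &
  e * tper x.1.1 x.1.2 x.2 ^+ 2 < modc (tint f x.1.1 x.1.2 x.2)].
have [|||p hp] := @bisection R _ (fun x => x.1.1) (fun x => tper x.1.1 x.1.2 x.2) Q (a, b, c).
- by move=> x _; exact: tper_ge0.
- move=> [[x y] z] [/= Kx Ky Kz h].
  have [u [v [w [[Ku Kv Kw] [h1 h2 h3]]]]] := tint_quarter cK (holo_contin hf) Kx Ky Kz h.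
  by exists (u, v, w).
- by split.
have Kp : K p.
  apply: cK.2 => d d0; have [|y [[Ky _ _ _] h1 h2]] := hp (d / 2); first by lra.
  by exists y.1.1 => //; lra.
(* The local bound is then 3 / 4 of the threshold, against a strict lower bound by the full
   threshold. *)
have [l hl] := hf p Kp; have e4 : 0 < e / 4 by lra.
have [d d0 hd] := hl _ e4.
have [|[[x y] z] [[/= Kx Ky Kz h] h1 h2]] := hp (d / 4); first by lra.
have P0 := tper_ge0 x y z.
have := tint_near cK hf Kx Ky Kz (ltW e4) h1 (l := l).
have hd' t : K t -> modc (t - p) <= 3 * tper x y z ->
  modc (f t - f p - l * (t - p)) <= e / 4 * modc (t - p).
  by move=> _ tp; apply: hd; lra.
move=> /(_ hd'); have : 0 <= e * tper x y z ^+ 2 by rewrite mulr_ge0 ?sqr_ge0 ?ltW.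
lra.
Qed.

(** The primitive integrates along radii. Goursat on the triangle a, z, w turns its increment into
    the integral over the short segment from z to w. *)
Lemma primitive f a (rho : R) : holo (oball a rho) f ->
  exists F, forall z, oball a rho z -> hasD F z (f z).
Proof.
move=> hf; exists (segint f a) => z za e e0.
have za' : modc (z - a) < rho by [].
(* A closed ball strictly between z and the boundary, as [cvxc] asks for closed sets. *)
pose r := (modc (z - a) + rho) / 2; pose K := cball a r.
have cK : cvxc K by exact: cvxc_cball.
have Ko x : K x -> oball a rho x by rewrite /K /cball /oball /= /r; lra.
have hK : holo K f by apply: holoS hf.
have cf := holo_contin hK.
have m0 := modc_ge0 (z - a).
have Ka : K a by rewrite /K /cball /= subrr modc0 /r; lra.
have Kz : K z by rewrite /K /cball /= /r; lra.
have [d d0 hd] := cf z Kz e e0.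
exists (Num.min d ((rho - modc (z - a)) / 2)).
  by rewrite lt_min d0; lra.
move=> w; rewrite lt_min => /andP[wd wr].
have Kw : K w by rewrite /K /cball /= /r; have := modc_tri z w a; lra.
have G := goursat cK hK Ka Kz Kw.
have -> : segint f a w - segint f a z = segint f z w.
  by rewrite [segint f w a](segint_rev cK cf Ka Kw) in G; rewrite -[RHS]subr0 -G; ring.
pose K' := K `&` cball z (modc (w - z)).
have cK' : cvxc K' by apply: cvxcI => //; exact: cvxc_cball.
apply: (segint_near cK').
- by apply: contin_sub cf => t [].
- by split=> //; rewrite /cball /= subrr modc0 modc_ge0.
- by split=> //; rewrite /cball /=.
by move=> t [Kt]; rewrite /cball /= => tz; apply: hd => //; lra.
Qed.

End Goursat.

(** * Compactness and square contours *)

Section Compactness.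
Variable R : realType.
Implicit Types (f g : R[i] -> R[i]) (z w l p : R[i]) (K : set R[i]).

(** Sequential compactness in a form that gives the sequence itself a limit in K, with no passage to
    a subsequence. *)
Definition ucomp K := forall U, free_ultra U -> forall x : nat -> R[i],
  (forall n, K (x n)) -> exists2 l, K l & ulim U x l.

Lemma ucomp_bounded_closed K (B : R) :
  (forall p, (forall e : R, 0 < e -> exists2 z, K z & modc (z - p) < e) -> K p) ->
  (forall z, K z -> modc z <= B) -> ucomp K.
Proof.
move=> cK bK U hU x Kx; have [n|l hl] := ulim_ex hU (x := x) (B := B); first exact: bK.
exists l => //; apply: cK => e e0.
by have [n /= xn] := ultra_ex hU (hl e e0); exists (x n).
Qed.

Lemma ucomp_cball a (r : R) : ucomp (cball a r).
Proof.
apply: (@ucomp_bounded_closed _ (modc a + r)); first exact: (cvxc_cball a r).2.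
by rewrite /cball => z /= za; have := modc_tri a z 0; rewrite !subr0; lra.
Qed.

Lemma ucomp_contin_bounded K f : ucomp K -> contin K f ->
  exists M : R, forall z, K z -> modc (f z) <= M.
Proof.
move=> uK cf; apply: contrapT => nM.
have bad (n : nat) : exists z, K z /\ n%:R < modc (f z).
  apply: contrapT => nz; apply: nM; exists n%:R => z Kz.
  by rewrite leNgt; apply/negP => lt; apply: nz; exists z.
have [x hx] := choice bad.
have [U hU] := free_ultra_exists.
have [l Kl xl] := uK U hU x (fun n => (hx n).1).
have [d d0 hd] := cf l Kl 1 ltr01.
pose m := (Num.truncn (modc (f l) + 1)).+1.
have [n [/= xn mn]] := ultra_ex hU (ultraI hU (xl d d0) (ultra_ge hU m)).
have := hd _ (hx n).1 xn; have [_ hn] := hx n.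
have := modc_tri (f l) (f (x n)) 0; rewrite !subr0.
have : modc (f l) + 1 < m%:R by apply: truncnS_gt.
have : m%:R <= n%:R :> R by rewrite ler_nat.
lra.
Qed.

Lemma ucomp_unif K f (e : R) : ucomp K -> contin K f -> 0 < e ->
  exists2 d : R, 0 < d & forall z w, K z -> K w -> modc (z - w) < d ->
    modc (f z - f w) <= e.
Proof.
move=> uK cf e0; apply: contrapT => nd.
have bad (n : nat) : exists zw : R[i] * R[i], [/\ K zw.1, K zw.2,
    modc (zw.1 - zw.2) < n.+1%:R^-1 & e < modc (f zw.1 - f zw.2)].
  apply: contrapT => nz; apply: nd; exists n.+1%:R^-1; first by rewrite invr_gt0.
  move=> z w Kz Kw zw; rewrite leNgt; apply/negP => lt.
  by apply: nz; exists (z, w).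
have [x hx] := choice bad.
have [U hU] := free_ultra_exists.
have Kx n : K (x n).1 by have [] := hx n.
have [l Kl xl] := uK U hU _ Kx.
have e2 : 0 < e / 2 by lra.
have [d d0 hd] := cf l Kl _ e2; have d2 : 0 < d / 2 by lra.
have [n [/= xn nd2]] := ultra_ex hU (ultraI hU (xl _ d2) (ultra_inv_lt hU d2)).
have [K1 K2 h12 ef] := hx n.
have h1 := hd _ K1; have h2 := hd _ K2.
have {}h12 := lt_trans h12 nd2.
have : modc ((x n).2 - l) < d.
  by have := modc_tri (x n).1 (x n).2 l; rewrite [modc ((x n).2 - (x n).1)]modcBC; lra.
move=> /h2; have : modc ((x n).1 - l) < d by lra.
move=> /h1; have := modc_tri (f l) (f (x n).1) (f (x n).2).
by rewrite [modc (f l - _)]modcBC; lra.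
Qed.

End Compactness.

Section Contour.
Variable R : realType.
Implicit Types (f g : R[i] -> R[i]) (z w l p u v : R[i]) (K : set R[i]).

Lemma ReD z w : complex.Re (z + w) = complex.Re z + complex.Re w.
Proof. by case: z w => a b [c d]. Qed.

Lemma ImD z w : complex.Im (z + w) = complex.Im z + complex.Im w.
Proof. by case: z w => a b [c d]. Qed.

Lemma Re_half z : complex.Re (z / 2%:R) = complex.Re z / 2.
Proof.
have {2}-> : z = z / 2%:R + z / 2%:R by field.
by rewrite ReD; field.
Qed.

Lemma cvxc_line b v (t : R) : cvxc [set z | complex.Re ((z - b) * v) = t].
Proof.
split=> [z w /= hz hw|p /= h].
  have -> : ((z + w) / 2%:R - b) * v = ((z - b) * v + (w - b) * v) / 2%:R by field.
  by rewrite Re_half ReD hz hw; field.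
apply/eqP; rewrite -subr_eq0 -normr_le0 leNgt; apply/negP => lt.
have v0 : 0 < modc v + 1 by have := modc_ge0 v; lra.
have [z /= zt zp] := h _ (divr_gt0 lt v0).
rewrite ltr_pdivlMr // in zp; have := modc_ge0 (z - p).
have : `|complex.Re ((p - b) * v) - t| <= modc (z - p) * modc v.
  rewrite -zt -ReB; apply: le_trans (Re_le_modc _) _.
  have -> : (p - b) * v - (z - b) * v = - ((z - p) * v) by ring.
  by rewrite modcN modcM.
lra.
Qed.

Definition ci : R[i] := ('i)%C.

Lemma ci_sqr : ci * ci = -1.
Proof. by rewrite -expr2 sqr_i. Qed.

Lemma modc_ci : modc ci = 1. Proof. exact: modc_i. Qed.

(** The outward unit normals of the four sides of the square contour. *)
Definition unit4 u := [\/ u = 1, u = ci, u = -1 | u = - ci].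

Lemma modc_unit4 u : unit4 u -> modc u = 1.
Proof. by case=> ->; rewrite ?modcN ?modc_ci ?modc1. Qed.

Lemma unit4_neq0 u : unit4 u -> u != 0.
Proof.
move=> /modc_unit4 u1; apply/eqP => u0; move: u1; rewrite u0 modc0 => /eqP.
by rewrite eq_sym oner_eq0.
Qed.

Section Square.
Variables (a : R[i]) (s : R).
Hypothesis s0 : 0 < s.

(** [corner u] and [corner' u] are the first and last point, counterclockwise, of the side with
    outward normal u. *)
Definition corner u : R[i] := a + (s%:C)%C * u * (1 - ci).
Definition corner' u : R[i] := a + (s%:C)%C * u * (1 + ci).

(* Counterclockwise integral along the boundary of the square with centre a
   and side length 2 s. *)
Definition cint f : R[i] :=
  segint f (corner 1) (corner' 1) + segint f (corner ci) (corner' ci) +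
  segint f (corner (-1)) (corner' (-1)) + segint f (corner (- ci)) (corner' (- ci)).

(** An annulus around the contour, whose points are at distance between s and sqrt 2 s from a.
    Bounds on the annulus involve the modulus only. *)
Definition ring_set : set R[i] := [set z | s <= modc (z - a) <= 2 * s].

(** The whole chord that carries the side: longer than the side, but convex and contained in the
    annulus. *)
Definition side u : set R[i] :=
  [set z | complex.Re ((z - a) * u^-1) = s] `&` cball a (2 * s).

Lemma cvxc_side u : cvxc (side u).
Proof. by apply: cvxcI; [exact: cvxc_line|exact: cvxc_cball]. Qed.

Lemma side_ring u : unit4 u -> forall z, side u z -> ring_set z.
Proof.
move=> u4 z [/= zs]; rewrite /cball /ring_set /= => -> ; rewrite andbT.
rewrite -zs; apply: le_trans (ler_norm _) _; apply: le_trans (Re_le_modc _) _.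
by rewrite modcM modcV (modc_unit4 u4) invr1 mulr1.
Qed.

Lemma modc_s : modc (s%:C)%C = s.
Proof. by rewrite modc_real gtr0_norm. Qed.

Lemma side_point u (x : R) : unit4 u -> `|x| <= 1 ->
  side u (a + (s%:C)%C * u * (1 + (x%:C)%C * ci)).
Proof.
move=> u4 x1; split => /=.
  have -> : (a + (s%:C)%C * u * (1 + (x%:C)%C * ci) - a) * u^-1 =
    (s%:C)%C * (1 + (x%:C)%C * ci) by field; exact: unit4_neq0.
  by rewrite /ci /=; ring.
rewrite /cball /= addrC addKr !modcM modc_s (modc_unit4 u4) mulr1 mulrC ler_wpM2r ?(ltW s0) //.
by apply: le_trans (modcD _ _) _; rewrite modc1 modcM modc_ci modc_real mulr1; lra.
Qed.

Lemma cornerE u : corner u = a + (s%:C)%C * u * (1 + ((-1)%:C)%C * ci).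
Proof. by rewrite rmorphN rmorph1 mulN1r. Qed.

Lemma corner'E u : corner' u = a + (s%:C)%C * u * (1 + (1%:C)%C * ci).
Proof. by rewrite rmorph1 mul1r. Qed.

Lemma side_corner u : unit4 u -> side u (corner u).
Proof. by move=> u4; rewrite cornerE; apply: side_point => //; rewrite normrN normr1. Qed.

Lemma side_corner' u : unit4 u -> side u (corner' u).
Proof. by move=> u4; rewrite corner'E; apply: side_point => //; rewrite normr1. Qed.

Lemma unit41 : unit4 1. Proof. exact: Or41. Qed.
Lemma unit4i : unit4 ci. Proof. exact: Or42. Qed.
Lemma unit4N1 : unit4 (-1). Proof. exact: Or43. Qed.
Lemma unit4Ni : unit4 (- ci). Proof. exact: Or44. Qed.
Hint Resolve unit41 unit4i unit4N1 unit4Ni side_corner side_corner' : core.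

Lemma side_contin f u : unit4 u -> contin ring_set f -> contin (side u) f.
Proof. by move=> u4; apply: contin_sub; exact: side_ring. Qed.
Hint Resolve side_contin cvxc_side : core.

Lemma cint_lin b f g : contin ring_set f -> contin ring_set g ->
  cint (fun x => b * f x + g x) = b * cint f + cint g.
Proof.
move=> cf cg; rewrite /cint.
have H u : unit4 u -> segint (fun x => b * f x + g x) (corner u) (corner' u) =
  b * segint f (corner u) (corner' u) + segint g (corner u) (corner' u).
  by move=> u4; rewrite (segint_lin (cvxc_side u)) //; auto.
by rewrite !H //; ring.
Qed.

Lemma eq_cint f g : contin ring_set f -> (forall z, ring_set z -> f z = g z) ->
  cint g = cint f.
Proof.
move=> cf fg; rewrite /cint.
have H u : unit4 u -> segint g (corner u) (corner' u) = segint f (corner u) (corner' u).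
  move=> u4; rewrite (eq_segint (cvxc_side u) (f := f)) //; auto.
  by move=> x /(side_ring u4) /fg.
by rewrite !H.
Qed.

Lemma cint_le f (M : R) : contin ring_set f -> (forall z, ring_set z -> modc (f z) <= M) ->
  modc (cint f) <= 8 * s * M.
Proof.
move=> cf fM; rewrite /cint.
have H u : unit4 u -> modc (segint f (corner u) (corner' u)) <= 2 * s * M.
  move=> u4; have -> : 2 * s * M = M * modc (corner' u - corner u).
    rewrite (_ : corner' u - corner u = 2%:R * (s%:C)%C * u * ci).
      by rewrite !modcM modc_ci (modc_unit4 u4) modc_s modc_nat; ring.
    by rewrite /corner /corner'; ring.
  apply: (segint_le (cvxc_side u)); auto.
  by move=> z /(side_ring u4) /fM.
apply: le_trans (modcD _ _) _; apply: (le_trans (lerD (modcD _ _) (lexx _))).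
apply: (le_trans (lerD (lerD (modcD _ _) (lexx _)) (lexx _))).
have := H _ unit41; have := H _ unit4i; have := H _ unit4N1; have := H _ unit4Ni.
lra.
Qed.

Lemma cint_ftc F f : contin ring_set f -> (forall z, ring_set z -> hasD F z (f z)) ->
  cint f = 0.
Proof.
move=> cf hF; rewrite /cint.
have H u : unit4 u -> segint f (corner u) (corner' u) = F (corner' u) - F (corner u).
  move=> u4; rewrite (ftc (cvxc_side u) (F := F)) //; auto.
  by move=> z /(side_ring u4) /hF.
rewrite !H //.
(* Each side ends where the next one begins, so the increments of F telescope around the square. *)
have S u : corner' u = corner (u * ci).
  rewrite /corner /corner'; congr (_ + _); rewrite -!mulrA; congr (_ * (_ * _)).
  by rewrite mulrBr mulr1 ci_sqr opprK addrC.
rewrite !S mul1r mulN1r mulNr ci_sqr opprK; ring.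
Qed.

(** At [a + s u (1 + m i)] the form dz / (z - a) equals (m + i) dm / (1 + m^2). Its imaginary part
    is at least dm / 2 because m^2 <= 1, and this bound is additive under subdivision. *)
Lemma Im_rsum_side n u (x y : R) : unit4 u -> -1 <= x -> x <= y -> y <= 1 ->
  (y - x) / 2 <= complex.Im (rsum (fun z => (z - a)^-1) n
    (a + (s%:C)%C * u * (1 + (x%:C)%C * ci)) (a + (s%:C)%C * u * (1 + (y%:C)%C * ci))).
Proof.
move=> u4; have u0 := unit4_neq0 u4.
have s00 : (s%:C)%C != 0 :> R[i].
  by apply/eqP => s00; move: s0; rewrite -modc_s s00 modc0 ltxx.
have mid (x' y' : R) : (a + (s%:C)%C * u * (1 + (x'%:C)%C * ci) +
    (a + (s%:C)%C * u * (1 + (y'%:C)%C * ci))) / 2%:R =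
    a + (s%:C)%C * u * (1 + (((x' + y') / 2)%:C)%C * ci).
  by rewrite rmorphM fmorphV rmorphD rmorph_nat; field.
have rsumS f k z w : rsum f k.+1 z w =
  rsum f k z ((z + w) / 2%:R) + rsum f k ((z + w) / 2%:R) w by [].
have rsum0 f z w : rsum f 0 z w = f ((z + w) / 2%:R) * (w - z) by [].
elim: n x y => [|n IH] x y x1 xy y1; last first.
  rewrite rsumS mid ImD.
  have := IH x ((x + y) / 2); have := IH ((x + y) / 2) y; lra.
rewrite rsum0 mid.
  set m := (x + y) / 2.
  have m1 : m ^+ 2 <= 1 by rewrite /m; nra.
  clearbody m.
  have m2 : 0 <= m ^+ 2 by exact: sqr_ge0.
  have mm : 1 + m ^+ 2 != 0 by apply/eqP; lra.
  have mc0 : 1 + (m%:C)%C * ci != 0 :> R[i].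
    by apply/eqP => /(congr1 (@complex.Re R)); rewrite /ci /= mulr0 mul0r !subr0 addr0 => /eqP; rewrite oner_eq0.
  have -> : (a + (s%:C)%C * u * (1 + (m%:C)%C * ci) - a)^-1 *
    (a + (s%:C)%C * u * (1 + (y%:C)%C * ci) - (a + (s%:C)%C * u * (1 + (x%:C)%C * ci))) =
    (((y - x) / (1 + m ^+ 2))%:C)%C * ((m%:C)%C + ci).
    have -> : (m%:C)%C + ci = ci * (1 + (m ^+ 2)%:C)%C / (1 + (m%:C)%C * ci).
      apply: (mulIf mc0); rewrite divfK // rmorphXn /=.
      have := ci_sqr => E; rewrite mulrDl !mulrDr mulr1 [(m%:C)%C * (_ * _)]mulrA.
      rewrite [ci * (_ * ci)]mulrCA E; ring.
    rewrite rmorphM fmorphV rmorphB rmorphD rmorph1; field.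
    rewrite [a + _]addrC addrK !mulf_neq0 // andbT mc0 /= -rmorphXn.
    by rewrite -[1 + _](rmorphD (real_complex R) 1) fmorph_eq0.
  rewrite (_ : complex.Im _ = (y - x) / (1 + m ^+ 2)); last by rewrite /ci /=; field.
  by rewrite ler_wpM2l ?subr_ge0 // lef_pV2 ?posrE; lra.
Qed.

Lemma contin_kernel z : modc (z - a) < s -> holo ring_set (fun x => (x - z)^-1).
Proof.
move=> za x /andP[xs _].
have xz : x - z != 0.
  apply/eqP => /eqP; rewrite subr_eq0 => /eqP xz; move: xs; rewrite xz; lra.
exists (- ((x - z) ^+ 2)^-1 * (1 - 0)).
apply: (@hasD_comp _ (fun x => x^-1) (fun x => x - z)); last exact: hasDV.
by apply: hasDB; [exact: hasD_id|exact: hasD_cst].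
Qed.

(** Each side contributes an imaginary part of at least 1, which excludes cancellation without
    computing any angle. *)
Lemma cint_center_neq0 : cint (fun z => (z - a)^-1) != 0.
Proof.
have H u : unit4 u -> 1 <= complex.Im (segint (fun z => (z - a)^-1) (corner u) (corner' u)).
  move=> u4; rewrite leNgt; apply/negP => lt.
  have ck : contin (side u) (fun z => (z - a)^-1).
    by apply: side_contin => //; apply: holo_contin; apply: contin_kernel; rewrite subrr modc0.
  set I := segint _ _ _ in lt; have e0 : 0 < (1 - complex.Im I) / 2 by lra.
  have [n /(_ n (leqnn _)) h] := segintP (cvxc_side u) ck (side_corner u4) (side_corner' u4) e0.
  have := Im_rsum_side n u4 (lexx _) (_ : -1 <= 1) (lexx 1).
  rewrite -cornerE -corner'E.
  have := le_trans (Im_le_modc _) h; rewrite ImB -/I ler_norml => /andP[_].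
  set J := complex.Im _; lra.
apply/eqP => /(congr1 (@complex.Im R)); rewrite /cint !ImD /=.
have := H _ unit41; have := H _ unit4i; have := H _ unit4N1; have := H _ unit4Ni.
lra.
Qed.

End Square.
End Contour.

(** * Cauchy's formula *)

Section CauchyFormula.
Variable R : realType.
Implicit Types (f g F : R[i] -> R[i]) (z w l p u v a : R[i]) (K : set R[i]).

Lemma continM K f g : contin K f -> contin K g -> contin K (fun x => f x * g x).
Proof.
move=> cf cg p Kp e e0.
have fp := modc_ge0 (f p); have gp := modc_ge0 (g p).
pose k := modc (f p) + modc (g p) + 1; have k0 : 0 < k by rewrite /k; lra.
pose t := Num.min 1 (e / k).
have t0 : 0 < t by rewrite lt_min ltr01 divr_gt0.
have [d d0 hd] := cf p Kp t t0; have [d' d'0 hd'] := cg p Kp t t0.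
exists (Num.min d d') => [|w Kw]; first by rewrite lt_min d0.
rewrite lt_min => /andP[/(hd w Kw) h1 /(hd' w Kw) h2].
have -> : f w * g w - f p * g p = (f w - f p) * g p + f p * (g w - g p) +
  (f w - f p) * (g w - g p) by ring.
have t1 : t <= 1 by rewrite ge_min lexx.
have tk : t * k <= e by rewrite -ler_pdivlMr // ge_min lexx orbT.
apply: le_trans (modcD _ _) _; apply: (le_trans (lerD (modcD _ _) (lexx _))).
rewrite !modcM; apply: le_trans tk.
have A1 : modc (f w - f p) * modc (g p) <= t * modc (g p) by rewrite ler_wpM2r.
have A2 : modc (f p) * modc (g w - g p) <= modc (f p) * t by rewrite ler_wpM2l.
have A3 : modc (f w - f p) * modc (g w - g p) <= t * 1.
  by apply: ler_pM => //; [exact: modc_ge0|exact: modc_ge0|lra].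
rewrite /k; lra.
Qed.

Lemma contin_cst K (c : R[i]) : contin K (fun=> c).
Proof. by move=> p _ e e0; exists 1 => // x _ _; rewrite subrr modc0 ltW. Qed.

Lemma contin_lin K b f g : contin K f -> contin K g -> contin K (fun x => b * f x + g x).
Proof.
move=> cf cg p Kp t t0; have t2 : 0 < t / 2 by lra.
have [d1 d10 h1] := continM (contin_cst b) cf Kp t2.
have [d2 d20 h2] := cg p Kp _ t2.
exists (Num.min d1 d2) => [|x Kx]; first by rewrite lt_min d10.
rewrite lt_min => /andP[/(h1 x Kx) {}h1 /(h2 x Kx) {}h2].
rewrite opprD addrACA; apply: le_trans (modcD _ _) _; lra.
Qed.

Section Square.
Variables (a : R[i]) (s : R).
Hypothesis s0 : 0 < s.

Lemma ucomp_ring : ucomp (ring_set a s).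
Proof.
apply: (@ucomp_bounded_closed _ _ (modc a + 2 * s)) => [p h|z /andP[_ zs]]; last first.
  by have := modc_tri a z 0; rewrite !subr0; lra.
apply/andP; split; rewrite leNgt; apply/negP => lt.
  have e0 : 0 < s - modc (p - a) by lra.
  by have [z /andP[z1 _] zp] := h _ e0; have := modc_tri p z a; lra.
have e0 : 0 < modc (p - a) - 2 * s by lra.
have [z /andP[_ z1] zp] := h _ e0; have := modc_tri z p a.
by rewrite [modc (p - z)]modcBC; lra.
Qed.

Lemma ring_far z x : modc (z - a) < s -> ring_set a s x ->
  s - modc (z - a) <= modc (x - z).
Proof. by move=> za /andP[xs _]; have := modc_tri z x a; lra. Qed.

Lemma ring_neq z x : modc (z - a) < s -> ring_set a s x -> x - z != 0.
Proof.
move=> za /(ring_far za) h; apply/eqP => xz; move: h; rewrite xz modc0; lra.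
Qed.

Lemma cint_hasD (G : R[i] -> R[i] -> R[i]) (G' : R[i] -> R[i]) z :
  contin (ring_set a s) G' ->
  (forall e : R, 0 < e -> exists2 d : R, 0 < d & forall w, modc (w - z) < d ->
     contin (ring_set a s) (G w) /\ forall x, ring_set a s x ->
       modc (G w x - G z x - G' x * (w - z)) <= e * modc (w - z)) ->
  hasD (fun w => cint a s (G w)) z (cint a s G').
Proof.
move=> cG' h e e0; have e8 : 0 < e / (8 * s) by rewrite divr_gt0 // mulr_gt0.
have [d d0 hd] := h _ e8; exists d => // w wz.
have [cw hw] := hd w wz.
have [cz _] : contin (ring_set a s) (G z) /\ True.
  by have [] := hd z; rewrite ?subrr ?modc0.
have c1 := contin_lin (- 1) cz cw.
have -> : cint a s (G w) - cint a s (G z) - cint a s G' * (w - z) =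
  cint a s (fun x => - (w - z) * G' x + ((- 1) * G z x + G w x)).
  by rewrite (cint_lin s0 (- (w - z)) cG' c1) (cint_lin s0 (- 1) cz cw); ring.
have c2 := contin_lin (- (w - z)) cG' c1.
apply: le_trans (cint_le s0 c2 (M := e / (8 * s) * modc (w - z)) _) _.
  move=> x /hw; rewrite (_ : - (w - z) * G' x + (-1 * G z x + G w x) =
    G w x - G z x - G' x * (w - z)) //; ring.
by rewrite mulrA [8 * s * _]mulrC divfK // gt_eqF // mulr_gt0.
Qed.

Lemma cint_hasD2 (G : R[i] -> R[i] -> R[i]) (G' : R[i] -> R[i]) z (C d : R) :
  contin (ring_set a s) G' -> 0 < d ->
  (forall w, modc (w - z) < d ->
     contin (ring_set a s) (G w) /\ forall x, ring_set a s x ->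
       modc (G w x - G z x - G' x * (w - z)) <= C * modc (w - z) ^+ 2) ->
  hasD (fun w => cint a s (G w)) z (cint a s G').
Proof.
move=> cG' d0 h; apply: cint_hasD => // e e0.
have C0 : 0 < `|C| + 1 by have := normr_ge0 C; lra.
exists (Num.min d (e / (`|C| + 1))); first by rewrite lt_min d0 divr_gt0.
move=> w; rewrite lt_min ltr_pdivlMr // => /andP[wd we].
have [cw hw] := h w wd; split=> // x /hw H; apply: le_trans H _.
rewrite expr2 mulrA ler_wpM2r ?modc_ge0 //.
have := ler_norm C; have := modc_ge0 (w - z); have := normr_ge0 C; nra.
Qed.

Section CauchyTransform.
Variable phi : R[i] -> R[i].
Hypothesis cphi : contin (ring_set a s) phi.

Let ck z : modc (z - a) < s -> contin (ring_set a s) (fun x => (x - z)^-1).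
Proof. by move=> za; apply: holo_contin; exact: contin_kernel. Qed.

Let half_ball z w : modc (z - a) < s -> modc (w - z) < (s - modc (z - a)) / 2 ->
  modc (w - a) < s /\ forall x, ring_set a s x -> (s - modc (z - a)) / 2 <= modc (x - w).
Proof.
move=> za wz; have := modc_tri z w a => h; split; first by lra.
by move=> x /(ring_far za) h1; have := modc_tri w x z; lra.
Qed.

Lemma cauchy_type1 z : modc (z - a) < s ->
  hasD (fun z => cint a s (fun x => phi x * (x - z)^-1)) z
       (cint a s (fun x => phi x * ((x - z)^-1 * (x - z)^-1))).
Proof.
move=> za; have [M hM] := ucomp_contin_bounded ucomp_ring cphi.
(* For w within d of z, all points of the annulus are at distance at least d from both w and z, so
   each inverse is at most 1 / d. *)
pose d := (s - modc (z - a)) / 2; have d0 : 0 < d by rewrite /d; lra.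
apply: (@cint_hasD2 (fun w x => phi x * (x - w)^-1) _ z (M / d ^+ 3) d) => //.
  by apply: continM => //; apply: continM; exact: ck.
move=> w wz; have [wa xw] := half_ball za wz; split; first by apply: continM => //; exact: ck.
move=> x rx; have x1 := xw x rx; have x2 := ring_far za rx.
have xz := ring_neq za rx; have xw0 := ring_neq wa rx.
have -> : phi x * (x - w)^-1 - phi x * (x - z)^-1 - phi x * ((x - z)^-1 * (x - z)^-1) * (w - z) =
  phi x * ((x - w)^-1 * (x - z)^-1 * (x - z)^-1) * (w - z) ^+ 2 by field; rewrite xz.
rewrite modcM modcX ler_wpM2r ?exprn_ge0 ?modc_ge0 // !modcM !modcV.
apply: ler_pM; rewrite ?mulr_ge0 ?invr_ge0 ?modc_ge0 ?hM //.
rewrite -exprVn exprSr expr2; rewrite -/d in x1.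
have dx : d <= modc (x - z) by rewrite /d in d0 *; lra.
have dd t : d <= t -> t^-1 <= d^-1 by move=> dt; rewrite lef_pV2 ?posrE //; exact: lt_le_trans dt.
by apply: ler_pM; rewrite ?mulr_ge0 ?invr_ge0 ?modc_ge0 ?dd //; apply: ler_pM; rewrite ?invr_ge0 ?modc_ge0 ?dd.
Qed.

Lemma cauchy_type2 z : modc (z - a) < s -> exists l,
  hasD (fun z => cint a s (fun x => phi x * ((x - z)^-1 * (x - z)^-1))) z l.
Proof.
move=> za; have [M hM] := ucomp_contin_bounded ucomp_ring cphi.
pose d := (s - modc (z - a)) / 2; have d0 : 0 < d by rewrite /d; lra.
exists (cint a s (fun x => phi x * (2%:R * ((x - z)^-1 * ((x - z)^-1 * (x - z)^-1))))).
apply: (@cint_hasD2 (fun w x => phi x * ((x - w)^-1 * (x - w)^-1)) _ z (M * (3 / d ^+ 4)) d) => //.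
  by apply: continM => //; apply: continM; [exact: contin_cst|do 2?[apply: continM; first exact: ck]; exact: ck].
move=> w wz; have [wa xw] := half_ball za wz; split.
  by apply: continM => //; apply: continM; exact: ck.
move=> x rx; have x1 := xw x rx; have x2 := ring_far za rx.
have xz := ring_neq za rx; have xw0 := ring_neq wa rx.
set k := (x - w)^-1; set k' := (x - z)^-1.
(* The second order remainder has one term of the first kind and two of the second, hence the 3 in
   the bound. *)
have -> : phi x * (k * k) - phi x * (k' * k') - phi x * (2%:R * (k' * (k' * k'))) * (w - z) =
  phi x * (k * k * (k' * k') + 2%:R * (k * (k' * (k' * k')))) * (w - z) ^+ 2.
  by rewrite /k /k'; field; rewrite xz.
rewrite modcM modcX ler_wpM2r ?exprn_ge0 ?modc_ge0 // modcM.
apply: ler_pM; rewrite ?modc_ge0 ?hM //.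
rewrite -/d in x1; have dx : d <= modc (x - z) by rewrite /d in d0 *; lra.
have dd t : d <= t -> t^-1 <= d^-1 by move=> dt; rewrite lef_pV2 ?posrE //; exact: lt_le_trans dt.
have k1 : modc k <= d^-1 by rewrite /k modcV dd.
have k2 : modc k' <= d^-1 by rewrite /k' modcV dd.
have m1 := modc_ge0 k; have m2 := modc_ge0 k'.
apply: le_trans (modcD _ _) _; rewrite !modcM modc_nat.
have kk : modc k * modc k <= d^-1 * d^-1 by apply: ler_pM.
have kk' : modc k' * modc k' <= d^-1 * d^-1 by apply: ler_pM.
have kkk : modc k * modc k' <= d^-1 * d^-1 by apply: ler_pM.
have q1 : modc k * modc k * (modc k' * modc k') <= d^-1 * d^-1 * (d^-1 * d^-1).
  by apply: ler_pM => //; rewrite mulr_ge0.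
have q2 : modc k * modc k' * (modc k' * modc k') <= d^-1 * d^-1 * (d^-1 * d^-1).
  by apply: ler_pM => //; rewrite mulr_ge0.
rewrite (_ : 3 / d ^+ 4 = 3 * (d^-1 * d^-1 * (d^-1 * d^-1))); first by lra.
by field; rewrite gt_eqF.
Qed.

End CauchyTransform.

(* Its value is 2 pi i, but only its non-vanishing matters. *)
Definition ckernel : R[i] := cint a s (fun x => (x - a)^-1).

Lemma ckernel_neq0 : ckernel != 0. Proof. exact: cint_center_neq0. Qed.

(** The derivative in z is a contour integral of a function with primitive [- (x - z)^-1], hence
    zero, so the value at the centre persists. *)
Lemma cint_kernel z : modc (z - a) < s -> cint a s (fun x => (x - z)^-1) = ckernel.
Proof.
move=> za; apply/eqP; rewrite -subr_eq0; apply/eqP/modc_le0.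
have cK := cvxc_cball a (modc (z - a)).
have c1 := contin_cst 1 : contin (ring_set a s) _.
have D w : modc (w - a) < s -> hasD (fun z => cint a s (fun x => (x - z)^-1)) w 0.
  move=> wa; have H := cauchy_type1 c1 wa.
  have -> : 0 = cint a s (fun x => 1 * ((x - w)^-1 * (x - w)^-1)).
    have ck : contin (ring_set a s) (fun x => (x - w)^-1).
      by apply: holo_contin; exact: contin_kernel.
    rewrite (@cint_ftc _ _ _ s0 (fun x => - (x - w)^-1)) //.
      by apply: continM => //; exact: continM.
    move=> x rx; have xw := ring_neq wa rx.
    apply: hasD_eq (hasDN (hasD_comp (f := fun x => x^-1)
      (hasDB (hasD_id x) (hasD_cst w x)) (hasDV xw))) _.
    by field.
  apply: hasD_ext H; exists 1 => // v _; congr cint; apply/funext => x; exact: mul1r.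
rewrite -[X in _ <= X](mul0r (modc (z - a))).
apply: (mvt_cvx cK (f := fun z => cint a s (fun x => (x - z)^-1)) (L := 0)).
- move=> w; rewrite /cball /= => wa; exists 0; last by rewrite modc0.
  by apply: D; lra.
- by rewrite /cball /= subrr modc0 modc_ge0.
- by rewrite /cball /=.
Qed.

(** The function [F (z + t (x - z)) / (x - z)] interpolates between the constant numerator F z at t
    = 0 and F x at t = 1. The t-derivative of its contour integral is the integral of
    [f (z + t (x - z))], which has a primitive in x and vanishes. Continuity of f = F' is what
    justifies differentiation under the integral. *)
Lemma cauchy_C1 F f (rho : R) z : 5 * s < rho ->
  (forall x, oball a rho x -> hasD F x (f x)) -> contin (oball a rho) f ->
  modc (z - a) < s -> cint a s (fun x => F x * (x - z)^-1) = ckernel * F z.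
Proof.
move=> srho hF cf za.
have ck : contin (ring_set a s) (fun x => (x - z)^-1).
  by apply: holo_contin; exact: contin_kernel.
have s_gt0 := s0; have cK5 := cvxc_cball a (5 * s).
have K5o x : cball a (5 * s) x -> oball a rho x by rewrite /cball /oball /=; lra.
have xz3 x : ring_set a s x -> modc (x - z) <= 3 * s.
  by move=> /andP[_ xa]; have := modc_tri a x z; rewrite [modc (a - z)]modcBC; lra.
(* Here the 5 originates: t runs over the unit disc, enlarged to 4 / 3 for increments up to 1 / 3,
   and [x - z] is at most 3 s, so the point is within s + 4 s of a. *)
have inK t x : ring_set a s x -> modc t <= 4 / 3 -> cball a (5 * s) (z + t * (x - z)).
  move=> /xz3 rx t1; rewrite /cball /=.
  have -> : z + t * (x - z) - a = (z - a) + t * (x - z) by ring.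
  apply: le_trans (modcD _ _) _; rewrite modcM.
  have : modc t * modc (x - z) <= 4 / 3 * (3 * s) by apply: ler_pM; rewrite ?modc_ge0.
  lra.
have cdil g t : contin (oball a rho) g -> modc t <= 4 / 3 ->
    contin (ring_set a s) (fun x => g (z + t * (x - z))).
  move=> cg t1 p rp e e0; have [d d0 hd] := cg _ (K5o _ (inK t p rp t1)) e e0.
  exists (d / 2) => [|x rx xp]; first by lra.
  apply: hd; first exact/K5o/inK.
  have -> : z + t * (x - z) - (z + t * (p - z)) = t * (x - p) by ring.
  rewrite modcM; apply: le_lt_trans (_ : 4 / 3 * modc (x - p) < d); last lra.
  by rewrite ler_wpM2r ?modc_ge0.
have cF : contin (oball a rho) F by apply: holo_contin => x /hF; exists (f x).
pose G t x := F (z + t * (x - z)) * (x - z)^-1.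
have D t : modc t <= 1 -> hasD (fun t => cint a s (G t)) t 0.
  move=> t1; have t1' : modc t <= 4 / 3 by lra.
  have cft := cdil f t cf t1'.
  have -> : 0 = cint a s (fun x => f (z + t * (x - z))).
    have [t0|tn0] := eqVneq t 0.
      rewrite (@cint_ftc _ _ _ s0 (fun x => f z * x)) // => x rx.
      by apply: hasD_eq (hasDZ (f z) (hasD_id x)) _; rewrite t0 mul0r addr0 mulr1.
    rewrite (@cint_ftc _ _ _ s0 (fun x => t^-1 * F (z + t * (x - z)))) // => x rx.
    apply: hasD_eq (hasDZ _ (hasD_comp (f := F) (g := fun x => z + t * (x - z)) (hasDD (hasD_cst z x)
      (hasDZ t (hasDB (hasD_id x) (hasD_cst z x)))) (hF _ (K5o _ (inK t x rx t1'))))) _.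
    by field.
  apply: cint_hasD => // e e0.
  have [d d0 hd] := ucomp_unif (@ucomp_cball R a (5 * s)) (contin_sub K5o cf) e0.
  exists (Num.min (1 / 3) (d / (3 * s))).
    by rewrite lt_min; apply/andP; split; [lra|rewrite divr_gt0 // mulr_gt0].
  move=> w; rewrite lt_min => /andP[wt wd].
  have w1 : modc w <= 4 / 3.
    by have := modc_tri t w 0; rewrite !subr0; lra.
  split; first by apply: continM => //; exact: cdil.
  move=> x rx; have xz := ring_neq za rx.
  set P := z + t * (x - z); set Q := z + w * (x - z).
  have QP : Q - P = (w - t) * (x - z) by rewrite /P /Q; ring.
  have KP : cball a (5 * s) P by exact: inK.
  have KQ : cball a (5 * s) Q by exact: inK.
  pose K' := cball a (5 * s) `&` cball P (modc (Q - P)).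
  have cK' : cvxc K' by apply: cvxcI => //; exact: cvxc_cball.
  have K'P : K' P by split => //; rewrite /cball /= subrr modc0 modc_ge0.
  have K'Q : K' Q by split => //; rewrite /cball /=.
  have QPd : modc (Q - P) < d.
    rewrite QP modcM; apply: le_lt_trans (_ : modc (w - t) * (3 * s) < d).
      by rewrite ler_wpM2l ?modc_ge0 ?xz3.
    by rewrite -ltr_pdivlMr // mulr_gt0.
  have L : modc ((F Q - f P * Q) - (F P - f P * P)) <= e * modc (Q - P).
    apply: (mvt_cvx cK' (f := fun y => F y - f P * y)) => // y [Ky]; rewrite /cball /= => yP.
    exists (f y - f P * 1).
      by apply: hasDB; [exact/hF/K5o|apply: hasDZ; exact: hasD_id].
    by rewrite mulr1; apply: hd => //; lra.
  have -> : G w x - G t x - f P * (w - t) =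
    ((F Q - f P * Q) - (F P - f P * P)) * (x - z)^-1.
    rewrite /G -/P -/Q; have -> : f P * (w - t) = f P * (Q - P) * (x - z)^-1.
      by rewrite QP; field.
    ring.
  rewrite modcM modcV; apply: le_trans (ler_wpM2r _ L) _; first by rewrite invr_ge0 modc_ge0.
  rewrite QP modcM -!mulrA ler_wpM2l ?(ltW e0) // mulfV ?mulr1 // gt_eqF //.
  exact: modc_gt0.
have := mvt_cvx (cvxc_cball 0 1) (f := fun t => cint a s (G t)) (L := 0) _ (_ : cball 0 1 0) (_ : cball 0 1 1).
rewrite mul0r => H.
have {}H : cint a s (G 1) = cint a s (G 0).
  apply/eqP; rewrite -subr_eq0; apply/eqP/modc_le0; apply: H.
  - move=> t; rewrite /cball /= subr0 => /D Dt; exists 0 => //.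
    by rewrite modc0.
  - by rewrite /cball /= subrr modc0.
  - by rewrite /cball /= subr0 modc1.
have -> : cint a s (fun x => F x * (x - z)^-1) = cint a s (G 1).
  by congr cint; apply/funext => x; rewrite /G mul1r [z + _]addrC subrK.
rewrite H; have -> : G 0 = (fun x => F z * (x - z)^-1 + 0).
  by apply/funext => x; rewrite /G mul0r addr0 addr0.
rewrite (cint_lin s0 (F z) ck (contin_cst 0)) (cint_kernel za) mulrC.
by rewrite [X in _ + X](_ : _ = 0) ?addr0 // /cint !segint_cst !mul0r !addr0.
Qed.

Lemma cauchy_formula f (rho : R) z : 5 * s < rho -> holo (oball a rho) f ->
  modc (z - a) < s -> cint a s (fun x => f x * (x - z)^-1) = ckernel * f z.
Proof.
move=> srho hf za; have [F hF] := primitive hf.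
have ck : contin (ring_set a s) (fun x => (x - z)^-1).
  by apply: holo_contin; exact: contin_kernel.
have cf := holo_contin hf.
have s_gt0 := s0.
have rO x : ring_set a s x -> oball a rho x by rewrite /oball /= => /andP[_ h]; lra.
have cfr := contin_sub rO cf.
have cF : contin (ring_set a s) F.
  by apply: holo_contin => x /rO/hF; exists (f x).
have D1 := cauchy_type1 cF za.
have D2 : hasD (fun z => cint a s (fun x => F x * (x - z)^-1)) z (ckernel * f z).
  have zo : oball a rho z by rewrite /oball /=; lra.
  apply: hasD_ext (hasDZ ckernel (hF z zo)).
  exists (s - modc (z - a)); first by lra.
  move=> w wz; rewrite (cauchy_C1 srho hF cf) //.
  by have := modc_tri z w a; lra.
rewrite -(hasD_uniq D1 D2).
have c1 : contin (ring_set a s) (fun x => f x * (x - z)^-1) by exact: continM.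
have c2 : contin (ring_set a s) (fun x => F x * ((x - z)^-1 * (x - z)^-1)).
  by apply: continM => //; exact: continM.
have := cint_lin s0 (- 1) c2 c1.
rewrite (@cint_ftc _ _ _ s0 (fun x => F x * (x - z)^-1)) => [E||x rx].
- by apply/eqP; rewrite -subr_eq0; apply/eqP; rewrite [RHS]E mulN1r [RHS]addrC.
- exact: contin_lin.
have xz := ring_neq za rx.
apply: hasD_eq (hasDM (hF _ (rO _ rx)) (hasD_comp (f := fun x => x^-1)
   (hasDB (hasD_id x) (hasD_cst z x)) (hasDV xz))) _.
by field.
Qed.

End Square.

Definition der f z : R[i] := xget 0 [set l | hasD f z l].

Lemma derP f z : (exists l, hasD f z l) -> hasD f z (der f z).
Proof. by move=> h; exact: (xgetPex 0 h). Qed.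

Lemma derE f z l : hasD f z l -> der f z = l.
Proof. by move=> h; apply: (@hasD_uniq _ f z) => //; apply: derP; exists l. Qed.

Lemma holoP K f z : holo K f -> K z -> hasD f z (der f z).
Proof. by move=> hf /hf; exact: derP. Qed.

End CauchyFormula.

(** * Consequences of Cauchy's formula *)

Section Analytic.
Variable R : realType.
Implicit Types (f g F : R[i] -> R[i]) (z w l p u v a : R[i]) (K : set R[i]).
Implicit Types (rho s r M : R).

Definition opn K := forall z, K z -> exists2 rho : R, 0 < rho & oball z rho `<=` K.

Lemma opn_oball a rho : opn (oball a rho).
Proof.
move=> z; rewrite /oball /= => za; exists (rho - modc (z - a)); first by lra.
by move=> w /= wz; have := modc_tri z w a; lra.
Qed.

(** Bernoulli's inequality makes (q / M)^k unbounded. It closes three arguments in which an estimate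
    holds for all powers with fixed constants. *)
Lemma geometric_blowup (A B M q : R) : 0 < A -> 0 <= M -> M < q ->
  (forall k, A * q ^+ k <= B * M ^+ k) -> False.
Proof.
move=> A0 M0 Mq h; have [Mz|Mnz] := eqVneq M 0.
  have := h 1%N; rewrite Mz !expr1 mulr0; have : 0 < A * q by rewrite mulr_gt0 //; lra.
  lra.
have {M0 Mnz}M0 : 0 < M by rewrite lt_neqAle eq_sym Mnz.
pose t := q / M - 1; have t0 : 0 < t by rewrite /t subr_gt0 ltr_pdivlMr // mul1r.
have bern k : 1 + k%:R * t <= (q / M) ^+ k.
  elim: k => [|k IH]; first by rewrite mul0r addr0 expr0.
  rewrite exprS mulrS; have k0 : 0 <= k%:R :> R by [].
  have -> : q / M = 1 + t by rewrite /t; ring.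
  rewrite (_ : q / M = 1 + t) in IH; last by rewrite /t; ring.
  have : 0 <= k%:R * t * t by rewrite !mulr_ge0 // ltW.
  have : (1 + t) * (1 + k%:R * t) <= (1 + t) * (1 + t) ^+ k by rewrite ler_wpM2l //; lra.
  lra.
have hk k : (q / M) ^+ k <= B / A.
  rewrite expr_div_n ler_pdivlMr // mulrC mulrA ler_pdivrMr ?exprn_gt0 //; exact: h.
pose k := (Num.truncn (B / A / t)).+1.
have kt : B / A < k%:R * t by rewrite -ltr_pdivrMr // truncnS_gt.
by have := bern k; have := hk k; lra.
Qed.

(** Cauchy's formula for [f ^ k] gives the bound up to a constant that does not depend on k; letting
    k grow removes the constant. *)
Lemma max_modulus f a s rho M z : 0 < s -> 5 * s < rho -> holo (oball a rho) f ->
  (forall x, ring_set a s x -> modc (f x) <= M) -> modc (z - a) < s -> modc (f z) <= M.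
Proof.
move=> s0 srho hf fM za; rewrite leNgt; apply/negP => lt.
have rO x : ring_set a s x -> oball a rho x by rewrite /oball /= => /andP[_ h]; lra.
have M0 : 0 <= M.
  apply: le_trans (modc_ge0 _) (fM (corner a s 1) _).
  (* A corner of the square witnesses that the annulus is not empty, so M bounds some modulus. *)
  by apply: (@side_ring R a s 1); [exact: unit41|apply: side_corner => //; exact: unit41].
have hfk k : holo (oball a rho) (fun x => f x ^+ k).
  elim: k => [|k IH] x xo.
    by exists 0; apply: hasD_ext (hasD_cst 1 x); exists 1.
  have [l hl] := hf x xo; have [l' hl'] := IH x xo.
  exists (l * f x ^+ k + f x * l'); apply: hasD_ext (hasDM hl hl').
  by exists 1 => // w _; rewrite exprS.
have c0 := modc_gt0 (ckernel_neq0 a s0).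
apply: (@geometric_blowup (modc (ckernel a s)) (8 * s / (s - modc (z - a))) M (modc (f z))) => // k.
rewrite -modcX -modcM -(cauchy_formula s0 srho (hfk k) za).
have ck : contin (ring_set a s) (fun x => f x ^+ k / (x - z)).
  apply: continM; last by apply: holo_contin; exact: contin_kernel.
  by apply: holo_contin; apply: holoS (hfk k).
apply: le_trans (cint_le s0 ck (M := M ^+ k / (s - modc (z - a))) _) _; last first.
  apply: eq_lexx; ring.
move=> x rx; rewrite modcM modcX modcV.
have za0 : 0 < s - modc (z - a) by lra.
have xz := ring_far za rx.
apply: ler_pM; rewrite ?exprn_ge0 ?invr_ge0 ?modc_ge0 //.
  by apply: lerXn2r; rewrite ?nnegrE ?modc_ge0 ?fM.
by rewrite lef_pV2 ?posrE //; exact: lt_le_trans xz.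
Qed.

Lemma cauchy_near f K z : opn K -> holo K f -> K z -> exists s, [/\ 0 < s,
  oball z (6 * s) `<=` K & forall w, modc (w - z) < s ->
    f w = (ckernel z s)^-1 * cint z s (fun x => f x * (x - w)^-1)].
Proof.
move=> oK hf /oK[rho rho0 rK]; exists (rho / 6).
have s0 : 0 < rho / 6 by lra.
split=> // [x|w wz]; first by rewrite /oball /= => xz; apply: rK; rewrite /oball /=; lra.
rewrite (cauchy_formula s0 _ (holoS rK hf) wz); last by lra.
by rewrite mulrA mulVf ?mul1r // ckernel_neq0.
Qed.

(** Locally the derivative is a constant times an integral of Cauchy type, and [cauchy_type2]
    differentiates that once more. *)
Lemma holo_der K f : opn K -> holo K f -> holo K (der f).
Proof.
move=> oK hf z Kz; have [s [s0 sK E]] := cauchy_near oK hf Kz.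
have cf : contin (ring_set z s) f.
  by apply: holo_contin; apply: holoS hf => x /andP[_ h]; apply: sK; rewrite /oball /=; lra.
have za : modc (z - z) < s by rewrite subrr modc0.
have [l hl] := cauchy_type2 s0 cf za.
exists ((ckernel z s)^-1 * l); apply: hasD_ext (hasDZ _ hl).
exists s => // w wz; apply/esym/derE.
apply: hasD_ext (hasDZ (ckernel z s)^-1 (cauchy_type1 s0 cf wz)).
exists (s - modc (w - z)); first by lra.
by move=> x xw; rewrite -E //; have := modc_tri w x z; lra.
Qed.

(** Divided differences do the work of power series here: they divide out zeros and give
    Schwarz-type bounds. *)
Definition dq f a z := if z == a then der f a else (f z - f a) / (z - a).

Lemma dqxx f a : dq f a a = der f a. Proof. by rewrite /dq eqxx. Qed.

Lemma dqE f a z : z != a -> dq f a z = (f z - f a) / (z - a).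
Proof. by rewrite /dq => /negPf ->. Qed.

Lemma dqM f a z : f z - f a = dq f a z * (z - a).
Proof.
rewrite /dq; case: eqP => [->|/eqP za]; first by rewrite !subrr mulr0.
by rewrite divfK // subr_eq0.
Qed.

Lemma dqC f a z : dq f a z = dq f z a.
Proof.
rewrite /dq [a == z]eq_sym; case: eqP => [->//|/eqP za].
by rewrite -[f a - f z]opprB -[a - z]opprB invrN mulrNN.
Qed.

(** Only z = a is at stake. By 1/(x - w) - 1/(x - a) = (w - a)/((x - w)(x - a)), the divided
    difference near a is the Cauchy type integral with density [f x / (x - a)]. *)
Lemma holo_dq f K a : opn K -> holo K f -> K a -> holo K (dq f a).
Proof.
move=> oK hf Ka z Kz; have [->|za] := eqVneq z a; last first.
  have [l hl] := hf z Kz; have za0 : z - a != 0 by rewrite subr_eq0.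
  exists ((l - 0) * (z - a)^-1 + (f z - f a) * (- ((z - a) ^+ 2)^-1 * (1 - 0))).
  apply: hasD_ext (hasDM (hasDB hl (hasD_cst (f a) z)) (hasD_comp (f := fun x => x^-1)
    (g := fun x => x - a) (hasDB (hasD_id z) (hasD_cst a z)) (hasDV za0))).
  exists (modc (z - a)); first exact: modc_gt0.
  move=> w wz; rewrite dqE //; apply/eqP => wa; move: wz; rewrite wa modcBC; lra.
have [s [s0 sK E]] := cauchy_near oK hf Ka.
have cf : contin (ring_set a s) f.
  by apply: holo_contin; apply: holoS hf => x /andP[_ h]; apply: sK; rewrite /oball /=; lra.
have aa : modc (a - a) < s by rewrite subrr modc0.
have ck w : modc (w - a) < s -> contin (ring_set a s) (fun x => (x - w)^-1).
  by move=> wa; apply: holo_contin; exact: contin_kernel.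
have cfa : contin (ring_set a s) (fun x => f x * (x - a)^-1) by apply: continM => //; exact: ck.
exists ((ckernel a s)^-1 * cint a s (fun x => (f x * (x - a)^-1) * ((x - a)^-1 * (x - a)^-1))).
apply: hasD_ext (hasDZ _ (cauchy_type1 s0 cfa aa)).
exists s => // w wa; have [->|wna] := eqVneq w a.
  rewrite dqxx; apply/esym/derE.
  have -> : (fun x => f x * (x - a)^-1 * (x - a)^-1) =
    (fun x => f x * ((x - a)^-1 * (x - a)^-1)) by apply/funext => x; rewrite mulrA.
  apply: hasD_ext (hasDZ (ckernel a s)^-1 (cauchy_type1 s0 cf aa)).
  by exists s => // x xa; rewrite -E.
rewrite dqE // (E w wa) (E a aa).
have cw : contin (ring_set a s) (fun x => f x * (x - w)^-1) by apply: continM => //; exact: ck.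
have wa0 : w - a != 0 by rewrite subr_eq0.
rewrite -mulrBr -mulrA; congr (_ * _); apply: (mulIf wa0); rewrite divfK //.
have -> : cint a s (fun x => f x / (x - w)) - cint a s (fun x => f x / (x - a)) =
  cint a s (fun x => -1 * (f x / (x - a)) + f x / (x - w)).
  by rewrite (cint_lin s0 (-1) cfa cw) mulN1r addrC.
have cq : contin (ring_set a s) (fun x => f x / (x - a) / (x - w)).
  by apply: continM => //; exact: ck.
have E0 := cint_lin s0 (w - a) cq (contin_cst 0).
have Z : cint a s (fun=> 0) = 0 by rewrite /cint !segint_cst !mul0r !addr0.
rewrite Z [X in _ = X]addr0 in E0.
rewrite [LHS]mulrC -E0; apply/esym.
apply: (eq_cint s0); first exact: contin_lin (contin_cst 0).
move=> x rx; have xa := ring_neq aa rx; have xw := ring_neq wa rx.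
by field; rewrite xw xa.
Qed.

(** Division by [z - a] costs at most 1 / s when z is at distance at least s from a; the maximum
    principle carries the bound inside. *)
Lemma dq_le f a s rho M z : 0 < s -> 5 * s < rho -> holo (oball a rho) f ->
  (forall x, oball a rho x -> modc (f x - f a) <= M) -> oball a rho z ->
  modc (dq f a z) <= M / s.
Proof.
move=> s0 srho hf fM zo.
have ao : oball a rho a by apply: oball_center; lra.
have far x : oball a rho x -> s <= modc (x - a) -> modc (dq f a x) <= M / s.
  move=> xo xa; have x0 : 0 < modc (x - a) by lra.
  rewrite dqE; last by apply/eqP => xx; move: x0; rewrite xx subrr modc0 ltxx.
  rewrite modcM modcV ler_pM ?invr_ge0 ?modc_ge0 ?fM //.
  by rewrite lef_pV2 ?posrE.
have [|zs] := leP s (modc (z - a)); first exact: far.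
have hq := holo_dq (@opn_oball a rho) hf ao.
apply: (max_modulus s0 srho hq) => // x /andP[xs x2]; apply: far => //.
by rewrite /oball /=; lra.
Qed.

Lemma dq_le12 f a rho M z : 0 < rho -> holo (oball a rho) f ->
  (forall x, oball a rho x -> modc (f x) <= M) -> oball a rho z ->
  modc (dq f a z) <= 12 * M / rho.
Proof.
(* With s = rho / 6 one has 5 s < rho, and [f x - f a] is at most 2 M: this is the 12 of all later
   derivative bounds. *)
move=> rho0 hf fM zo; have s0 : 0 < rho / 6 by lra.
have ao : oball a rho a by exact: oball_center.
have -> : 12 * M / rho = (2 * M) / (rho / 6) by field; rewrite gt_eqF.
apply: (dq_le s0 _ hf) => //; first by lra.
by move=> x xo; have := modcB (f x) (f a); have := fM x xo; have := fM a ao; lra.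
Qed.

Lemma der_le f a rho M : 0 < rho -> holo (oball a rho) f ->
  (forall x, oball a rho x -> modc (f x) <= M) -> modc (der f a) <= 12 * M / rho.
Proof.
by move=> rho0 hf fM; rewrite -dqxx; apply: (dq_le12 rho0) => //; exact: oball_center.
Qed.

Lemma oballS a z rho r : modc (z - a) + r <= rho -> oball z r `<=` oball a rho.
Proof. by move=> h w; rewrite /oball /=; have := modc_tri z w a; lra. Qed.

Section Bounded.
Variables (f : R[i] -> R[i]) (a : R[i]) (rho M : R).
Hypotheses (rho0 : 0 < rho) (hf : holo (oball a rho) f).
Hypothesis fM : forall x, oball a rho x -> modc (f x) <= M.

Lemma der_le_half z : oball a (rho / 2) z -> modc (der f z) <= 24 * M / rho.
Proof.
have rho0' := rho0; rewrite /oball /= => za.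
have S : oball z (rho / 2) `<=` oball a rho by apply: oballS; lra.
have r2 : 0 < rho / 2 by lra.
apply: le_trans (der_le r2 (holoS S hf) (fun x xo => fM (S x xo))) _.
by apply: eq_lexx; field; rewrite gt_eqF.
Qed.

Lemma der_lip z w : cball a (rho / 8) z -> cball a (rho / 8) w ->
  modc (der f z - der f w) <= 24 * 48 * M / rho ^+ 2 * modc (z - w).
Proof.
have rho0' := rho0; have r2 : 0 < rho / 2 by lra.
have S2 : oball a (rho / 2) `<=` oball a rho.
  by move=> x; rewrite /oball /=; lra.
have hd : holo (oball a (rho / 2)) (der f).
  by apply: holoS (holo_der (@opn_oball a rho) hf).
move=> zc wc; apply: (mvt_cvx (cvxc_cball a (rho / 8)) (f := der f)) => // x.
rewrite /cball /= => xa.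
have xo : oball a (rho / 2) x by rewrite /oball /=; lra.
exists (der (der f) x); first exact: holoP hd xo.
(* The derivative is at most 24 M / rho on this ball, so the second derivative is at most 12 times
   that, divided by rho / 4. *)
have S : oball x (rho / 4) `<=` oball a (rho / 2) by apply: oballS; lra.
have r4 : 0 < rho / 4 by lra.
apply: le_trans (der_le r4 (holoS S hd) (fun y yo => der_le_half (S y yo))) _.
by apply: eq_lexx; field; rewrite gt_eqF.
Qed.

Lemma taylor2 z w : cball a (rho / 8) z -> cball a (rho / 8) w ->
  modc (f w - f z - der f z * (w - z)) <= 24 * 48 * M / rho ^+ 2 * modc (w - z) ^+ 2.
Proof.
have rho0' := rho0; move=> zc wc.
have M0 : 0 <= M.
  by apply: le_trans (modc_ge0 _) (fM (oball_center _ rho0)).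
pose K := cball a (rho / 8) `&` cball z (modc (w - z)).
have cK : cvxc K by apply: cvxcI; exact: cvxc_cball.
have -> : f w - f z - der f z * (w - z) = (f w - der f z * w) - (f z - der f z * z) by ring.
rewrite expr2 mulrA.
apply: (mvt_cvx cK (f := fun x => f x - der f z * x)).
- move=> x [xa xz]; exists (der f x - der f z * 1).
    apply: hasDB; last by apply: hasDZ; exact: hasD_id.
    by apply: holoP hf _; move: xa; rewrite /cball /oball /=; lra.
  rewrite mulr1; apply: le_trans (der_lip xa zc) _.
  apply: ler_wpM2l; last by move: xz; rewrite /cball.
  by rewrite divr_ge0 ?exprn_ge0 ?mulr_ge0 ?ler0n ?(ltW rho0').
- by split=> //; rewrite /cball /= subrr modc0 modc_ge0.
- by split=> //; rewrite /cball /=.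
Qed.

End Bounded.

Lemma holo_bounded f a rho r : holo (oball a rho) f -> r < rho ->
  exists2 M, 0 <= M & forall z, cball a r z -> modc (f z) <= M.
Proof.
move=> hf rr; have S : cball a r `<=` oball a rho.
  by move=> x; rewrite /cball /oball /=; lra.
have [M hM] := ucomp_contin_bounded (@ucomp_cball R a r) (contin_sub S (holo_contin hf)).
exists `|M| => // z /hM h; exact: le_trans h (ler_norm _).
Qed.

Lemma strict_diff f K z e : opn K -> holo K f -> K z -> 0 < e ->
  exists2 d, 0 < d & forall x y, modc (x - z) < d -> modc (y - z) < d ->
    modc (f x - f y - der f z * (x - y)) <= e * modc (x - y).
Proof.
move=> oK hf Kz e0; have [rho rho0 rK] := oK z Kz.
have [d d0 hd] := hasD_contin (holoP (holo_der oK hf) Kz) e0.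
have [m [m0 md mr _]] := exists_lt3 d0 rho0 rho0; exists m => // x y xz yz.
have -> : f x - f y - der f z * (x - y) = (f x - der f z * x) - (f y - der f z * y) by ring.
apply: (mvt_cvx (cvxc_cball z m) (f := fun x => f x - der f z * x)); rewrite /cball /=.
- move=> t tz; exists (der f t - der f z * 1).
    apply: hasDB; last by apply: hasDZ; exact: hasD_id.
    by apply: holoP hf _; apply: rK; rewrite /oball /=; lra.
  by rewrite mulr1; apply: hd; lra.
- by rewrite ltW.
- by rewrite ltW.
Qed.

(** A cluster of zeros at a survives division by [z - a]. Dividing k times bounds f by M (|z - a| /
    s)^k, which tends to 0 when |z - a| < s. *)
Lemma zeros_cluster f a rho z : 0 < rho -> holo (oball a rho) f ->
  (forall d, 0 < d -> exists w, [/\ w != a, modc (w - a) < d & f w = 0]) ->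
  modc (z - a) < rho / 14 -> f z = 0.
Proof.
(* Halving rho makes f bounded, and s = r / 7 meets the requirement 5 s < r. *)
move=> rho0 hf zf za; pose r := rho / 2; pose s := rho / 14.
have r0 : 0 < r by rewrite /r; lra.
have s0 : 0 < s by rewrite /s; lra.
have sr : 5 * s < r by rewrite /s /r; lra.
have rr : r < rho by rewrite /r; lra.
have [M M0 hM] := holo_bounded hf rr.
have S : oball a r `<=` oball a rho by move=> x; rewrite /oball /= /r; lra.
suff H k : forall g M, 0 <= M -> holo (oball a r) g ->
  (forall x, oball a r x -> modc (g x) <= M) ->
  (forall d, 0 < d -> exists w, [/\ w != a, modc (w - a) < d & g w = 0]) ->
  forall x, oball a r x -> modc (g x) <= M * (modc (x - a) / s) ^+ k.
  apply/eqP/negP => /negP fz0.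
  have zo : oball a r z by rewrite /oball /= /r; lra.
  apply: (@geometric_blowup (modc (f z)) M (modc (z - a) / s) 1).
  - exact: modc_gt0.
  - by rewrite divr_ge0 ?modc_ge0 // ltW.
  - by rewrite ltr_pdivrMr // mul1r.
  move=> k; rewrite expr1n mulr1; apply: (H k f M M0 (holoS S hf)) => // x.
  by rewrite /oball /= => xr; apply: hM; rewrite /cball /=; lra.
elim: k => [|k IH] g B B0 hg gB zg x xo; first by rewrite expr0 mulr1 gB.
have ao : oball a r a by exact: oball_center.
have ga : g a = 0.
  apply: modc_arch => e e0; have [d d0 hd] := holo_contin hg ao e0.
  have dr0 : 0 < Num.min d r by rewrite lt_min d0.
  have [w [wa wd gw]] := zg _ dr0; move: wd; rewrite lt_min => /andP[w1 w2].
  by have := hd w w2 w1; rewrite gw sub0r modcN.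
have hq := holo_dq (@opn_oball a r) hg ao.
have qB y : oball a r y -> modc (dq g a y) <= B / s.
  by apply: (dq_le s0 sr hg) => t to; rewrite ga subr0 gB.
have -> : g x = dq g a x * (x - a) by rewrite -dqM ga subr0.
rewrite modcM exprSr [(modc (x - a) / s)^+k * _]mulrC.
have -> : B * (modc (x - a) / s * (modc (x - a) / s) ^+ k) =
  (B / s * (modc (x - a) / s) ^+ k) * modc (x - a) by ring.
rewrite ler_wpM2r ?modc_ge0 //; apply: IH => //; first by rewrite divr_ge0 // ltW.
move=> d d0; have [w [wa wd gw]] := zg d d0; exists w; split=> //.
by rewrite dqE // gw ga subrr mul0r.
Qed.

Definition near0 f z := exists2 d, 0 < d & forall w, modc (w - z) < d -> f w = 0.

Lemma near0_acc f z : near0 f z ->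
  forall d, 0 < d -> exists w, [/\ w != z, modc (w - z) < d & f w = 0].
Proof.
move=> [d d0 h] e e0; have [t [t0 td te _]] := exists_lt3 d0 e0 e0.
have [w wz] := exists_at_dist z t0; exists w; split; rewrite ?wz //.
  by apply/eqP => E; move: t0; rewrite -wz E subrr modc0 ltxx.
by apply: h; rewrite wz.
Qed.

(** One radius serves all x and y near z, so the property spreads along segments by bisection and
    over connected open sets. *)
Lemma near0_spread f K z : opn K -> holo K f -> K z ->
  exists2 d, 0 < d & forall x y, modc (x - z) < d -> modc (y - z) < d ->
    near0 f x -> near0 f y.
Proof.
move=> oK hf /oK[rho rho0 rK]; exists (rho / 100); first by lra.
move=> x y xz yz fx; have hx : holo (oball x (rho / 2)) f.
  by apply: holoS hf => w; rewrite /oball /= => h; apply: rK; rewrite /oball /=;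
     have := modc_tri x w z; lra.
exists (rho / 100); first by lra.
move=> w wy; apply: (zeros_cluster (rho := rho / 2) _ hx (near0_acc fx)); first by lra.
have := modc_tri y w x; have := modc_tri z y x; rewrite [modc (z - x)]modcBC; lra.
Qed.

Lemma near0_ball f a rho x y : holo (oball a rho) f -> oball a rho x -> oball a rho y ->
  near0 f x -> near0 f y.
Proof.
move=> hf xo yo; pose r := Num.max (modc (x - a)) (modc (y - a)).
have rr : r < rho by rewrite gt_max xo.
apply: (cvxc_bisect (cvxc_cball a r) (Q := fun x y => near0 f x -> near0 f y)).
- by rewrite /cball /= le_max lexx.
- by rewrite /cball /= le_max lexx orbT.
- by move=> u v _ _ h1 h2 /h1 /h2.
move=> p pa; have po : oball a rho p by move: pa; rewrite /cball /oball /=; lra.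
have [d d0 hd] := near0_spread (@opn_oball a rho) hf po.
exists (d / 4); first by lra.
move=> u v _ _ up uv; apply: hd; first by lra.
by have := modc_tri u v p; lra.
Qed.

Lemma isolated_zero f K z : opn K -> holo K f -> K z -> ~ near0 f z ->
  exists2 d, 0 < d & forall w, w != z -> modc (w - z) < d -> f w != 0.
Proof.
move=> oK hf /oK[rho rho0 rK] nz; apply: contrapT => nd; apply: nz.
exists (rho / 14); first by lra.
move=> w wz; apply: (zeros_cluster rho0 (holoS rK hf)) wz => d d0.
apply: contrapT => nw; apply: nd; exists d => // x xz xd; apply/negP => /eqP fx.
by apply: nw; exists x.
Qed.

End Analytic.

(** * Ultralimits of holomorphic functions *)

Section UltraHolo.
Variable R : realType.
Implicit Types (f g : R[i] -> R[i]) (z w l p u v a x y : R[i]) (K : set R[i]).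
Implicit Types (rho s r M e : R).
Variables (U : set_system nat) (hU : free_ultra U).

Lemma ulimB (x y : nat -> R[i]) l l' : ulim U x l -> ulim U y l' ->
  ulim U (fun n => x n - y n) (l - l').
Proof.
move=> h h' e e0; have e2 : 0 < e / 2 by lra.
apply: (ultraS hU) (ultraI hU (h _ e2) (h' _ e2)) => n [/= h1 h2].
have -> : x n - y n - (l - l') = (x n - l) - (y n - l') by ring.
by have := modcB (x n - l) (y n - l'); lra.
Qed.

Lemma ulim_cst l : ulim U (fun=> l) l.
Proof. by move=> e e0; apply: (ultra_all hU) => n /=; rewrite subrr modc0. Qed.

Lemma ulim_contin K f (x : nat -> R[i]) l : contin K f -> (forall n, K (x n)) -> K l ->
  ulim U x l -> ulim U (fun n => f (x n)) (f l).
Proof.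
move=> cf Kx Kl h e e0; have e2 : 0 < e / 2 by lra.
have [d d0 hd] := cf l Kl _ e2.
by apply: (ultraS hU) (h d d0) => n /= /(hd _ (Kx n)); lra.
Qed.

(** If the bound failed for U-many n, the points of failure would have an ultralimit l in K, and the
    common Lipschitz constant would keep [F n l] away from 0. *)
Lemma ulim_unif K (F : nat -> R[i] -> R[i]) (L e : R) : ucomp K ->
  (forall n z w, K z -> K w -> modc (F n z - F n w) <= L * modc (z - w)) ->
  (forall z, K z -> ulim U (fun n => F n z) 0) -> 0 < e ->
  U [set n | forall z, K z -> modc (F n z) <= e].
Proof.
move=> uK FL F0 e0; apply: contrapT => /(ultraC hU) bad.
have [[z0 Kz0]|nK] := pselect (exists z, K z); last first.
  by have [n /= []] := ultra_ex hU bad; move=> z Kz; exfalso; apply: nK; exists z.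
have hx n : exists x, K x /\ (~ (forall z, K z -> modc (F n z) <= e) -> e < modc (F n x)).
  have [[x [Kx ex]]|h] := pselect (exists x, K x /\ e < modc (F n x)); first by exists x.
  exists z0; split=> // nb; exfalso; apply: nb => z Kz; rewrite leNgt; apply/negP => lt.
  by apply: h; exists z.
have [x {}hx] := choice hx.
have [l Kl xl] := uK U hU x (fun n => (hx n).1).
have L0 : 0 < `|L| + 1 by have := normr_ge0 L; lra.
have e2 : 0 < e / 2 by lra.
have eL : 0 < e / 2 / (`|L| + 1) by rewrite divr_gt0.
have [n [/= [nb xn] Fn]] := ultra_ex hU (ultraI hU (ultraI hU bad (xl _ eL)) (F0 l Kl _ e2)).
rewrite subr0 in Fn; have [Kx /(_ nb) ex] := hx n.
have := FL n _ _ Kx Kl; rewrite ltr_pdivlMr // in xn.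
have := ler_norm L; have := modc_ge0 (x n - l); have := modc_lowB (F n (x n)) (F n l).
nra.
Qed.

(** Hurwitz's theorem. If F n has no zero, the maximum principle for 1 / F n gives a point of the
    annulus where |F n| is below |F n a|, up to 1 / (n + 1) since no minimum is taken. In the limit
    f vanishes on the annulus. *)
Lemma zero_persists (F : nat -> R[i] -> R[i]) f a s rho M : 0 < s -> 5 * s < rho ->
  (forall n, holo (oball a rho) (F n)) ->
  (forall n z, oball a rho z -> modc (F n z) <= M) ->
  (forall z, oball a rho z -> ulim U (fun n => F n z) (f z)) ->
  f a = 0 -> (forall x, ring_set a s x -> f x != 0) ->
  U [set n | exists2 z, oball a rho z & F n z = 0].
Proof.
move=> s0 srho hF FM Ff fa fr; apply: contrapT => /(ultraC hU) bad.
have rho0 : 0 < rho by lra.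
have ao : oball a rho a by exact: oball_center.
have rO x : ring_set a s x -> oball a rho x by rewrite /oball /= => /andP[_ h]; lra.
have hx n : exists x, ring_set a s x /\ (~ (exists2 z, oball a rho z & F n z = 0) ->
    modc (F n x) < modc (F n a) + n.+1%:R^-1).
  have [[x [rx h]]|nx] := pselect (exists x, ring_set a s x /\
    modc (F n x) < modc (F n a) + n.+1%:R^-1); first by exists x.
  exists (corner a s 1); split.
    by apply: (@side_ring R a s 1); [exact: unit41|apply: side_corner => //; exact: unit41].
  move=> nz; exfalso; have Fn0 x : oball a rho x -> F n x != 0.
    by move=> xo; apply/eqP => Fx; apply: nz; exists x.
  have n1 : 0 < n.+1%:R^-1 :> R by rewrite invr_gt0.
  have m0 := modc_ge0 (F n a).
  pose m := modc (F n a) + n.+1%:R^-1; have mp : 0 < m by rewrite /m ltr_wpDl.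
  have hI : holo (oball a rho) (fun x => (F n x)^-1).
    move=> x xo; have [l hl] := hF n x xo; exists (- ((F n x) ^+ 2)^-1 * l).
    exact: (hasD_comp (f := fun x => x^-1) hl (hasDV (Fn0 x xo))).
  have : modc (F n a)^-1 <= m^-1.
    apply: (max_modulus s0 srho hI); last by rewrite subrr modc0.
    move=> x rx; rewrite modcV lef_pV2 ?posrE //; last exact/modc_gt0/Fn0/rO.
    by rewrite leNgt; apply/negP => lt; apply: nx; exists x.
  rewrite modcV lef_pV2 ?posrE //; last exact/modc_gt0/Fn0.
  by rewrite /m gerDl leNgt n1.
have [x {}hx] := choice hx.
have [l rl xl] := @ucomp_ring R a s U hU x (fun n => (hx n).1).
pose t := rho - 2 * s; have t0 : 0 < t by rewrite /t; lra.
pose L := 12 * M / t.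
have FL n z w : cball a (2 * s) z -> cball a (2 * s) w ->
   modc (F n z - F n w) <= L * modc (z - w).
  move=> zc wc; apply: (mvt_cvx (cvxc_cball a (2 * s)) (f := F n)) => // y.
  rewrite /cball /= => ya; have So : oball y t `<=` oball a rho by apply: oballS; rewrite /t; lra.
  exists (der (F n) y); first by apply: holoP (hF n) _; rewrite /oball /=; lra.
  exact: der_le t0 (holoS So (hF n)) (fun z zo => FM n z (So z zo)).
have rC z : ring_set a s z -> cball a (2 * s) z by move=> /andP[].
have /negP[] := fr l rl; apply/eqP/modc_arch => e e0.
have L0 : 0 < `|L| + 1 by have := normr_ge0 L; lra.
have e4 : 0 < e / 4 by lra.
have eL : 0 < e / 4 / (`|L| + 1) by rewrite divr_gt0.
have [n [/= [[[nb x1] x2] x3] x4]] := ultra_ex hU (ultraI hU (ultraI hU (ultraI hU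
  (ultraI hU bad (xl _ eL)) (Ff l (rO _ rl) _ e4)) (Ff a ao _ e4)) (ultra_inv_lt hU e4)).
have [rx /(_ nb) h] := hx n.
rewrite fa subr0 in x3; rewrite ltr_pdivlMr // in x1.
have {x4}h : modc (F n (x n)) <= modc (F n a) + e / 4 by apply: ltW; apply: lt_trans h _; rewrite ltrD2l.
have := FL n _ _ (rC _ rl) (rC _ rx).
have := modc_lowB (F n l) (F n (x n)); have := modc_lowB (f l) (F n l).
rewrite [modc (f l - _)]modcBC [modc (l - _)]modcBC.
have := ler_norm L; have := modc_ge0 (x n - l); nra.
Qed.

Definition inj_on K f := forall x y, K x -> K y -> f x = f y -> x = y.

Lemma inj_not_near_cst f a rho x c : 0 < rho -> inj_on (oball a rho) f -> oball a rho x ->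
  ~ near0 (fun z => f z - c) x.
Proof.
move=> rho0 fi xo [d d0 h]; have [r r0 rS] := @opn_oball R a rho x xo.
have [t [t0 td tr _]] := exists_lt3 d0 r0 r0.
have [w wz] := exists_at_dist x t0.
have wo : oball a rho w by apply: rS; rewrite /oball /= wz.
have fx : f x - c = 0 by apply: h; rewrite subrr modc0.
have fw : f w - c = 0 by apply: h; rewrite wz.
have E : w = x by apply: fi => //; apply: (addIr (- c)); rewrite fx fw.
by move: t0; rewrite -wz E subrr modc0 ltxx.
Qed.

(** If f' vanished at a, Hurwitz would apply to the divided differences based at [y n], which tend
    to the one based at a: some [dq f (y n)] has a zero z. For z different from [y n] this
    contradicts injectivity; for z = [y n] it contradicts that a is an isolated zero of f'. *)
Lemma inj_der_neq0 f a rho : 0 < rho -> holo (oball a rho) f -> inj_on (oball a rho) f ->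
  der f a != 0.
Proof.
move=> rho0 hf fi; apply/negP => /eqP fa.
have ao : oball a rho a by exact: oball_center.
have oO := @opn_oball R a rho; have hd := holo_der oO hf.
have nd : ~ near0 (der f) a.
  move=> [d d0 h]; have [t [t0 td tr _]] := exists_lt3 d0 rho0 rho0.
  apply: (@inj_not_near_cst f a rho a (f a) rho0 fi ao); exists t => // w wa.
  apply: modc_le0; rewrite -[X in _ <= X](mul0r (modc (w - a))).
  apply: (mvt_cvx (cvxc_cball a t) (f := f)); rewrite /cball /=.
  - move=> x xa; exists (der f x); first by apply: holoP hf _; rewrite /oball /=; lra.
    by rewrite h ?modc0 //; lra.
  - by rewrite subrr modc0 ltW.
  - exact: ltW.
have [d0 d00 hd0] := isolated_zero oO hd ao nd.
pose r := 3 * rho / 4; have rr : r < rho by rewrite /r; lra.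
have r0 : 0 < r by rewrite /r; lra.
have [M M0 hM] := holo_bounded hf rr.
have rS : oball a r `<=` oball a rho by move=> x; rewrite /oball /=; lra.
have r8 : 0 < rho / 8 by lra.
have [t [t0 td trho _]] := exists_lt3 d00 r8 r8.
have n1 n : 0 < (n.+1%:R^-1 : R) <= 1.
  by rewrite invr_gt0 ltr0n /= invf_le1 ?ltr0n // ler1n.
have [y ya] := choice (fun n => exists_at_dist a (mulr_gt0 t0 (proj1 (andP (n1 n))))).
have yt n : 0 < modc (y n - a) <= t.
  rewrite ya; case/andP: (n1 n) => h1 h2; rewrite mulr_gt0 //=.
  by rewrite ler_piMr // ltW.
have yna n : y n != a.
  by apply/eqP => E; have /andP[] := yt n; rewrite E subrr modc0 ltxx.
have yo n : oball a rho (y n) by rewrite /oball /=; case/andP: (yt n) => *; lra.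
have yr n : oball a r (y n) by rewrite /oball /= /r; case/andP: (yt n) => *; lra.
have yl : ulim U y a.
  move=> e e0; have et : 0 < e / t by rewrite divr_gt0.
  apply: (ultraS hU) (ultra_inv_lt hU et) => n /=.
  by rewrite ya ltr_pdivlMr // mulrC.
pose rh := rho / 4; have rh0 : 0 < rh by rewrite /rh; lra.
have rhS : oball a rh `<=` oball a rho by move=> x; rewrite /oball /= /rh; lra.
pose s := rh / 6.
have s0 : 0 < s by rewrite /s; lra.
have srh : 5 * s < rh by rewrite /s; lra.
have [|n z zo|z zo|||n [z zo dz]] := ultra_ex hU
    (@zero_persists (fun n => dq f (y n)) (dq f a) a s rh (12 * M / (rho / 2)) s0 srh _ _ _ _ _).
- by move=> n; apply: holoS (holo_dq oO hf (yo n)).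
- have So : oball (y n) (rho / 2) `<=` oball a r.
    by apply: oballS; case/andP: (yt n) => *; rewrite /r; lra.
  apply: dq_le12; first by lra.
  + by apply: holoS hf => x /So /rS.
  + by move=> x /So; rewrite /oball /= => xr; apply: hM; rewrite /cball /= ltW.
  + rewrite /oball /=; have := modc_tri a z (y n); rewrite [modc (a - y n)]modcBC.
    by move: zo; rewrite /oball /= /rh; case/andP: (yt n) => *; lra.
(* Symmetry of divided differences turns convergence in the base point into continuity of
   [dq f z]. *)
- have := ulim_contin (holo_contin (holo_dq oO hf (rhS z zo))) yo ao yl.
  by rewrite dqC; under eq_fun do rewrite dqC.
- by rewrite dqxx.
- move=> x rx; have xa : x != a.
    apply/eqP => xa; have /andP[] := rx; rewrite xa subrr modc0; lra.
  have xo : oball a rho x by apply: rhS; case/andP: rx; rewrite /oball /=; lra.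
  rewrite dqE // mulf_neq0 ?invr_neq0 ?subr_eq0 //.
  by apply/eqP => /(fi _ _ xo ao) /eqP; rewrite (negPf xa).
have [zy|zy] := eqVneq z (y n).
  move: dz; rewrite zy dqxx; apply/eqP; apply: hd0 => //.
  by case/andP: (yt n) => *; lra.
move: (dqM f (y n) z); rewrite dz mul0r => /eqP; rewrite subr_eq0 => /eqP.
by move=> /(fi _ _ (rhS z zo) (yo n)) /eqP; rewrite (negPf zy).
Qed.

Section Limit.
Variables (F : nat -> R[i] -> R[i]) (f : R[i] -> R[i]) (a : R[i]) (rho M : R).
Hypotheses (rho0 : 0 < rho) (hF : forall n, holo (oball a rho) (F n)).
Hypothesis FM : forall n z, oball a rho z -> modc (F n z) <= M.
Hypothesis Ff : forall z, oball a rho z -> ulim U (fun n => F n z) (f z).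

(** The derivatives are bounded, hence have an ultralimit, and the second order Taylor bound is
    uniform in n and passes to the limit. *)
Lemma ulim_holo z : oball a rho z -> hasD f z (der f z) /\
  ulim U (fun n => der (F n) z) (der f z).
Proof.
move=> zo; have [r r0 rS] := opn_oball zo.
have hr n : holo (oball z r) (F n) by apply: holoS (hF n).
have Mr n x : oball z r x -> modc (F n x) <= M by move=> /rS; exact: FM.
have [n|l hl] := ulim_ex hU (x := fun n => der (F n) z) (B := 12 * M / r).
  exact: der_le r0 (hr n) (Mr n).
suff H : hasD f z l by rewrite (derE H).
pose C := 24 * 48 * M / r ^+ 2; have C0 : 0 < `|C| + 1 by have := normr_ge0 C; lra.
move=> e e0; exists (Num.min (r / 8) (e / (`|C| + 1))).
  by rewrite lt_min; apply/andP; split; [lra|rewrite divr_gt0].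
move=> w; rewrite lt_min => /andP[wr]; rewrite ltr_pdivlMr // => we.
have wo : oball a rho w by apply: rS; rewrite /oball /=; lra.
apply: (@le_trans _ _ (C * modc (w - z) ^+ 2)); last first.
  rewrite expr2 mulrA ler_wpM2r ?modc_ge0 //; clearbody C.
  have : C * modc (w - z) <= `|C| * modc (w - z) by rewrite ler_wpM2r ?modc_ge0 ?ler_norm.
  by have := modc_ge0 (w - z); lra.
rewrite -[X in modc X]subr0; apply: (@ulim_le R U hU
  (fun n => F n w - F n z - der (F n) z * (w - z))).
  apply: ulimB; first by apply: ulimB; exact: Ff.
  move=> t t0; have m0 : 0 < modc (w - z) + 1 by have := modc_ge0 (w - z); lra.
  apply: (ultraS hU) (hl (t / (modc (w - z) + 1)) _); last by rewrite divr_gt0.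
  move=> n /=; rewrite ltr_pdivlMr // -mulrBl modcM => h.
  by have := modc_ge0 (der (F n) z - l); lra.
apply: (ultra_all hU) => n /=; rewrite subr0.
by apply: (taylor2 r0 (hr n) (Mr n)); rewrite /cball /= ?subrr ?modc0; lra.
Qed.

Lemma ulim_holoW : holo (oball a rho) f.
Proof. by move=> z /ulim_holo[h _]; exists (der f z). Qed.

Lemma ulim_bound z : oball a rho z -> modc (f z) <= M.
Proof.
move=> zo; rewrite -[f z]subr0; apply: (ulim_le hU (Ff zo)).
by apply: (ultra_all hU) => n /=; rewrite subr0 FM.
Qed.

(** Rigidity needs the difference to be small also as a Lipschitz map. That comes from uniform
    convergence of the derivatives, which are themselves equi-Lipschitz. *)
Lemma ulim_small e : 0 < e -> U [set n |
  (forall z, cball a (rho / 8) z -> modc (F n z - f z) <= e) /\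
  (forall z w, cball a (rho / 8) z -> cball a (rho / 8) w ->
     modc ((F n z - f z) - (F n w - f w)) <= e * modc (z - w))].
Proof.
have rho0' := rho0; move=> e0; pose u n z := F n z - f z.
have hu n : holo (oball a rho) (u n).
  move=> z zo; have [l hl] := hF n zo; have [hd _] := ulim_holo zo.
  by exists (l - der f z); exact: hasDB.
have uM n z : oball a rho z -> modc (u n z) <= 2 * M.
  move=> zo; have := modcB (F n z) (f z); have := FM n zo; have := ulim_bound zo.
  by rewrite /u; lra.
have cO z : cball a (rho / 8) z -> oball a rho z by rewrite /cball /oball /=; lra.
have uK := @ucomp_cball R a (rho / 8).
have mv n (L : R) : (forall z, cball a (rho / 8) z -> modc (der (u n) z) <= L) ->
  forall z w, cball a (rho / 8) z -> cball a (rho / 8) w ->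
    modc (u n z - u n w) <= L * modc (z - w).
  move=> hL z w zc wc; apply: (mvt_cvx (cvxc_cball a (rho / 8)) (f := u n)) => // x xc.
  by exists (der (u n) x); [apply: holoP (hu n) (cO _ xc)|exact: hL].
have duE n z : oball a rho z -> der (u n) z = der (F n) z - der f z.
  move=> zo; apply: derE; apply: hasDB; first exact: holoP (hF n) zo.
  by have [] := ulim_holo zo.
have D1 : U [set n | forall z, cball a (rho / 8) z -> modc (der (u n) z) <= e].
  apply: (ulim_unif uK _ _ e0).
    by move=> n z w; exact: (der_lip rho0' (hu n) (uM n)).
  move=> z /cO zo; have [_ h] := ulim_holo zo.
  have := ulimB h (ulim_cst (der f z)); rewrite subrr.
  by under eq_fun do rewrite -duE //.
have D2 : U [set n | forall z, cball a (rho / 8) z -> modc (u n z) <= e].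
  apply: (@ulim_unif _ _ (24 * (2 * M) / rho) _ uK _ _ e0).
    move=> n; apply: mv => z zc; apply: (der_le_half rho0' (hu n) (uM n)).
    by move: zc; rewrite /cball /oball /=; lra.
  by move=> z /cO zo; have := ulimB (Ff zo) (ulim_cst (f z)); rewrite subrr.
by apply: (ultraS hU) (ultraI hU D1 D2) => n [/= h1 h2]; split=> //; exact: mv.
Qed.

(** If f x = f y, the zero of f - f y at x persists for some F n - F n y in a ball around x too
    small to contain y. The pair x0, y0 excludes a constant limit. *)
Lemma hurwitz_inj x0 y0 : (forall n, inj_on (oball a rho) (F n)) ->
  oball a rho x0 -> oball a rho y0 -> f x0 != f y0 -> inj_on (oball a rho) f.
Proof.
move=> Fi xo0 yo0 fxy x y xo yo fx; apply: contrapT => /eqP xy.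
have hf := ulim_holoW; have oO := @opn_oball R a rho.
pose g z := f z - f y.
have hg : holo (oball a rho) g.
  by move=> z zo; have [l hl] := hf z zo; exists (l - 0); apply: hasDB hl (hasD_cst _ _).
have ng : ~ near0 g x.
  move=> n0; have [d d0 h0] := near0_ball hg xo xo0 n0.
  have [d' d'0 h0'] := near0_ball hg xo yo0 n0.
  move: fxy; have := h0 x0; rewrite subrr modc0 => /(_ d0) /eqP; rewrite subr_eq0 => /eqP ->.
  by have := h0' y0; rewrite subrr modc0 => /(_ d'0) /eqP; rewrite subr_eq0 => /eqP ->; rewrite eqxx.
have [d d0 hd] := isolated_zero oO hg xo ng.
have [r r0 rS] := oO x xo.
have xy0 : 0 < modc (x - y) by apply: modc_gt0; rewrite subr_eq0.
have [t [t0 td tr txy]] := exists_lt3 d0 r0 xy0.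
have tS z : oball x t z -> oball a rho z.
  by move=> zt; apply: rS; move: zt; rewrite /oball /=; lra.
have s0 : 0 < t / 6 by lra.
have st : 5 * (t / 6) < t by lra.
have [|||||n [z zt Fz]] := ultra_ex hU
    (@zero_persists (fun n z => F n z - F n y) g x (t / 6) t (2 * M) s0 st _ _ _ _ _).
- move=> n z /tS zo; have [l hl] := hF n zo; exists (l - 0); apply: hasDB hl (hasD_cst _ _).
- move=> n z /tS zo; have := modcB (F n z) (F n y); have := FM n zo; have := FM n yo; lra.
- by move=> z /tS zo; apply: ulimB; exact: Ff.
- by rewrite /g fx subrr.
- move=> w /andP[w1 w2]; apply: hd; last by lra.
  by apply/eqP => wx; move: w1; rewrite wx subrr modc0; lra.
have zy : z = y by apply: (Fi n) => //; [exact: tS|apply/eqP; rewrite -subr_eq0 Fz].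
by move: zt; rewrite /oball /= zy modcBC; lra.
Qed.

End Limit.

End UltraHolo.

(** * Lower Lipschitz bounds for injective maps on compact sets *)

Section BiLipschitz.
Variable R : realType.
Implicit Types (f g : R[i] -> R[i]) (K : set R[i]).

(** By compactness a failure concentrates at a pair of limits: off the diagonal injectivity refutes
    it, on the diagonal strict differentiability with nonzero derivative does. *)
Lemma inj_lower_lipschitz K K' f : opn K' -> holo K' f -> K `<=` K' -> ucomp K ->
  inj_on K f -> (forall z, K z -> der f z != 0) ->
  exists2 mu : R, 0 < mu & forall x y, K x -> K y -> mu * modc (x - y) <= modc (f x - f y).
Proof.
move=> oK hf KK uK fi fd; apply: contrapT => nmu.
have bad (n : nat) : exists xy : R[i] * R[i], [/\ K xy.1, K xy.2 &
    modc (f xy.1 - f xy.2) < n.+1%:R^-1 * modc (xy.1 - xy.2)].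
  apply: contrapT => nb; apply: nmu; exists n.+1%:R^-1; first by rewrite invr_gt0.
  by move=> x y Kx Ky; rewrite leNgt; apply/negP => lt; apply: nb; exists (x, y).
have [xy {}hxy] := choice bad; have [U hU] := free_ultra_exists.
pose x n := (xy n).1; pose y n := (xy n).2.
have Kx n : K (x n) by have [] := hxy n.
have Ky n : K (y n) by have [] := hxy n.
have hn n : modc (f (x n) - f (y n)) < n.+1%:R^-1 * modc (x n - y n) by have [] := hxy n.
have [lx Klx xl] := uK U hU x Kx; have [ly Kly yl] := uK U hU y Ky.
have cf := contin_sub KK (holo_contin hf).
have [E|ne] := eqVneq lx ly; last first.
  have fl := ulimB hU (ulim_contin hU cf Kx Klx xl) (ulim_contin hU cf Ky Kly yl).
  have dl := ulimB hU xl yl.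
  move/eqP: ne; apply; apply: fi => //; apply/eqP; rewrite -subr_eq0; apply/eqP.
  apply: modc_arch => e e0.
  have b0 : 0 < modc (lx - ly) + 1 by have := modc_ge0 (lx - ly); lra.
  have eb : 0 < e / (modc (lx - ly) + 1) by rewrite divr_gt0.
  rewrite -[X in modc X]subr0; apply: (ulim_le hU fl).
  apply: (ultraS hU) (ultraI hU (dl 1 ltr01) (ultra_inv_lt hU eb)) => n /= [h1].
  rewrite ltr_pdivlMr // subr0 => h2.
  have h3 : modc (x n - y n) <= modc (lx - ly) + 1.
    by have := modc_lowB (x n - y n) (lx - ly); lra.
  have i0 : 0 <= n.+1%:R^-1 :> R by rewrite invr_ge0.
  apply: le_trans (ltW (hn n)) _; apply: le_trans (ltW h2).
  by rewrite ler_wpM2l.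
rewrite -E in yl => {ly Kly E}.
have D0 := modc_gt0 (fd lx Klx).
have D2 : 0 < modc (der f lx) / 2 by lra.
have [d d0 hd] := strict_diff oK hf (KK _ Klx) D2.
have [n [/= [h1 h2] h3]] := ultra_ex hU (ultraI hU (ultraI hU (xl _ d0) (yl _ d0)) (ultra_inv_lt hU D2)).
have := hd _ _ h1 h2; have := hn n.
have := modc_lowB (der f lx * (x n - y n)) (f (x n) - f (y n)).
rewrite modcM [modc (der f lx * _ - _)]modcBC.
have : n.+1%:R^-1 * modc (x n - y n) <= modc (der f lx) / 2 * modc (x n - y n).
  by rewrite ler_wpM2r ?modc_ge0 // ltW.
move: (n.+1%:R^-1 * _) => q; lra.
Qed.

End BiLipschitz.

(** * The topology of the complex plane *)

Section ComplexTopology.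
Variable R : realType.
Implicit Types (z w : R[i]^o) (A V : set R[i]^o).

Lemma normr_modc (z : R[i]^o) : `|z| = ((modc z)%:C)%C.
Proof. by case: z => x y. Qed.

Lemma normr_lt_modc (z : R[i]^o) (e : R) : (`|z| < (e%:C)%C) = (modc z < e).
Proof. by rewrite normr_modc ltcR. Qed.

Lemma nbhs_oball z (P : set R[i]^o) : nbhs z P <-> exists2 e : R, 0 < e & oball z e `<=` P.
Proof.
split=> [/nbhs_ballP[e /= e0 eP]|[e e0 eP]].
  have eE : e = ((complex.Re e)%:C)%C by rewrite RRe_real // gtr0_real.
  exists (complex.Re e); first by rewrite -ltcR -eE.
  move=> w wz; apply: eP; rewrite -ball_normE /= distrC eE normr_lt_modc; exact: wz.
apply/nbhs_ballP; exists (e%:C)%C; first by rewrite /= ltcR.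
move=> w; rewrite -ball_normE /= distrC normr_lt_modc => wz; exact: eP.
Qed.

Lemma open_opn V : open V -> opn V.
Proof. by rewrite openE => h z /h /nbhs_oball. Qed.

Lemma derivable_hasD (f : R[i]^o -> R[i]^o) z : derivable f z 1 -> exists l, hasD f z l.
Proof.
move=> /cvg_ex[l /= hl]; exists l => e e0.
have e0' : 0 < (e%:C)%C :> R[i] by rewrite ltcR.
move/cvgrPdist_le/(_ _ e0'): hl => /nbhs_oball[d d0 hd].
exists d => // w wz; have [->|wz0] := eqVneq w z.
  by rewrite !subrr mulr0 subrr modc0 mulr0.
have h0 : w - z != 0 by rewrite subr_eq0.
have := hd (w - z); rewrite /oball /= subr0 => /(_ wz h0).
rewrite normr_modc lecR [X in modc X](_ : _ =
  - ((f w - f z - l * (w - z)) * (w - z)^-1)); last first.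
  rewrite -![_ *: _]/(_ * _) mulr1 subrK; field; exact: h0.
by rewrite modcN modcM modcV ler_pdivrMr // modc_gt0.
Qed.

(** The hypothesis makes both P and its complement open in V. *)
Lemma connected_spread V (P : set R[i]^o) a z : open V -> connected V -> V a -> P a ->
  (forall z, V z -> exists2 d : R, 0 < d & forall x y, modc (x - z) < d ->
     modc (y - z) < d -> P x -> P y) -> V z -> P z.
Proof.
move=> oV cV Va Pa h Vz.
suff : V `&` P = V by move=> E; move: Vz; rewrite -E => -[].
have opnV := open_opn oV.
apply: cV; first by exists a.
- exists (V `&` P); last by rewrite setIA setIid.
  rewrite openE => x [Vx Px]; apply/nbhs_oball.
  have [d d0 hd] := h x Vx; have [r r0 hr] := opnV x Vx.
  exists (Num.min d r); first by rewrite lt_min d0.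
  move=> y; rewrite /oball /= lt_min => /andP[yd yr]; split; first exact: hr.
  by apply: (hd x) => //; rewrite subrr modc0.
exists (~` (V `&` ~` P)).
  apply: open_closedC; rewrite openE => x [Vx nPx]; apply/nbhs_oball.
  have [d d0 hd] := h x Vx; have [r r0 hr] := opnV x Vx.
  exists (Num.min d r); first by rewrite lt_min d0.
  move=> y; rewrite /oball /= lt_min => /andP[yd yr]; split; first exact: hr.
  by move=> Py; apply: nPx; apply: (hd y) => //; rewrite subrr modc0.
rewrite eqEsubset; split=> x [Vx]; first by move=> Px; split=> // -[].
by move=> nn; split=> //; apply: contrapT => nP; apply: nn.
Qed.

Lemma compact_ucomp A : compact A -> ucomp A.
Proof.
move=> cA U hU x Ax; have UU := hU.1.
have PU : ProperFilter U by exact: ultra_proper.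
have [|l [Al cl]] := cA (x @ U) _.
  by apply: (ultra_all hU) => n /=; exact: Ax.
exists l => // e e0; apply: contrapT => /(ultraC hU) ne.
have ol : nbhs l (oball l e) by apply/nbhs_oball; exists e.
have [y [ny yl]] := cl (~` oball l e) (oball l e) ne ol.
exact: ny.
Qed.

Lemma perfect_limit A a (d : R) : perfect_set A -> A a -> 0 < d ->
  exists b, [/\ A b, b != a & modc (b - a) < d].
Proof.
move=> [_ E] Aa d0; move: (Aa); rewrite -{1}E => /(_ (oball a d)) h.
have [|b [ba Ab bd]] := h; first by apply/nbhs_oball; exists d.
by exists b.
Qed.

Lemma bounded_modc A : bounded_set A -> exists B : R, forall z, A z -> modc z <= B.
Proof.
move=> [M [Mr hM]]; exists (complex.Re M + 1) => z Az.
have := hM (M + 1); rewrite ltrDl ltr01 => /(_ isT z Az) /=.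
rewrite normr_modc -[M in X in _ <= X]RRe_real //.
rewrite -(rmorph1 (real_complex R)) -rmorphD lecR; exact.
Qed.

Lemma closure_oball A z : (forall e : R, 0 < e -> exists2 y, A y & modc (y - z) < e) ->
  closure A z.
Proof.
move=> h B /nbhs_oball[e e0 eB]; have [y Ay yz] := h e e0.
by exists y; split=> //; exact: eB.
Qed.

End ComplexTopology.

(** * The Caratheodory metric and uniform Lipschitz bounds *)

Section Caratheodory.
Variable R : realType.
Implicit Types (f g : R[i] -> R[i]) (z w p a b : R[i]) (Omega K : set R[i]).
Implicit Types (rho s r M e t B C : R).

Definition to_disc Omega f := holo Omega f /\ forall z, Omega z -> modc (f z) <= 1.

Definition cara_set Omega z : set R := [set r | exists2 f, to_disc Omega f & r = modc (der f z)].

(* The infinitesimal Caratheodory metric of Omega at z. *)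
Definition cara Omega z : R := sup (cara_set Omega z).

Lemma cara_set_ub Omega z rho : 0 < rho -> oball z rho `<=` Omega ->
  ubound (cara_set Omega z) (12 / rho).
Proof.
move=> rho0 S r [f [hf f1] ->].
have := der_le rho0 (holoS S hf) (fun x xo => f1 x (S x xo)).
by rewrite mulr1.
Qed.

Lemma cara_set_sup Omega z : opn Omega -> Omega z -> has_sup (cara_set Omega z).
Proof.
move=> oO /oO[rho rho0 S]; split; last by exists (12 / rho); exact: cara_set_ub.
exists 0, (fun=> 0); last by rewrite (derE (hasD_cst 0 z)) modc0.
by split=> [x _|x _]; [exists 0; exact: hasD_cst|rewrite modc0].
Qed.

Lemma cara_ge Omega z f : opn Omega -> Omega z -> to_disc Omega f ->
  modc (der f z) <= cara Omega z.
Proof.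
by move=> oO Oz hf; apply: ub_le_sup; [exact: (cara_set_sup oO Oz).2|exists f].
Qed.

Lemma cara_le Omega z M : opn Omega -> Omega z ->
  (forall f, to_disc Omega f -> modc (der f z) <= M) -> cara Omega z <= M.
Proof.
move=> oO Oz h; apply: ge_sup; first exact: (cara_set_sup oO Oz).1.
by move=> r [f hf ->]; exact: h.
Qed.

Lemma cara_ball Omega z rho : 0 < rho -> opn Omega -> oball z rho `<=` Omega ->
  cara Omega z <= 12 / rho.
Proof.
move=> rho0 oO S; have Oz : Omega z by apply: S; exact: oball_center.
by apply: ge_sup; [exact: (cara_set_sup oO Oz).1|exact: cara_set_ub].
Qed.

Lemma cara_ge0 Omega z : opn Omega -> Omega z -> 0 <= cara Omega z.
Proof.
move=> oO Oz; have [[r [f hf rE]] _] := cara_set_sup oO Oz.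
by apply: le_trans (cara_ge oO Oz hf); exact: modc_ge0.
Qed.

Lemma cara_bounded Omega z B : 0 < B -> opn Omega -> (forall z, Omega z -> modc z <= B) ->
  Omega z -> B^-1 <= cara Omega z.
Proof.
move=> B0 oO OB Oz.
have hD x : hasD (fun w => (B^-1%:C)%C * w) x ((B^-1%:C)%C * 1) by apply: hasDZ; exact: hasD_id.
have := @cara_ge Omega z (fun w => (B^-1%:C)%C * w) oO Oz.
rewrite (derE (hD z)) mulr1 modc_real gtr0_norm ?invr_gt0 //; apply.
split=> [x _|x Ox]; first by exists ((B^-1%:C)%C * 1).
by rewrite modcM modc_real gtr0_norm ?invr_gt0 // mulrC ler_pdivrMr // mul1r OB.
Qed.

Lemma cara_pull Omega g z : opn Omega -> holo Omega g ->
  (forall z, Omega z -> Omega (g z)) -> Omega z ->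
  cara Omega (g z) * modc (der g z) <= cara Omega z.
Proof.
move=> oO hg gO Oz.
have [->|d0] := eqVneq (der g z) 0; first by rewrite modc0 mulr0 cara_ge0.
rewrite -ler_pdivlMr ?modc_gt0 //; apply: cara_le => // [|f [hf f1]]; first exact: gO.
rewrite ler_pdivlMr ?modc_gt0 // -modcM.
have D x : Omega x -> hasD (fun x => f (g x)) x (der f (g x) * der g x).
  by move=> Ox; apply: (hasD_comp (g := g)); [exact: holoP hg Ox|exact: holoP hf (gO _ Ox)].
rewrite -(derE (D z Oz)); apply: cara_ge => //.
by split=> x Ox; [exists (der f (g x) * der g x); exact: D|exact/f1/gO].
Qed.

(* Earle-Hamilton: composing with z |-> g z + t (g z - g p) instead of g gains
   the factor 1 + t. *)
Lemma cara_contract Omega g p delta B : opn Omega -> holo Omega g -> 0 < delta -> 0 < B ->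
  (forall z, Omega z -> oball (g z) delta `<=` Omega) ->
  (forall z, Omega z -> modc z <= B) -> Omega p ->
  (1 + delta / (4 * B)) * (cara Omega (g p) * modc (der g p)) <= cara Omega p.
Proof.
(* As 2 B bounds [g z - g p], the added term is at most delta / 2 and the modified map still sends
   Omega into itself. *)
move=> oO hg d0 B0 gO OB Op; pose t := delta / (4 * B).
have t0 : 0 < t by rewrite divr_gt0 // mulr_gt0.
have gOO z : Omega z -> Omega (g z) by move=> /gO; apply; exact: oball_center.
pose G z := (1 + (t%:C)%C) * g z + - ((t%:C)%C * g p).
have Gp : G p = g p by rewrite /G; ring.
have DG z : Omega z -> hasD G z ((1 + (t%:C)%C) * der g z + 0).
  by move=> Oz; apply: hasDD; [apply: hasDZ; exact: holoP hg Oz|exact: hasD_cst].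
have GO z : Omega z -> Omega (G z).
  move=> Oz; apply: (gO z Oz); rewrite /oball /=.
  have -> : G z - g z = (t%:C)%C * (g z - g p) by rewrite /G; ring.
  rewrite modcM modc_real gtr0_norm //.
  have := modcB (g z) (g p); have := OB _ (gOO _ Oz); have := OB _ (gOO _ Op) => h1 h2 h3.
  apply: (@le_lt_trans _ _ (t * (2 * B))); first by rewrite ler_wpM2l ?(ltW t0) //; lra.
  have -> : t * (2 * B) = delta / 2 by rewrite /t; field; rewrite gt_eqF.
  by lra.
have := cara_pull oO (fun z Oz => ex_intro _ _ (DG z Oz)) GO Op.
rewrite Gp (derE (DG p Op)) addr0 modcM mulrCA.
suff -> : modc (1 + (t%:C)%C) = 1 + t :> R by [].
by rewrite -(rmorph1 (real_complex R)) -rmorphD modc_real gtr0_norm //; lra.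
Qed.

(** The supremum of the metric over the small ball is finite and can be absorbed. For a competitor
    f, (s / 2) [dq f a] is again a competitor, so its derivative is controlled by the supremum
    itself. The product rule for f a + dq f a z (z - a) then gives the metric at a plus two quarters
    of that supremum. *)
Lemma cara_harnack Omega a z rho s : opn Omega -> 0 < s -> 5 * s < rho ->
  oball a rho `<=` Omega -> modc (z - a) <= s / 8 -> cara Omega z <= 2 * cara Omega a.
Proof.
move=> oO s0 sr S za; have rho0 : 0 < rho by lra.
have Oa : Omega a by apply: S; exact: oball_center.
pose T : set R := [set r | exists2 x, cball a (s / 8) x & r = cara Omega x].
have inO x : cball a (s / 8) x -> Omega x.
  by rewrite /cball /= => xa; apply: S; rewrite /oball /=; lra.
have T0 : T (cara Omega z) by exists z.
have supT : has_sup T.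
  split; first by exists (cara Omega z).
  exists (12 / (rho / 2)) => r [x]; rewrite /cball /= => xa ->; apply: cara_ball => //; first by lra.
  by apply: subset_trans S; apply: oballS; lra.
have Tge x : cball a (s / 8) x -> cara Omega x <= sup T.
  by move=> xa; apply: ub_le_sup; [exact: supT.2|exists x].
have T_ge0 : 0 <= sup T by apply: le_trans (Tge z za); apply: cara_ge0 => //; exact: inO.
suff H : sup T <= cara Omega a + sup T / 2 by have := Tge z za; lra.
apply: ge_sup; first exact: supT.1.
move=> _ [x xa ->]; apply: cara_le => // [|f [hf f1]]; first exact: inO.
have hq := holo_dq oO hf Oa.
have q2 y : Omega y -> modc (dq f a y) <= 2 / s.
  move=> Oy; have fa2 w : Omega w -> modc (f w - f a) <= 2.
    by move=> Ow; have := modcB (f w) (f a); have := f1 w Ow; have := f1 a Oa; lra.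
  have [yr|yr] := ltP (modc (y - a)) rho.
    by apply: (dq_le s0 sr (holoS S hf)) => // w /S; exact: fa2.
  have ya0 : 0 < modc (y - a) by lra.
  rewrite dqE; last by apply/eqP => E; move: ya0; rewrite E subrr modc0 ltxx.
  rewrite modcM modcV ler_pM ?invr_ge0 ?modc_ge0 ?fa2 //.
  by rewrite lef_pV2 ?posrE //; lra.
pose h y := ((s / 2)%:C)%C * dq f a y.
have s2 : 0 < s / 2 by lra.
have Dh y : Omega y -> hasD h y (((s / 2)%:C)%C * der (dq f a) y).
  by move=> Oy; apply: hasDZ; exact: holoP hq Oy.
have hh : to_disc Omega h.
  split=> y Oy; first by exists (((s / 2)%:C)%C * der (dq f a) y); exact: Dh.
  rewrite /h modcM modc_real gtr0_norm //.
  rewrite [X in _ <= X](_ : _ = s / 2 * (2 / s)); last by field; rewrite gt_eqF.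
  by rewrite ler_wpM2l ?q2 // ltW.
have dq' y : cball a (s / 8) y -> modc (der (dq f a) y) <= 2 / s * sup T.
  move=> ya; have Oy := inO y ya; have := le_trans (cara_ge oO Oy hh) (Tge y ya).
  rewrite (derE (Dh y Oy)) modcM modc_real gtr0_norm // => hT.
  have -> : modc (der (dq f a) y) = 2 / s * (s / 2 * modc (der (dq f a) y)).
    by field; rewrite gt_eqF.
  by rewrite ler_wpM2l // divr_ge0 // ltW.
have ca : cball a (s / 8) a by rewrite /cball /= subrr modc0; lra.
have qx : modc (dq f a x - dq f a a) <= 2 / s * sup T * modc (x - a).
  apply: (mvt_cvx (cvxc_cball a (s / 8)) (f := dq f a)) => // y ya.
  by exists (der (dq f a) y); [exact: holoP hq (inO y ya)|exact: dq'].
have fD : hasD f x (der (dq f a) x * (x - a) + dq f a x * (1 - 0) + 0).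
  have H := hasDD (hasDM (holoP hq (inO x xa)) (hasDB (hasD_id x) (hasD_cst a x))) (hasD_cst (f a) x).
  by apply: hasD_ext H; exists 1 => // w _; rewrite -dqM subrK.
rewrite (derE fD) addr0 subr0 mulr1; apply: le_trans (modcD _ _) _; rewrite modcM.
have := cara_ge oO Oa (conj hf f1); rewrite -dqxx.
have := modc_lowB (dq f a x) (dq f a a).
have xa' : modc (x - a) <= s / 8 by [].
have E1 : modc (der (dq f a) x) * modc (x - a) <= 2 / s * sup T * (s / 8).
  by apply: ler_pM; rewrite ?modc_ge0 ?dq'.
have E2 : 2 / s * sup T * modc (x - a) <= 2 / s * sup T * (s / 8).
  by rewrite ler_wpM2l // mulr_ge0 // divr_ge0 // ltW.
have E3 : 2 / s * sup T * (s / 8) = sup T / 4 by field; rewrite gt_eqF.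
lra.
Qed.

End Caratheodory.

Section Uniform.
Variable R : realType.
Implicit Types (f g : R[i] -> R[i]) (z w p a b : R[i]) (Omega K : set R[i]).
Implicit Types (rho s r M e t B C : R).
Variables (A V : set R[i]^o).
Hypotheses (oV : open V) (cV : connected V) (AV : A `<=` V) (uA : ucomp A).
Variable a0 : R[i].
Hypothesis Aa0 : A a0.

(** The bound B may depend on Omega: in this section it only makes the metric positive and enters no
    constant. *)
Definition big_domain Omega := [/\ opn Omega, exists2 B : R, 0 < B &
  (forall z, Omega z -> modc z <= B) & V `<=` Omega].

Lemma lebesgue_number : exists2 rho, 0 < rho & forall a, A a -> oball a rho `<=` V.
Proof.
apply: contrapT => nr.
have bad (n : nat) : exists az : R[i] * R[i],
    [/\ A az.1, ~ V az.2 & modc (az.2 - az.1) < n.+1%:R^-1].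
  apply: contrapT => nb; apply: nr; exists n.+1%:R^-1; first by rewrite invr_gt0.
  by move=> a Aa z za; apply: contrapT => nVz; apply: nb; exists (a, z).
have [x hx] := choice bad; have [U hU] := free_ultra_exists.
have Ax n : A (x n).1 by have [] := hx n.
have [l Al xl] := uA hU Ax; have [rho rho0 S] := open_opn oV (AV Al).
have r2 : 0 < rho / 2 by lra.
have [n [/= h1 h2]] := ultra_ex hU (ultraI hU (xl _ r2) (ultra_inv_lt hU r2)).
have [_ nV h3] := hx n; apply: nV; apply: S; rewrite /oball /=.
have {h2}h3 := lt_trans h3 h2.
by have := modc_tri (x n).1 (x n).2 l; lra.
Qed.

Lemma cara_double Omega x y rho : opn Omega -> 0 < rho -> oball x rho `<=` Omega ->
  modc (y - x) <= rho / 48 -> cara Omega y <= 2 * cara Omega x.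
Proof. by move=> oO r0 S yx; apply: (@cara_harnack _ _ _ _ rho (rho / 6)) => //; lra. Qed.

Lemma cara_compare_local z : V z -> exists2 d, 0 < d & forall x y, modc (x - z) < d ->
  modc (y - z) < d -> forall Omega, big_domain Omega -> cara Omega y <= 2 * cara Omega x.
Proof.
move=> /(open_opn oV)[rho rho0 S]; exists (rho / 200); first by lra.
move=> x y xz yz Omega [oO _ VO]; apply: (@cara_double _ _ _ (rho / 2)) => //; first by lra.
  by move=> w wx; apply/VO/S; move: w wx; apply: oballS; lra.
by have := modc_tri z y x; rewrite [modc (z - x)]modcBC; lra.
Qed.

(** Connectedness of V is used here: local Harnack estimates are chained from a0 to z, with a
    constant blind to Omega. *)
Lemma cara_compare z : V z -> exists2 C, 0 < C & forall Omega, big_domain Omega ->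
  cara Omega z <= C * cara Omega a0 /\ cara Omega a0 <= C * cara Omega z.
Proof.
pose P z := exists2 C, 0 < C & forall Omega, big_domain Omega ->
  cara Omega z <= C * cara Omega a0 /\ cara Omega a0 <= C * cara Omega z.
apply: (@connected_spread R V P a0 z oV cV (AV Aa0)).
  exists 1 => // Omega _; rewrite mul1r; split=> //.
move=> x Vx; have [d d0 hd] := cara_compare_local Vx.
exists d => // u v ux vx [C C0 hC]; exists (2 * C); first by rewrite mulr_gt0.
move=> Omega bO; have [h1 h2] := hC _ bO.
have h3 := hd _ _ ux vx _ bO; have h4 := hd _ _ vx ux _ bO.
split; first by lra.
have : C * cara Omega u <= C * (2 * cara Omega v) by rewrite ler_wpM2l // ltW.
lra.
Qed.

Lemma cara_compare_compact : exists2 C, 0 < C & forall Omega a, big_domain Omega -> A a ->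
  cara Omega a <= C * cara Omega a0 /\ cara Omega a0 <= C * cara Omega a.
Proof.
apply: contrapT => nC.
have bad (n : nat) : exists aO : R[i] * set R[i], [/\ A aO.1, big_domain aO.2 &
    ~ (cara aO.2 aO.1 <= n.+1%:R * cara aO.2 a0 /\ cara aO.2 a0 <= n.+1%:R * cara aO.2 aO.1)].
  apply: contrapT => nb; apply: nC; exists n.+1%:R => // Omega a bO Aa.
  by apply: contrapT => h; apply: nb; exists (a, Omega).
have [x hx] := choice bad; have [U hU] := free_ultra_exists.
have Ax n : A (x n).1 by have [] := hx n.
have [l Al xl] := uA hU Ax.
have [C C0 hC] := cara_compare (AV Al); have [d d0 hd] := cara_compare_local (AV Al).
pose m := (Num.truncn (2 * C)).+1.
have mC : 2 * C < m%:R by exact: truncnS_gt.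
have [n [/= h1 h2]] := ultra_ex hU (ultraI hU (xl _ d0) (ultra_ge hU m)).
have [Axn bO] := hx n; apply.
have ll : modc (l - l) < d by rewrite subrr modc0.
have [g1 g2] := hC _ bO; have g3 := hd _ _ ll h1 _ bO; have g4 := hd _ _ h1 ll _ bO.
have Cn : 2 * C <= n.+1%:R.
  by apply: le_trans (ltW mC) _; rewrite ler_nat; exact: leqW.
have [oO _ VO] := bO.
have c1 := cara_ge0 oO (VO _ (AV Axn)); have c2 := cara_ge0 oO (VO _ (AV Aa0)).
have E1 : 2 * C * cara (x n).2 a0 <= n.+1%:R * cara (x n).2 a0 by rewrite ler_wpM2r.
have E2 : 2 * C * cara (x n).2 (x n).1 <= n.+1%:R * cara (x n).2 (x n).1 by rewrite ler_wpM2r.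
split; first by lra.
have : C * cara (x n).2 l <= C * (2 * cara (x n).2 (x n).1) by rewrite ler_wpM2l // ltW.
lra.
Qed.

Lemma cara_uniform : exists rho C, [/\ 0 < rho, 0 < C, forall a, A a -> oball a rho `<=` V &
  forall Omega a a' z z', big_domain Omega -> A a -> A a' -> oball a rho z -> oball a' rho z' ->
   cara Omega z <= C * cara Omega z'].
Proof.
have [rho rho0 S] := lebesgue_number; have [C C0 hC] := cara_compare_compact.
exists (rho / 200), (4 * C * C); split; [lra|by rewrite !mulr_gt0| |].
  by move=> a Aa; apply: subset_trans (S a Aa); apply: oballS; rewrite subrr modc0; lra.
move=> Omega a a' z z' bO Aa Aa'; rewrite /oball /= => za za'.
have [oO _ VO] := bO.
have [h1 _] := hC _ _ bO Aa; have [_ h2] := hC _ _ bO Aa'.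
have g1 : cara Omega z <= 2 * cara Omega a.
  by apply: (@cara_double _ _ _ rho) => //; [exact: subset_trans (S a Aa) VO|lra].
have g2 : cara Omega a' <= 2 * cara Omega z'.
  apply: (@cara_double _ _ _ (rho / 2)) => //; first by lra.
    by apply: subset_trans VO; apply: subset_trans (S a' Aa'); apply: oballS; lra.
  by rewrite modcBC; lra.
have E1 : C * cara Omega a0 <= C * (C * cara Omega a') by rewrite ler_wpM2l // ltW.
have E2 : C * C * cara Omega a' <= C * C * (2 * cara Omega z') by rewrite ler_wpM2l // mulr_ge0 // ltW.
lra.
Qed.

(** The derivative of g at p is controlled only while g p stays near A, which is itself a
    consequence of the Lipschitz bound. The circle is broken by continuation along the segment from
    a: bisection finds p where the bound turns from true to false, and there both facts are at
    hand. *)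
Lemma uniform_lipschitz : exists rho L, [/\ 0 < rho, 0 < L, forall a, A a -> oball a rho `<=` V &
  forall Omega g, big_domain Omega -> holo Omega g -> (forall z, Omega z -> Omega (g z)) ->
    (forall a, A a -> A (g a)) ->
    forall a z, A a -> oball a rho z -> modc (g z - g a) <= L * modc (z - a)].
Proof.
have [rho [C [rho0 C0 S hC]]] := cara_uniform.
(* While the bound L holds, values move by at most rho / 2 and remain in the ball where metrics are
   comparable. The extra 1 in L absorbs the differentiability error. *)
pose L := C + 1; pose rho1 := rho / (2 * L).
have L0 : 0 < L by rewrite /L; lra.
have L1 : 1 <= L by rewrite /L; lra.
have r10 : 0 < rho1 by rewrite divr_gt0 // mulr_gt0.
have r1L : L * rho1 = rho / 2 by rewrite /rho1; field; rewrite gt_eqF.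
have r12 : rho1 <= rho / 2 by rewrite -r1L ler_peMl // ltW.
exists rho1, L; split=> //.
  by move=> a Aa; apply: subset_trans (S a Aa); apply: oballS; rewrite subrr modc0; lra.
move=> Omega g bO hg gO gA a z Aa; rewrite /oball /= => za.
pose d := z - a; pose pt t := a + (t%:C)%C * d.
have ptB s t : pt t - pt s = ((t - s)%:C)%C * d by rewrite /pt rmorphB; ring.
have ptBn s t : s <= t -> modc (pt t - pt s) = (t - s) * modc d.
  by move=> st; rewrite ptB modcM modc_real ger0_norm // subr_ge0.
pose good t := modc (g (pt t) - g a) <= L * (t * modc d).
have d0 := modc_ge0 d.
have pt0 : pt 0 = a by rewrite /pt rmorph0 mul0r addr0.
have pta t : 0 <= t <= 1 -> modc (pt t - a) <= modc d.
  by case/andP => t0 t1; rewrite -pt0 ptBn // subr0 ler_piMl.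
apply: contrapT => nz.
pose Q (x : R * R) := [/\ 0 <= x.1, x.1 <= x.2, x.2 <= 1, good x.1 & ~ good x.2].
have [|||p hp] := @bisection R _ (fun x => pt x.1) (fun x => (x.2 - x.1) * modc d) Q (0, 1).
- by move=> x [x0 x1 _ _ _]; rewrite mulr_ge0 // subr_ge0.
- move=> [s t] [/= s0 st t1 gs nt]; pose m := (s + t) / 2.
  have sm : s <= m by rewrite /m; lra.
  have mt : m <= t by rewrite /m; lra.
  have [gm|nm] := pselect (good m).
    exists (m, t); split=> /=; [split=> //=; lra| |rewrite ptBn // ler_wpM2r //; lra].
    by have -> : t - m = (t - s) / 2 by [rewrite /m; field]; rewrite mulrAC.
  exists (s, m); split=> /=; [split=> //=; lra| |by rewrite subrr modc0 mulr_ge0 // subr_ge0].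
  by have -> : m - s = (t - s) / 2 by [rewrite /m; field]; rewrite mulrAC.
- split=> //=; first by rewrite /good pt0 subrr modc0 mul0r mulr0.
  rewrite /good mul1r (_ : pt 1 = z) //.
  by rewrite /pt rmorph1 mul1r /d [a + _]addrC subrK.
have pa : modc (p - a) < rho.
  have [|[s t] [[/= s0 st t1 _ _] h1 h2]] := hp (rho / 8); first by lra.
  have := pta s; rewrite s0 (le_trans st t1) => /(_ isT).
  by have := modc_tri (pt s) p a; rewrite [modc (p - pt s)]modcBC -/d in za *; lra.
have [oO [B B0 OB] VO] := bO.
have Op : Omega p by apply/VO/(S a Aa).
have rho4 : 0 < rho / 4 by lra.
have [e e0 he] := hasD_contin (holoP hg Op) rho4.
have gp : oball (g a) rho (g p).
  have [|[s t] [[/= s0 st t1 gs _] h1 h2]] := hp (e / 2); first by lra.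
  have : modc (pt s - p) < e by lra.
  move=> /he; have : L * (s * modc d) <= L * rho1.
    rewrite ler_wpM2l ?(ltW L0) //; apply: le_trans (ltW za).
    by rewrite ler_piMl // (le_trans st).
  rewrite r1L /oball /=; have := modc_tri (g (pt s)) (g p) (g a).
  by rewrite [modc (g p - g (pt s))]modcBC; rewrite /good in gs; lra.
have gp' : modc (der g p) <= C.
  have Ogp := gO _ Op.
  have c0 : 0 < cara Omega (g p).
    by apply: lt_le_trans (cara_bounded B0 oO OB Ogp); rewrite invr_gt0.
  rewrite -(ler_pM2l c0); apply: le_trans (cara_pull oO hg gO Op) _.
  by rewrite mulrC; apply: (hC _ a (g a)) => //; exact: gA.
have e8 : (0 : R) < 1 / 8 by lra.
have [t t0 ht] := holoP hg Op e8.
have [|[s u] [[/= s0 su u1 gs nu] h1 h2]] := hp (t / 4); first by lra.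
apply: nu; rewrite /good.
have us := ptBn s u su; have u0 : 0 <= (u - s) * modc d by rewrite mulr_ge0 // subr_ge0.
have sp : modc (pt s - p) < t by lra.
have up3 : modc (pt u - p) <= 3 * ((u - s) * modc d) by have := modc_tri (pt s) (pt u) p; lra.
have up : modc (pt u - p) < t by lra.
have := ht _ sp; have := ht _ up.
set x := pt u - p; set y := pt s - p.
have -> : g (pt u) - g a = (g (pt u) - g p - der g p * x) - (g (pt s) - g p - der g p * y) +
  der g p * (pt u - pt s) + (g (pt s) - g a) by rewrite /x /y; ring.
move=> k1 k2.
have k3 : modc (der g p * (pt u - pt s)) <= C * ((u - s) * modc d).
  by rewrite modcM us ler_wpM2r.
have k4 := modcD ((g (pt u) - g p - der g p * x) - (g (pt s) - g p - der g p * y) +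
  der g p * (pt u - pt s)) (g (pt s) - g a).
have k5 := modcD ((g (pt u) - g p - der g p * x) - (g (pt s) - g p - der g p * y))
  (der g p * (pt u - pt s)).
have k6 := modcB (g (pt u) - g p - der g p * x) (g (pt s) - g p - der g p * y).
rewrite /good in gs; rewrite -/x in up3; rewrite -/y in h1.
have : modc (g (pt u) - g p - der g p * x) + modc (g (pt s) - g p - der g p * y) <=
  (u - s) * modc d by lra.
rewrite /L in gs *; lra.
Qed.

End Uniform.

(** * Bounded distortion and uniform disconnectedness *)

Section Distortion.
Variable R : realType.
Implicit Types (f g h : R[i] -> R[i]) (x y z p a b : R[i]) (w : seq (R[i] -> R[i])).
Implicit Types (rho s r M e t B C : R).

Lemma uniform_over_list (T : Type) (l : seq T) (P : T -> R -> Prop) :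
  (forall i C C', P i C -> C <= C' -> P i C') ->
  (forall i, List.In i l -> exists C, P i C) ->
  exists C, forall i, List.In i l -> P i C.
Proof.
move=> mono; elim: l => [|i l IH] h; first by exists 0.
have [C hC] := h i (or_introl erefl).
have [|C' hC'] := IH; first by move=> j jl; apply: h; right.
exists (Num.max C C') => j [<-|jl].
  by apply: mono hC _; rewrite le_max lexx.
by apply: mono (hC' j jl) _; rewrite le_max lexx orbT.
Qed.

Variables (Omega A : set R[i]^o) (gs : seq (R[i] -> R[i])) (delta B : R).
Hypotheses (oO : open Omega) (cO : connected Omega) (AO : A `<=` Omega) (uA : ucomp A).
Hypotheses (d0 : 0 < delta) (B0 : 0 < B) (OB : forall z, Omega z -> modc z <= B).
Hypothesis gh : forall g, List.In g gs -> holo Omega g.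
Hypothesis gO : forall g z, List.In g gs -> Omega z -> oball (g z) delta `<=` Omega.
Hypothesis gi : forall g, List.In g gs -> inj_on Omega g.
Hypothesis gA : forall g a, List.In g gs -> A a -> A (g a).
Hypothesis Ag : forall a, A a -> exists g b, [/\ List.In g gs, A b & a = g b].
Hypothesis ssc : forall g h a b, List.In g gs -> List.In h gs -> g <> h ->
  A a -> A b -> g a <> h b.

Let oOm : opn Omega := open_opn oO.

Lemma gOO g z : List.In g gs -> Omega z -> Omega (g z).
Proof. by move=> gg Oz; apply: (gO gg Oz); exact: oball_center. Qed.

Lemma ssc_gap : exists2 r, 0 < r & forall g h a b, List.In g gs -> List.In h gs ->
  g <> h -> A a -> A b -> r <= modc (g a - h b).
Proof.
(* A gap written as [1 <= C * distance] is monotone in C, as [uniform_over_list] requires. *)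
suff [C hC] : exists C, forall g, List.In g gs -> forall h, List.In h gs -> g <> h ->
    forall a b, A a -> A b -> 1 <= C * modc (g a - h b).
  have C1 : 0 < `|C| + 1 by have := normr_ge0 C; lra.
  exists ((`|C| + 1)^-1); first by rewrite invr_gt0.
  move=> g h a b gg hh gh' Aa Ab; have := hC g gg h hh gh' a b Aa Ab.
  rewrite -div1r ler_pdivrMr // => H.
  have := ler_norm C; have := modc_ge0 (g a - h b); nra.
have mono (g h : R[i] -> R[i]) (C C' : R) : (g <> h -> forall a b, A a -> A b -> 1 <= C * modc (g a - h b)) ->
    C <= C' -> (g <> h -> forall a b, A a -> A b -> 1 <= C' * modc (g a - h b)).
  move=> H CC ne a b Aa Ab; apply: le_trans (H ne a b Aa Ab) _.
  by rewrite ler_wpM2r ?modc_ge0.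
apply: uniform_over_list => [g C C' H CC h hh|g gg].
  exact: mono (H h hh) CC.
apply: uniform_over_list => [h C C'|h hh]; first exact: mono.
apply: contrapT => nC.
have ne : g <> h by move=> E; apply: nC; exists 0 => /(_ E).
have bad (n : nat) : exists ab : R[i] * R[i], [/\ A ab.1, A ab.2 &
    modc (g ab.1 - h ab.2) < n.+1%:R^-1].
  apply: contrapT => nb; apply: nC; exists n.+1%:R => _ a b Aa Ab.
  rewrite leNgt; apply/negP => lt; apply: nb; exists (a, b); split=> //=.
  by rewrite -[_^-1]mul1r ltr_pdivlMr // mulrC.
have [x hx] := choice bad; have [U hU] := free_ultra_exists.
have A1 n : A (x n).1 by have [] := hx n.
have A2 n : A (x n).2 by have [] := hx n.
have [l Al xl] := uA hU A1; have [m Am xm] := uA hU A2.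
have cg := contin_sub AO (holo_contin (gh gg)); have ch := contin_sub AO (holo_contin (gh hh)).
have D := ulimB hU (ulim_contin hU cg A1 Al xl) (ulim_contin hU ch A2 Am xm).
apply: (ssc gg hh ne Al Am); apply/eqP; rewrite -subr_eq0; apply/eqP/modc_arch => e e0.
rewrite -[X in modc X]subr0; apply: (ulim_le hU D).
apply: (ultraS hU) (ultra_inv_lt hU e0) => n /= h1; rewrite subr0.
by have [_ _ h2] := hx n; exact: ltW (lt_trans h2 h1).
Qed.

(** The quotient |g x - g y| / |x - y| varies by a factor 1 + L E over points within E of each
    other; products allow coinciding points. *)
Lemma map_distortion : exists2 L, 0 <= L & forall g, List.In g gs -> forall E x y x' y',
  A x -> A y -> A x' -> A y' -> modc (y - x) <= E -> modc (x' - x) <= E -> modc (y' - x) <= E ->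
  modc (g x - g y) * modc (x' - y') <= (1 + L * E) * (modc (g x' - g y') * modc (x - y)).
Proof.
suff [L hL] : exists L, forall g, List.In g gs -> forall E x y x' y',
  A x -> A y -> A x' -> A y' -> modc (y - x) <= E -> modc (x' - x) <= E -> modc (y' - x) <= E ->
  modc (g x - g y) * modc (x' - y') <= (1 + L * E) * (modc (g x' - g y') * modc (x - y)).
  exists `|L| => // g gg E x y x' y' Ax Ay Ax' Ay' h1 h2 h3.
  apply: le_trans (hL g gg E x y x' y' Ax Ay Ax' Ay' h1 h2 h3) _.
  rewrite ler_wpM2r ?mulr_ge0 ?modc_ge0 // lerD2l ler_wpM2r ?ler_norm //.
  exact: le_trans (modc_ge0 _) h1.
apply: uniform_over_list => [g C C' H CC E x y x' y' Ax Ay Ax' Ay' h1 h2 h3|g gg].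
  apply: le_trans (H E x y x' y' Ax Ay Ax' Ay' h1 h2 h3) _.
  rewrite ler_wpM2r ?mulr_ge0 ?modc_ge0 // lerD2l ler_wpM2r //.
  exact: le_trans (modc_ge0 _) h1.
have B0' := B0; have hg := gh gg.
have [mu mu0 hmu] : exists2 mu : R, 0 < mu &
    forall x y, A x -> A y -> mu * modc (x - y) <= modc (g x - g y).
  apply: (inj_lower_lipschitz oOm hg AO uA) => [x y /AO Ox /AO Oy|z /AO Oz].
    exact: gi gg _ _ Ox Oy.
  have [U hU] := free_ultra_exists.
  have [r r0 S] := oOm Oz; apply: (inj_der_neq0 hU r0 (holoS S hg)).
  by move=> x y /S Ox /S Oy; exact: gi gg _ _ Ox Oy.
have [rho rho0 S] := lebesgue_number oO AO uA.
have gB z : Omega z -> modc (g z) <= B by move=> Oz; apply: OB; exact: gOO.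
have gBo a : A a -> forall z, oball a rho z -> modc (g z) <= B by move=> Aa z /(S a Aa); exact: gB.
have hga a : A a -> holo (oball a rho) g by move=> Aa; exact: holoS (S a Aa) hg.
pose Cl := 24 * 48 * B / rho ^+ 2; pose Lg := 24 * B / rho.
have Cl0 : 0 <= Cl by rewrite /Cl divr_ge0 ?exprn_ge0 ?(ltW rho0) // mulr_ge0 ?ler0n ?(ltW B0').
have Lg0 : 0 <= Lg by rewrite /Lg divr_ge0 ?(ltW rho0) // mulr_ge0 ?ler0n ?(ltW B0').
have lip x y : A x -> A y -> modc (g x - g y) <= Lg * modc (x - y).
  move=> Ax Ay; have [xy|xy] := ltP (modc (y - x)) (rho / 2); last first.
    have h1 := gB _ (AO Ax); have h2 := gB _ (AO Ay); have h3 := modcB (g x) (g y).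
    have : Lg * (rho / 2) <= Lg * modc (x - y) by rewrite ler_wpM2l // modcBC.
    have -> : Lg * (rho / 2) = 12 * B by rewrite /Lg; field; rewrite gt_eqF.
    lra.
  apply: (mvt_cvx (cvxc_cball x (modc (y - x))) (f := g)); rewrite /cball /=.
  - move=> t tx; exists (der g t).
      by apply: holoP (hga x Ax) _; rewrite /oball /=; lra.
    by apply: (der_le_half rho0 (hga x Ax) (gBo x Ax)); rewrite /oball /=; lra.
  - by [].
  - by rewrite subrr modc0 modc_ge0.
have near x E u v : A x -> E <= rho / 8 -> modc (u - x) <= E -> modc (v - x) <= E ->
    modc (g u - g v - der g x * (u - v)) <= Cl * E * modc (u - v).
  move=> Ax Er ux vx.
  have -> : g u - g v - der g x * (u - v) = (g u - der g x * u) - (g v - der g x * v) by ring.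
  apply: (mvt_cvx (cvxc_cball x E) (f := fun v => g v - der g x * v)) => // t tx.
  have {}tx : modc (t - x) <= E by exact: tx.
  exists (der g t - der g x * 1).
    apply: hasDB; last by apply: hasDZ; exact: hasD_id.
    by apply: holoP (hga x Ax) _; rewrite /oball /=; lra.
  rewrite mulr1.
  have tc : cball x (rho / 8) t by rewrite /cball /=; lra.
  have xc : cball x (rho / 8) x by rewrite /cball /= subrr modc0; lra.
  apply: le_trans (der_lip rho0 (hga x Ax) (gBo x Ax) tc xc) _.
  exact: ler_wpM2l.
(* The first summand serves E <= rho / 8, where g is almost affine. The second serves larger E,
   where 8 E / rho > 1 and crude Lipschitz bounds suffice. *)
exists (2 * Cl / mu + 8 * Lg / (mu * rho)) => E x y x' y' Ax Ay Ax' Ay' h1 h2 h3.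
have E0 : 0 <= E by apply: le_trans (modc_ge0 _) h1.
have mxy := hmu x' y' Ax' Ay'.
set X := modc (x - y); set X' := modc (x' - y') in mxy *.
set G := modc (g x - g y); set G' := modc (g x' - g y') in mxy *.
have X0 : 0 <= X by exact: modc_ge0.
have X'0 : 0 <= X' by exact: modc_ge0.
have G'0 : 0 <= G' by exact: modc_ge0.
have p1 : 0 <= 2 * Cl / mu * E by apply: mulr_ge0 => //; rewrite divr_ge0 ?(ltW mu0) // mulr_ge0.
have p2 : 0 <= 8 * Lg / (mu * rho) * E.
  by apply: mulr_ge0 => //; rewrite divr_ge0 // mulr_ge0 // ltW.
have GX : 0 <= G' * X by rewrite mulr_ge0.
have q1 : 0 <= 2 * Cl / mu * E * (G' * X) by rewrite mulr_ge0.
have q2 : 0 <= 8 * Lg / (mu * rho) * E * (G' * X) by rewrite mulr_ge0.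
have [Er|Er] := leP E (rho / 8).
  have n1 := near x E x y Ax Er; rewrite subrr modc0 in n1; have {}n1 := n1 E0 h1.
  have n2 := near x E x' y' Ax Er h2 h3.
  rewrite -/X in n1; rewrite -/X' in n2.
  have k1 : G <= modc (der g x) * X + Cl * E * X.
    have := modc_lowB (g x - g y) (der g x * (x - y)); rewrite modcM -/G -/X; lra.
  have k2 : modc (der g x) * X' <= G' + Cl * E * X'.
    have := modc_lowB (der g x * (x' - y')) (g x' - g y'); rewrite modcM -/G' -/X'.
    by rewrite [modc (der g x * _ - _)]modcBC; lra.
  have k3 : G * X' <= (modc (der g x) * X + Cl * E * X) * X' by rewrite ler_wpM2r.
  have k4 : modc (der g x) * X' * X <= (G' + Cl * E * X') * X by rewrite ler_wpM2r.
  have k5 : 2 * Cl / mu * E * X * (mu * X') <= 2 * Cl / mu * E * X * G'.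
    by rewrite ler_wpM2l // mulr_ge0.
  have k6 : 2 * Cl / mu * E * X * (mu * X') = 2 * Cl * E * X * X' by field; rewrite gt_eqF.
  lra.
have k1 : G * X' <= Lg * X * X' by rewrite ler_wpM2r // lip.
have k2 : Lg * X / mu * (mu * X') <= Lg * X / mu * G'.
  by apply: ler_wpM2l => //; apply: divr_ge0; [exact: mulr_ge0|exact: ltW].
have k3 : Lg * X / mu * (mu * X') = Lg * X * X' by field; rewrite gt_eqF.
have k4 : Lg / mu * (G' * X) * 1 <= Lg / mu * (G' * X) * (8 / rho * E).
  apply: ler_wpM2l; first by apply: mulr_ge0 => //; apply: divr_ge0 => //; exact: ltW.
  by rewrite mulrAC ler_pdivlMr // mul1r; lra.
have k5 : Lg / mu * (G' * X) * (8 / rho * E) = 8 * Lg / (mu * rho) * E * (G' * X).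
  by field; rewrite !gt_eqF.
lra.
Qed.

Definition word (w : seq (R[i] -> R[i])) := forall g, List.In g w -> List.In g gs.

(** The head acts last, so appending a letter at the end passes to a smaller piece inside the same
    one. *)
Definition comp_word (w : seq (R[i] -> R[i])) x := foldr (fun g y => g y) x w.

Lemma comp_word_rcons w g x : comp_word (rcons w g) x = comp_word w (g x).
Proof. by rewrite /comp_word foldr_rcons. Qed.

Lemma word_cons g w : word (g :: w) -> List.In g gs /\ word w.
Proof. by move=> h; split; [apply: h; left|move=> k kw; apply: h; right]. Qed.

Lemma word_rcons g w : word w -> List.In g gs -> word (rcons w g).
Proof.
elim: w => [|k w IH] hw gg /= j; first by case=> // <-.
have [kg ww] := word_cons hw.
by case=> [<- //|]; exact: (IH ww gg).
Qed.

Lemma comp_wordO w z : word w -> Omega z -> Omega (comp_word w z).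
Proof. by elim: w => //= g w IH hw Oz; have [gg ww] := word_cons hw; apply: gOO => //; exact: IH. Qed.

Lemma comp_wordA w a : word w -> A a -> A (comp_word w a).
Proof. by elim: w => //= g w IH hw Oz; have [gg ww] := word_cons hw; apply: gA => //; exact: IH. Qed.

Lemma comp_word_inj w : word w -> inj_on Omega (comp_word w).
Proof.
elim: w => [_ x y _ _ //|g w IH hw x y Ox Oy].
have [gg ww] := word_cons hw => /(gi gg) h.
by apply: (IH ww) => //; apply: h; exact: comp_wordO.
Qed.

Lemma comp_word_holo w : word w -> holo Omega (comp_word w).
Proof.
elim: w => [|g w IH] /= hw z Oz; first by exists 1; exact: hasD_id.
have [gg ww] := word_cons hw; have [l hl] := IH ww z Oz.
have [l' hl'] := gh gg (comp_wordO ww Oz).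
by exists (l' * l); exact: (hasD_comp (f := g) hl hl').
Qed.

(** The Earle-Hamilton factor by which each map contracts the Caratheodory metric. *)
Let lam := (1 + delta / (4 * B))^-1.

Let lam_gt0 : 0 < lam.
Proof. by rewrite invr_gt0 addr_gt0 // divr_gt0 // mulr_gt0. Qed.

Let lam_lt1 : lam < 1.
Proof.
have t0 : 0 < delta / (4 * B) by rewrite divr_gt0 // mulr_gt0.
by rewrite /lam invf_lt1; lra.
Qed.

Lemma cara_word w z : word w -> Omega z ->
  cara Omega (comp_word w z) * modc (der (comp_word w) z) <= lam ^+ size w * cara Omega z.
Proof.
move=> + Oz; elim: w => [_|g w IH hw].
  by rewrite expr0 mul1r (derE (hasD_id z)) modc1 mulr1.
have [gg ww] := word_cons hw; have {}IH := IH ww.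
set q := comp_word w z in IH *; have Oq : Omega q by exact: comp_wordO.
have D : hasD (comp_word (g :: w)) z (der g q * der (comp_word w) z).
  apply: (hasD_comp (f := g) (g := comp_word w)); last exact: holoP (gh gg) Oq.
  exact: holoP (comp_word_holo ww) Oz.
rewrite (derE D) modcM /= -/q mulrA.
have H := cara_contract oOm (gh gg) d0 B0 (fun z => @gO g z gg) OB Oq.
have t1 : 0 < 1 + delta / (4 * B) by rewrite addr_gt0 // divr_gt0 // mulr_gt0.
have {}H : cara Omega (g q) * modc (der g q) <= lam * cara Omega q.
  by rewrite /lam [X in _ <= X]mulrC ler_pdivlMr // [X in X <= _]mulrC.
apply: le_trans (ler_wpM2r (modc_ge0 _) H) _.
rewrite exprS -!mulrA; apply: ler_wpM2l; first exact: ltW.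
exact: IH.
Qed.

Lemma der_word w z r : word w -> 0 < r -> oball z r `<=` Omega ->
  modc (der (comp_word w) z) <= 12 * B / r * lam ^+ size w.
Proof.
move=> ww r0 S; have Oz : Omega z by apply: S; exact: oball_center.
have h1 := cara_word ww Oz; have h2 := cara_ball r0 oOm S.
have h3 := cara_bounded B0 oOm OB (comp_wordO ww Oz).
have l0 : 0 <= lam ^+ size w by rewrite exprn_ge0 // ltW.
have : B^-1 * modc (der (comp_word w) z) <= lam ^+ size w * (12 / r).
  apply: le_trans (ler_wpM2r (modc_ge0 _) h3) _; apply: le_trans h1 _.
  exact: ler_wpM2l.
rewrite mulrC ler_pdivrMr // => h; apply: le_trans h _.
by apply: eq_lexx; ring.
Qed.

Lemma word_local z : Omega z -> exists d C, [/\ 0 < d, 0 <= C & forall x y w, modc (x - z) < d ->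
  modc (y - z) < d -> word w -> modc (comp_word w x - comp_word w y) <= C * lam ^+ size w].
Proof.
have B0' := B0; move=> /oOm[r r0 S]; exists (r / 2), (24 * B / r * r).
have r2 : 0 < r / 2 by lra.
have C0 : 0 <= 24 * B / r.
  by rewrite divr_ge0 ?(ltW r0) // mulr_ge0 ?ler0n ?(ltW B0').
split=> // [|x y w xz yz ww]; first by rewrite mulr_ge0 // ltW.
have l0 : 0 <= lam ^+ size w by rewrite exprn_ge0 // ltW.
apply: (@le_trans _ _ (24 * B / r * lam ^+ size w * modc (x - y))).
  apply: (mvt_cvx (cvxc_cball z (r / 2)) (f := comp_word w)); rewrite /cball /=; try exact: ltW.
  move=> t tz; have St : oball t (r / 2) `<=` Omega.
    by apply: subset_trans S; apply: oballS; lra.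
  exists (der (comp_word w) t).
    by apply: holoP (comp_word_holo ww) _; apply: St; exact: oball_center.
  apply: le_trans (der_word ww r2 St) _; apply: eq_lexx.
  by field; rewrite gt_eqF.
rewrite -mulrA [lam ^+ _ * _]mulrC mulrA ler_wpM2r //; apply: ler_wpM2l => //.
by have := modc_tri z x y; rewrite [modc (z - y)]modcBC; lra.
Qed.

(** Contraction is Euclidean only locally. Connectedness of Omega compares each point with a0, and
    compactness of A makes the constant uniform. *)
Lemma word_contract : exists2 C, 0 <= C & forall w x y, word w -> A x -> A y ->
  modc (comp_word w x - comp_word w y) <= C * lam ^+ size w.
Proof.
have [[a0 Aa0]|nA] := pselect (exists a, A a); last first.
  by exists 0 => // w x y _ Ax; exfalso; apply: nA; exists x.
pose P z := exists2 C, 0 <= C & forall w, word w ->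
  modc (comp_word w z - comp_word w a0) <= C * lam ^+ size w.
have lw (w : seq (R[i] -> R[i])) : 0 <= lam ^+ size w by rewrite exprn_ge0 // ltW.
have PO z : Omega z -> P z.
  apply: (@connected_spread R Omega P a0 z oO cO (AO Aa0)).
    by exists 0 => // w _; rewrite subrr modc0 mul0r.
  move=> x /word_local[d [C [dp C0 hC]]]; exists d => // u v ux vx [C' C'0 hC'].
  exists (C + C'); first by rewrite addr_ge0.
  move=> w ww; have := hC' w ww; have := hC v u w vx ux ww.
  have := modc_tri (comp_word w u) (comp_word w v) (comp_word w a0); rewrite mulrDl; lra.
suff [C C0 hC] : exists2 C, 0 <= C & forall w x, word w -> A x ->
    modc (comp_word w x - comp_word w a0) <= C * lam ^+ size w.
  exists (2 * C); first by rewrite mulr_ge0.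
  move=> w x y ww Ax Ay; have := hC w x ww Ax; have := hC w y ww Ay.
  have := modc_tri (comp_word w a0) (comp_word w x) (comp_word w y).
  by rewrite [modc (comp_word w a0 - _)]modcBC; lra.
apply: contrapT => nC.
have bad (n : nat) : exists xw : R[i] * seq (R[i] -> R[i]), [/\ A xw.1, word xw.2 &
    n%:R * lam ^+ size xw.2 < modc (comp_word xw.2 xw.1 - comp_word xw.2 a0)].
  apply: contrapT => nb; apply: nC; exists n%:R => // w x ww Ax.
  by rewrite leNgt; apply/negP => lt; apply: nb; exists (x, w).
have [x hx] := choice bad; have [U hU] := free_ultra_exists.
have Ax n : A (x n).1 by have [] := hx n.
have [l Al xl] := uA hU Ax.
have [C C0 hC] := PO l (AO Al); have [d [C' [dp C'0 hC']]] := word_local (AO Al).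
pose m := (Num.truncn (C + C')).+1.
have mC : C + C' < m%:R by exact: truncnS_gt.
have [n [/= h1 h2]] := ultra_ex hU (ultraI hU (xl _ dp) (ultra_ge hU m)).
have [_ ww h3] := hx n.
have ll : modc (l - l) < d by rewrite subrr modc0.
have := hC' _ _ _ h1 ll ww; have := hC _ ww.
have := modc_tri (comp_word (x n).2 l) (comp_word (x n).2 (x n).1) (comp_word (x n).2 a0).
have : (C + C') * lam ^+ size (x n).2 <= n%:R * lam ^+ size (x n).2.
  by rewrite ler_wpM2r // (le_trans (ltW mC)) // ler_nat.
rewrite mulrDl; lra.
Qed.

(** A letter applied after k others acts on a set of diameter at most C lam^k and distorts by at
    most exp (L C lam^k); [T n] sums these exponents as a geometric series. *)
Lemma word_distortion : exists2 K, 1 <= K & forall w x y x' y', word w ->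
  A x -> A y -> A x' -> A y' ->
  modc (comp_word w x - comp_word w y) * modc (x' - y') <=
  K * (modc (comp_word w x' - comp_word w y') * modc (x - y)).
Proof.
have [L L0 hL] := map_distortion; have [C C0 hC] := word_contract.
have l1 : 0 < 1 - lam by rewrite subr_gt0.
pose T n := L * C * ((1 - lam ^+ n) / (1 - lam)).
have LC : 0 <= L * C by rewrite mulr_ge0.
have H w x y x' y' : word w -> A x -> A y -> A x' -> A y' ->
  modc (comp_word w x - comp_word w y) * modc (x' - y') <=
  expR (T (size w)) * (modc (comp_word w x' - comp_word w y') * modc (x - y)).
  elim: w => [_ _ _ _ _|g w IH hw Ax Ay Ax' Ay'].
    by rewrite /T expr0 subrr mul0r mulr0 expR0 mul1r mulrC.
  have [gg ww] := word_cons hw; have {}IH := IH ww Ax Ay Ax' Ay'.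
  have [->|xy'] := eqVneq x' y'.
    by rewrite subrr modc0 mulr0 mulr_ge0 ?expR_ge0 ?mulr_ge0 ?modc_ge0.
  have TS : T (size w).+1 = T (size w) + L * (C * lam ^+ size w).
    by rewrite /T exprS; field; rewrite gt_eqF.
  rewrite [size (g :: w)]/= TS expRD.
  have D' : 0 < modc (comp_word w x' - comp_word w y').
    apply: modc_gt0; rewrite subr_eq0; apply/eqP.
    by move=> /(comp_word_inj ww (AO Ax') (AO Ay'))/eqP; rewrite (negPf xy').
  have := hL g gg (C * lam ^+ size w) (comp_word w x) (comp_word w y) (comp_word w x') (comp_word w y')
    (comp_wordA ww Ax) (comp_wordA ww Ay) (comp_wordA ww Ax') (comp_wordA ww Ay')
    (hC w _ _ ww Ay Ax) (hC w _ _ ww Ax' Ax) (hC w _ _ ww Ay' Ax).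
  set gx := modc (_ - _); set D := modc (comp_word w x' - _) in D' IH *.
  set gx' := modc (g _ - _); set X := modc (comp_word w x - _) in IH *.
  set e := L * (C * _) => H1.
  have e0 : 0 <= e by rewrite /e mulr_ge0 // mulr_ge0 // exprn_ge0 // ltW.
  have H2 : gx * D <= expR e * (gx' * X).
    apply: le_trans H1 _; rewrite ler_wpM2r ?mulr_ge0 ?modc_ge0 //.
    exact: expR_ge1Dx.
  rewrite -(ler_pM2r D').
  have H3 : gx * D * modc (x' - y') <= expR e * (gx' * X) * modc (x' - y').
    by rewrite ler_wpM2r ?modc_ge0.
  have H4 : expR e * gx' * (X * modc (x' - y')) <= expR e * gx' * (expR (T (size w)) * (D * modc (x - y))).
    by rewrite ler_wpM2l // mulr_ge0 ?expR_ge0 ?modc_ge0.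
  lra.
exists (expR (L * C / (1 - lam))).
  by apply: le_trans (expR_ge1Dx _); rewrite lerDl divr_ge0 // ltW.
move=> w x y x' y' ww Ax Ay Ax' Ay'; apply: le_trans (H w x y x' y' ww Ax Ay Ax' Ay') _.
rewrite ler_wpM2r ?mulr_ge0 ?modc_ge0 // ler_expR /T mulrA.
rewrite ler_wpM2r ?invr_ge0 ?(ltW l1) // ler_piMr //.
by rewrite gerBl exprn_ge0 // ltW.
Qed.

Definition uniformly_disconnected (c s0 : R) := forall a s, A a -> 0 < s -> s <= s0 ->
  exists P : set R[i], [/\ P a, P `<=` A, forall x, P x -> modc (x - a) < s &
    forall x y, P x -> A y -> ~ P y -> c * s <= modc (x - y)].

(** Descend along an address of a until the piece becomes smaller than s. Its parent has size at
    least of order s, so strong separation, transported by bounded distortion, leaves gaps of order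
    s. The descent stops because pieces shrink exponentially. *)
Lemma attractor_uniformly_disconnected : (exists x y, [/\ A x, A y & x != y]) ->
  exists c s0, [/\ 0 < c, 0 < s0 & uniformly_disconnected c s0].
Proof.
move=> [x0 [y0 [Ax0 Ay0 xy0]]].
have [r r0 hr] := ssc_gap; have [C C0 hC] := word_contract; have [K K1 hK] := word_distortion.
pose D := modc (x0 - y0); have D0 : 0 < D by apply: modc_gt0; rewrite subr_eq0.
pose Del := 2 * B / D.
have B0' := B0; have Del0 : 0 < Del by rewrite /Del divr_gt0 // mulr_gt0.
have K0 : 0 < K by lra.
have diam x y : A x -> A y -> modc (x - y) <= Del * D.
  move=> /AO/OB h1 /AO/OB h2; rewrite /Del divfK ?gt_eqF //.
  by have := modcB x y; lra.
clearbody Del; pose d w := modc (comp_word w x0 - comp_word w y0).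
have dle w x y : word w -> A x -> A y -> modc (comp_word w x - comp_word w y) <= K * d w * Del.
  move=> ww Ax Ay; rewrite -(ler_pM2r D0); apply: le_trans (hK w x y x0 y0 ww Ax Ay Ax0 Ay0) _.
  rewrite -/(d w) mulrA -[K * d w * Del * D]mulrA ler_wpM2l ?diam //.
  by rewrite mulr_ge0 ?modc_ge0 // ltW.
have dge w x y : word w -> A x -> A y -> d w * modc (x - y) <= K * D * modc (comp_word w x - comp_word w y).
  move=> ww Ax Ay; apply: le_trans (hK w x0 y0 x y ww Ax0 Ay0 Ax Ay) _.
  by rewrite -/D; apply: eq_lexx; ring.
(* [s0] is the size bound [K * d w * Del] of the empty word, where the descent starts. In [c],
   distortion is paid twice: for the size of the parent and for the gap inside it. *)
pose c := r / (K * K * Del * D); pose s0 := K * D * Del.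
have KK : 0 < K * K * Del * D by rewrite !mulr_gt0.
exists c, s0; split; [by rewrite divr_gt0|by rewrite !mulr_gt0|].
move=> a s Aa sp ss0; apply: contrapT => nP.
have H n : exists w a', [/\ word w, size w = n, A a', a = comp_word w a' &
    s <= K * d w * Del /\ forall x y, A x -> A y -> ~ (exists2 y', A y' & y = comp_word w y') ->
      c * s <= modc (comp_word w x - y)].
  elim: n => [|n [w [a' [ww wn Aa' aE [sw gap]]]]].
    exists [::], a; split=> //; split=> // x y Ax Ay; case; by exists y.
  have [g [b [gg Ab bE]]] := Ag Aa'.
  have ww' := word_rcons ww gg; have size' : size (rcons w g) = n.+1 by rewrite size_rcons wn.
  have aE' : a = comp_word (rcons w g) b by rewrite comp_word_rcons -bE.
  have gap' x y : A x -> A y -> ~ (exists2 y', A y' & y = comp_word (rcons w g) y') ->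
      c * s <= modc (comp_word (rcons w g) x - y).
    move=> Ax Ay ny; rewrite comp_word_rcons.
    (* A point outside the parent piece is far by induction; one inside it lies in a sibling piece,
       where [r] applies. *)
    have [[y' Ay' yE]|nw] := pselect (exists2 y', A y' & y = comp_word w y'); last first.
      by apply: gap => //; exact: gA.
    have [h [y'' [hh Ay'' y'E]]] := Ag Ay'.
    have gh' : g <> h.
      by move=> E; apply: ny; exists y'' => //; rewrite comp_word_rcons E -y'E.
    have r1 : r <= modc (g x - y') by rewrite y'E; exact: hr.
    have := dge w (g x) y' ww (gA gg Ax) Ay'; rewrite -yE => G.
    have G1 : d w * r <= d w * modc (g x - y') by rewrite ler_wpM2l ?modc_ge0.
    rewrite /c mulrAC ler_pdivrMr //.
    have G2 : r * s <= r * (K * d w * Del) by rewrite ler_wpM2l // ltW.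
    have G3 : K * Del * (d w * r) <= K * Del * (K * D * modc (comp_word w (g x) - y)).
      by rewrite ler_wpM2l ?mulr_ge0 ?(ltW K0) ?(ltW Del0) // (le_trans G1).
    lra.
  have [sw'|sw'] := leP s (K * d (rcons w g) * Del).
    by exists (rcons w g), b; split.
  exfalso; apply: nP; exists [set x | exists2 x', A x' & x = comp_word (rcons w g) x'].
  split; first by exists b.
  - by move=> _ [x Ax ->]; exact: comp_wordA.
  - move=> _ [x Ax ->]; apply: le_lt_trans sw'; rewrite aE'; exact: dle.
  - by move=> _ y [x Ax ->] Ay ny; exact: gap'.
have KC : 0 < K * Del * (C + 1) by rewrite !mulr_gt0 //; lra.
apply: (@geometric_blowup R s (K * Del * (C + 1)) lam 1) => //; first exact: ltW.
move=> n; rewrite expr1n mulr1.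
have [w [a' [ww wn _ _ [sw _]]]] := H n.
have l0 : 0 <= lam ^+ n by rewrite exprn_ge0 // ltW.
have := hC w x0 y0 ww Ax0 Ay0; rewrite wn -/(d w) => dw.
have KD : 0 < K * Del by rewrite mulr_gt0.
have : K * Del * d w <= K * Del * (C * lam ^+ n) by rewrite ler_wpM2l // ltW.
have : 0 <= K * Del * lam ^+ n by rewrite mulr_ge0 // ltW.
lra.
Qed.

End Distortion.

(** * Local rigidity *)

Section LocalRigidity.
Variable R : realType.
Implicit Types (x y z a b p q : R[i]).
Variables (A : set R[i]) (c s0 : R).
Hypothesis ud : uniformly_disconnected A c s0.

(* With u = g - f and Phi' = f' / u, a point x and y = f^-1 (g x) satisfy
   Phi y - Phi x ~ 1, so Re Phi grows without bound along the orbit of x, while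
   the orbit stays in a piece of A on which Phi is bounded. *)
Lemma local_rigidity (f g : R[i] -> R[i]) b a (rho r M mu kap del : R) :
  holo (oball b rho) f -> holo (oball b rho) g -> r < rho ->
  0 < mu -> 0 < kap -> 0 < del -> del <= s0 ->
  (forall z, cball b r z -> modc (der f z) <= M) ->
  (forall x y, cball b r x -> cball b r y -> mu * modc (x - y) <= modc (f x - f y)) ->
  (forall z w, cball b r z -> cball b r w ->
     modc ((g z - f z) - (g w - f w)) <= kap * modc (z - w)) ->
  (forall z, cball b r z -> modc (g z - f z) <= kap * del) ->
  modc (a - b) + 4 * del <= r ->
  (forall x, A x -> modc (x - a) <= 2 * del -> exists y, [/\ A y, cball b r y & g x = f y]) ->
  8 * kap < c * mu -> 2 * kap <= mu -> 4 * M * kap <= mu ^+ 2 ->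
  forall x, A x -> modc (x - a) <= del -> g x = f x.
Proof.
move=> hf hg rr mu0 k0 del0 dels fM fmu ulip usm ab inv kc k2 k4 x0 Ax0 x0a.
have arith (v w : R) : - (1 / 2) <= w - v - 1 -> v + 1 / 2 <= w by move=> h; lra.
have arith' (v w B t : R) : - B <= v -> w <= B -> v + t / 2 <= w -> 4 * B < t -> False.
  by move=> h1 h2 h3 h4; lra.
pose u z := g z - f z.
suff : u x0 = 0 by move/eqP; rewrite subr_eq0 => /eqP.
apply: contrapT => /eqP ux0.
have inK z : modc (z - x0) <= del -> cball b r z.
  move=> zx; rewrite /cball /=; have := modc_tri a z b; have := modc_tri x0 z a; lra.
have Ko z : cball b r z -> oball b rho z by rewrite /cball /oball /=; lra.
have hu : holo (oball b rho) u.
  move=> z zo; have [l hl] := hg z zo; have [l' hl'] := hf z zo.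
  by exists (l - l'); exact: hasDB.
(* Either u has no zero within del and s = del, or s is a dyadic fraction of del with no zero of u
   within s of x0 but a zero z0 within 2 s. Then |z - z0| <= 3 s and the Lipschitz bound make u of
   order kap s. *)
have [s [sp sdel uz us]] : exists s, [/\ 0 < s, s <= del,
    forall z, modc (z - x0) < s -> u z != 0 &
    forall z, modc (z - x0) < s -> modc (u z) <= 4 * kap * s].
  pose P (k : nat) := forall z, modc (z - x0) < del / 2 ^+ k -> u z != 0.
  have [P0|nP0] := pselect (P 0%N).
    exists del; split=> // z; first by move=> zx; apply: P0; rewrite expr0 divr1.
    move=> zx; apply: le_trans (usm z (inK z (ltW zx))) _.
    by have := mulr_gt0 k0 del0; lra.
  have [k [nPk PSk]] : exists k, ~ P k /\ P k.+1.
    apply: contrapT => nk.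
    have nP k : ~ P k.
      by elim: k => // k nPk PS; apply: nk; exists k.
    have m0 : 0 < modc (u x0) / 2 by have := modc_gt0 ux0; lra.
    have x0K : cball b r x0 by apply: inK; rewrite subrr modc0 ltW.
    have [d d0 hd] := holo_contin hu (Ko _ x0K) m0.
    pose k := (Num.truncn (del / d)).+1.
    have kd : del / d < k%:R by exact: truncnS_gt.
    have k2k : k%:R <= 2 ^+ k :> R.
      by rewrite -natrX ler_nat ltnW // ltn_expl.
    have p2 : 0 < 2 ^+ k :> R by rewrite exprn_gt0.
    have dd : del / 2 ^+ k < d.
      rewrite ltr_pdivrMr // mulrC -ltr_pdivrMr //; exact: lt_le_trans kd k2k.
    have d1 : del / 2 ^+ k <= del by rewrite ler_pdivrMr // ler_peMr ?(ltW del0) // exprn_ege1 // ler1n.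
    apply: (nP k) => z zx; apply/eqP => uz0.
    have zK : cball b r z by apply: inK; lra.
    have := hd z (Ko _ zK) (lt_trans zx dd); rewrite uz0 sub0r modcN.
    by have := modc_gt0 ux0; lra.
  have p2 : 0 < 2 ^+ k :> R by rewrite exprn_gt0.
  pose s := del / 2 ^+ k.+1.
  have sE : del / 2 ^+ k = 2 * s by rewrite /s exprS; field; rewrite gt_eqF.
  have d1 : del / 2 ^+ k <= del by rewrite ler_pdivrMr // ler_peMr ?(ltW del0) // exprn_ege1 // ler1n.
  have sp : 0 < s by rewrite /s divr_gt0 // exprn_gt0.
  have [z0 [z0x uz0]] : exists z0, modc (z0 - x0) < 2 * s /\ u z0 = 0.
    apply: contrapT => nz; apply: nPk => z; rewrite sE => zx; apply/eqP => uz.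
    by apply: nz; exists z.
  exists s; split=> //; first by lra.
  move=> z zx; have := ulip z z0 (inK z _) (inK z0 _); rewrite -/(u z) -/(u z0) uz0 subr0.
  have h1 : modc (z - x0) <= del by lra.
  have h2 : modc (z0 - x0) <= del by lra.
  move=> /(_ h1 h2) h3; apply: le_trans h3 _.
  have h4 : modc (z - z0) <= 3 * s.
    by have := modc_tri x0 z z0; rewrite [modc (x0 - z0)]modcBC; lra.
  have : kap * modc (z - z0) <= kap * (3 * s) by rewrite ler_wpM2l // ltW.
  by have := mulr_gt0 k0 sp; lra.
have s2 : 0 < s / 2 by lra.
have [|P [Px0 PA Ps gap]] := ud Ax0 s2; first by lra.
have PK x : P x -> cball b r x by move=> /Ps xs; apply: inK; lra.
(* Leaving P would cost a jump over the gap c s / 2, hence mu c s / 2 <= |u x| <= 4 kap s, against 8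
   kap < c mu. *)
have step x : P x -> exists y, [/\ P y, f y - f x = u x & mu * modc (y - x) <= modc (u x)].
  move=> Px; have xs := Ps x Px.
  have [|y [Ay yK gy]] := inv x (PA x Px).
    by have := modc_tri x0 x a; lra.
  have fu : f y - f x = u x by rewrite /u gy.
  have yx : mu * modc (y - x) <= modc (u x).
    by rewrite -fu; apply: fmu => //; exact: PK.
  exists y; split=> //; apply: contrapT => nPy.
  have h1 := gap x y Px Ay nPy; have h2 := us x (_ : modc (x - x0) < s).
  have {}h2 : modc (u x) <= 4 * kap * s by apply: h2; lra.
  have h3 : mu * (c * (s / 2)) <= mu * modc (y - x) by rewrite ler_wpM2l ?(ltW mu0) // modcBC.
  have h4 : 8 * kap * s < c * mu * s by rewrite ltr_pM2r.
  lra.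
have hq : holo (oball x0 s) (fun z => der f z * (u z)^-1).
  move=> z zs; have zo : oball b rho z.
    by apply/Ko/inK; move: zs; rewrite /oball /=; lra.
  have [l hl] := holo_der (@opn_oball R b rho) hf zo; have [l' hl'] := hu z zo.
  exists (l * (u z)^-1 + der f z * (- (u z ^+ 2)^-1 * l')).
  by apply: hasDM hl (hasD_comp (f := fun x => x^-1) hl' (hasDV (uz z zs))).
have [Phi hPhi] := primitive hq.
(* Freezing the denominator, [(u x)^-1 * f] grows by exactly 1 from x to y. The error of freezing
   has derivative f' (1/u z - 1/u x), small since u varies by at most half of |u x| between x and
   y. *)
have grow x y : P x -> P y -> f y - f x = u x -> mu * modc (y - x) <= modc (u x) ->
  complex.Re (Phi x) + 1 / 2 <= complex.Re (Phi y).
  move=> Px Py fu yx; have xs := Ps x Px; have ys := Ps y Py.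
  have ux : u x != 0 by apply: uz; lra.
  have m0 := modc_gt0 ux.
  pose K := cball x0 (s / 2) `&` cball x (modc (y - x)).
  have cK : cvxc K by apply: cvxcI; exact: cvxc_cball.
  have Kx : K x by split; rewrite /cball /= ?subrr ?modc0 ?modc_ge0 // ltW.
  have Ky : K y by split; rewrite /cball //= ltW.
  have M0 : 0 <= M by apply: le_trans (modc_ge0 _) (fM x (PK x Px)).
  have H : modc ((Phi y - (u x)^-1 * f y) - (Phi x - (u x)^-1 * f x)) <=
     2 * M * kap / (mu * modc (u x)) * modc (y - x).
    apply: (mvt_cvx cK (f := fun z => Phi z - (u x)^-1 * f z)) => // z [].
    rewrite /cball /= => zx0 zx.
    have zK : cball b r z by apply: inK; lra.
    have zs : modc (z - x0) < s by lra.
    exists (der f z * (u z)^-1 - (u x)^-1 * der f z).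
      apply: hasDB; first exact: hPhi.
      by apply: hasDZ; exact: holoP hf (Ko _ zK).
    have uz0 := uz z zs.
    have uxz : modc (u x - u z) <= kap / mu * modc (u x).
      have h := ulip z x zK (PK x Px); rewrite -/(u z) -/(u x) modcBC in h.
      apply: le_trans h _; apply: (@le_trans _ _ (kap * modc (y - x))).
        by rewrite ler_wpM2l // ltW.
      rewrite mulrAC -mulrA ler_wpM2l ?(ltW k0) // ler_pdivlMr //.
      by rewrite mulrC.
    have kmu : kap / mu <= 1 / 2 by rewrite ler_pdivrMr //; lra.
    have uzh : modc (u x) / 2 <= modc (u z).
      have := modc_lowB (u x) (u z); have : kap / mu * modc (u x) <= 1 / 2 * modc (u x).
        by rewrite ler_wpM2r ?modc_ge0.
      lra.
    have -> : der f z * (u z)^-1 - (u x)^-1 * der f z =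
      der f z * (u x - u z) * ((u z)^-1 * (u x)^-1) by field; rewrite uz0 ux.
    rewrite !modcM !modcV.
    apply: (@le_trans _ _ (M * (kap / mu * modc (u x)) * ((modc (u x) / 2)^-1 * (modc (u x))^-1))).
      apply: ler_pM; rewrite ?mulr_ge0 ?invr_ge0 ?modc_ge0 //.
        by apply: ler_pM; rewrite ?modc_ge0 ?fM.
      apply: ler_wpM2r; first by rewrite invr_ge0 modc_ge0.
      by rewrite lef_pV2 ?posrE ?modc_gt0 // divr_gt0.
    apply: eq_lexx; field.
    by rewrite !gt_eqF.
  have H2 : 2 * M * kap / (mu * modc (u x)) * modc (y - x) <= 1 / 2.
    have -> : 2 * M * kap / (mu * modc (u x)) * modc (y - x) =
      2 * M * kap * (mu * modc (y - x)) / (mu ^+ 2 * modc (u x)).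
      by field; rewrite !gt_eqF.
    rewrite ler_pdivrMr; last by rewrite mulr_gt0 // exprn_gt0.
    have h1 : 2 * M * kap * (mu * modc (y - x)) <= 2 * M * kap * modc (u x).
      by apply: ler_wpM2l => //; apply: mulr_ge0; [apply: mulr_ge0|exact: ltW].
    have h2 : 4 * M * kap * modc (u x) <= mu ^+ 2 * modc (u x).
      by rewrite ler_wpM2r ?modc_ge0.
    lra.
  have E : (Phi y - (u x)^-1 * f y) - (Phi x - (u x)^-1 * f x) = Phi y - Phi x - 1.
    have -> : (Phi y - (u x)^-1 * f y) - (Phi x - (u x)^-1 * f x) =
      Phi y - Phi x - (u x)^-1 * (f y - f x) by ring.
    by rewrite fu mulVf.
  rewrite E in H; have := le_trans (Re_le_modc _) (le_trans H H2).
  have Re1 : complex.Re (1 : R[i]) = 1 by [].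
  by rewrite !ReB Re1 ler_norml => /andP[/arith].
have orbit (k : nat) : exists2 x, P x & complex.Re (Phi x0) + k%:R / 2 <= complex.Re (Phi x).
  elim: k => [|k [x Px hx]]; first by exists x0 => //; rewrite mul0r addr0.
  have [y [Py fu yx]] := step x Px; exists y => //.
  by apply: le_trans (grow x y Px Py fu yx); rewrite -natr1 mulrDl addrA lerD2r.
have hPhi' : holo (oball x0 s) Phi by move=> z /hPhi h; exists (der f z * (u z)^-1).
have [|B B0 hB] := holo_bounded hPhi' (_ : s / 2 < s); first by lra.
pose k := (Num.truncn (4 * B)).+1.
have kB : 4 * B < k%:R by exact: truncnS_gt.
have [x Px hx] := orbit k.
have xB := hB x (ltW (Ps x Px)).
have x0B : modc (Phi x0) <= B by apply: hB; rewrite /cball /= subrr modc0 ltW.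
have := le_trans (Re_le_modc _) xB; have := le_trans (Re_le_modc _) x0B.
rewrite !ler_norml => /andP[h1 _] /andP[_ h4].
exact: arith' h1 h4 hx kB.
Qed.

End LocalRigidity.

(** * Finite unions of closed sets, nets and the identity theorem *)

Section Closed.
Variable R : realType.
Implicit Types (x y z a b p q : R[i]) (A K C : set R[i]) (d : R).

Definition eps_closed C := forall p, (forall e : R, 0 < e -> exists2 z, C z & modc (z - p) < e) -> C p.

Lemma eps_closed_image K (f : R[i] -> R[i]) : ucomp K -> contin K f ->
  eps_closed [set q | exists2 z, K z & q = f z].
Proof.
move=> uK cf p h.
have h' (n : nat) : exists z, K z /\ modc (f z - p) < n.+1%:R^-1.
  by have [|_ [z Kz ->] zp] := h n.+1%:R^-1; [rewrite invr_gt0|exists z].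
have [x hx] := choice h'; have [U hU] := free_ultra_exists.
have [l Kl xl] := uK U hU x (fun n => (hx n).1).
exists l => //; apply: (ulim_uniq hU) (ulim_contin hU cf (fun n => (hx n).1) Kl xl).
move=> e e0; apply: (ultraS hU) (ultra_inv_lt hU e0) => n /=.
exact: lt_trans (hx n).2.
Qed.

Definition has_interior A C := exists p d, [/\ A p, 0 < d &
  forall q, A q -> modc (q - p) < d -> C q].

(** Baire's theorem for finitely many closed sets: if the first one misses q, it misses a
    neighbourhood of q, which the others must cover. *)
Lemma finite_union_interior A (T : Type) (l : seq T) (C : T -> set R[i]) p d :
  (forall i, List.In i l -> eps_closed (C i)) -> A p -> 0 < d ->
  (forall q, A q -> modc (q - p) < d -> exists2 i, List.In i l & C i q) ->
  exists2 i, List.In i l & has_interior A (C i).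
Proof.
elim: l p d => [|i l IH] p d clo Ap d0 cov.
  by have [|? []] := cov p Ap; rewrite subrr modc0.
have [[q [Aq qp nC]]|h] := pselect (exists q, [/\ A q, modc (q - p) < d & ~ C i q]); last first.
  exists i; first by left.
  exists p, d; split=> // q Aq qp; apply: contrapT => nC; apply: h; exists q; split=> //.
have [e [e0 he]] : exists e, 0 < e /\ forall z, modc (z - q) < e -> ~ C i z.
  apply: contrapT => ne; apply: nC; apply: (clo i (or_introl erefl)) => e e0.
  apply: contrapT => nz; apply: ne; exists e; split=> // z zq Cz; apply: nz; exists z => //.
have m0 : 0 < Num.min e (d - modc (q - p)) by rewrite lt_min e0 subr_gt0.
have [||j jl hj] := IH q (Num.min e (d - modc (q - p))) _ Aq m0.
- by move=> j jl; apply: clo; right.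
- move=> z Az; rewrite lt_min => /andP[z1 z2].
  have [|j [ji|jl] Cj] := cov z Az; first by have := modc_tri q z p; lra.
    by exfalso; apply: (he z z1); rewrite ji.
  by exists j.
by exists j => //; right.
Qed.

(** A greedy choice of points more than d apart cannot go on forever: two of them would be within d
    / 2 of the ultralimit. *)
Lemma ucomp_net A d : ucomp A -> 0 < d -> exists l : seq R[i],
  (forall a, List.In a l -> A a) /\ forall a, A a -> exists2 b, List.In b l & modc (a - b) <= d.
Proof.
move=> uA d0; apply: contrapT => nl.
have far (l : seq R[i]) : exists a, (forall b, List.In b l -> A b) ->
    A a /\ forall b, List.In b l -> d < modc (a - b).
  have [lA|nlA] := pselect (forall b, List.In b l -> A b); last by exists 0.
  apply: contrapT => na; apply: nl; exists l; split=> // a Aa.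
  apply: contrapT => nb; apply: na; exists a => _; split=> // b bl.
  by rewrite ltNge; apply/negP => h; apply: nb; exists b.
have [pick hpick] := choice far.
pose L := fix L n := if n is n'.+1 then pick (L n') :: L n' else [::].
have LA n : forall b, List.In b (L n) -> A b.
  by elim: n => //= n IH b [<-|/IH //]; have [] := hpick _ IH.
have Lin m n : (m < n)%N -> List.In (pick (L m)) (L n).
  elim: n => // n IH; rewrite ltnS leq_eqVlt => /orP[/eqP ->|/IH h]; first by left.
  by right.
have [U hU] := free_ultra_exists.
have xA n : A (pick (L n)) by have [] := hpick _ (LA n).
have [p Ap xp] := uA U hU _ xA.
have d2 : 0 < d / 2 by lra.
have [m /= hm] := ultra_ex hU (xp _ d2).
have [n [/= hn mn]] := ultra_ex hU (ultraI hU (xp _ d2) (ultra_ge hU m.+1)).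
have [_ /(_ _ (Lin _ _ mn)) h] := hpick _ (LA n).
by have := modc_tri p (pick (L n)) (pick (L m)); rewrite [modc (p - _)]modcBC; lra.
Qed.

End Closed.

Lemma identity_connected (R : realType) (V : set R[i]^o) (f g : R[i] -> R[i]) (a : R[i]) :
  open V -> connected V -> holo V f -> holo V g -> V a ->
  (forall d : R, 0 < d -> exists b, [/\ b != a, modc (b - a) < d & f b = g b]) ->
  forall z, V z -> f z = g z.
Proof.
move=> oV cV hf hg Va acc z Vz; have oV' := open_opn oV.
pose u x := f x - g x.
have hu : holo V u.
  move=> x Vx; have [l hl] := hf x Vx; have [l' hl'] := hg x Vx.
  by exists (l - l'); exact: hasDB.
have ua : near0 u a.
  apply: contrapT => /(isolated_zero oV' hu Va)[d d0 hd].
  have [b [ba bd fg]] := acc d d0.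
  by have /negP[] := hd b ba bd; rewrite /u fg subrr.
have [d d0 uz] : near0 u z.
  by apply: (connected_spread oV cV Va ua _ Vz) => x Vx; exact: near0_spread oV' hu Vx.
by apply/eqP; rewrite -subr_eq0; apply/eqP/uz; rewrite subrr modc0.
Qed.

(** * Repetition in a sequence of systems *)

Section Repetition.
Variable R : realType.
Implicit Types (x y z a b p q : R[i]).
(** [e n] lists the maps of the n-th system, possibly with repetition, so that N is common to all n;
    hence [ssc] distinguishes maps and not indices. *)
Variables (A V : set R[i]^o) (N : nat) (Om : nat -> set R[i]) (e : nat -> nat -> R[i] -> R[i]).
Variables (c s0 : R) (a0 : R[i]).
Hypotheses (oV : open V) (cV : connected V) (AV : A `<=` V) (uA : ucomp A) (Aa0 : A a0).
Hypothesis perfA : forall a (d : R), A a -> 0 < d -> exists b, [/\ A b, b != a & modc (b - a) < d].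
Hypotheses (c0 : 0 < c) (s00 : 0 < s0) (ud : uniformly_disconnected A c s0).
Hypothesis bigOm : forall n, big_domain V (Om n).
Hypothesis eholo : forall n i, (i < N)%N -> holo (Om n) (e n i).
Hypothesis eOm : forall n i z, (i < N)%N -> Om n z -> Om n (e n i z).
Hypothesis einj : forall n i, (i < N)%N -> inj_on (Om n) (e n i).
Hypothesis eA : forall n i a, (i < N)%N -> A a -> A (e n i a).
Hypothesis Acover : forall n a, A a -> exists i b, [/\ (i < N)%N, A b & a = e n i b].
Hypothesis ssc : forall n i j a b, (i < N)%N -> (j < N)%N -> e n i <> e n j ->
  A a -> A b -> e n i a <> e n j b.
Variables (U : set_system nat) (hU : free_ultra U).

Definition index_list : seq nat := iota 0 N.

Lemma index_listP i : List.In i index_list <-> (i < N)%N.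
Proof.
rewrite /index_list -[in X in _ <-> X](add0n N).
have : forall m n, List.In i (iota m n) <-> (m <= i < m + n)%N.
  move=> m n; elim: n m => [|n IH] m /=.
    by split=> //; rewrite addn0 => /andP[h1]; rewrite ltnNge h1.
  rewrite IH addSnnS; split=> [[->|/andP[h1 h2]]|/andP[h1 h2]].
  - by rewrite leqnn addnS ltnS leq_addr.
  - by rewrite (ltnW h1).
  - by move: h1; rewrite leq_eqVlt => /orP[/eqP ->|h1]; [left|right; rewrite h1].
by move=> ->; rewrite leq0n.
Qed.

Definition stable i := exists m, U [set n | forall z, V z -> e n i z = e m i z].

Lemma limit_family : exists rho M (f : nat -> R[i] -> R[i]), [/\ 0 < rho,
  forall a, A a -> oball a rho `<=` V,
  forall n i a z, (i < N)%N -> A a -> oball a rho z -> modc (e n i z) <= M &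
  forall i a z, (i < N)%N -> A a -> oball a rho z -> ulim U (fun n => e n i z) (f i z)].
Proof.
have [rho [L [rho0 L0 S hL]]] := uniform_lipschitz oV cV AV uA Aa0.
have cf : contin A (fun z => z) by apply: holo_contin => z _; exists 1; exact: hasD_id.
have [B hB] := ucomp_contin_bounded uA cf.
pose M := B + L * rho.
have bM n i a z : (i < N)%N -> A a -> oball a rho z -> modc (e n i z) <= M.
  move=> iN Aa za.
  have h := hL (Om n) (e n i) (bigOm n) (@eholo n i iN) (fun z => @eOm n i z iN) (fun a => @eA n i a iN) a z Aa za.
  have h1 := hB _ (eA n iN Aa).
  have : L * modc (z - a) <= L * rho by rewrite ler_wpM2l ?(ltW L0) // ltW.
  by have := modc_lowB (e n i z) (e n i a); rewrite /M; lra.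
(* Away from A the sequence may be unbounded; the default value 0 there is never consulted. *)
exists rho, M, (fun i z => xget 0 [set l | ulim U (fun n => e n i z) l]); split=> //.
move=> i a z iN Aa za.
have [l hl] := ulim_ex hU (fun n => bM n i a z iN Aa za).
exact: (@xgetPex _ 0 [set l | ulim U (fun n => e n i z) l]) (ex_intro _ l hl).
Qed.

(** The limit is known to be holomorphic and injective only on balls around points of A. So A is
    first cut by a finite net into parts of small balls; the image of one part has interior in A,
    and on its ball the inverse of f i is available. *)
Lemma stable_of_interior rho M (f : nat -> R[i] -> R[i]) i : 0 < rho ->
  (forall a, A a -> oball a rho `<=` V) ->
  (forall n i a z, (i < N)%N -> A a -> oball a rho z -> modc (e n i z) <= M) ->
  (forall i a z, (i < N)%N -> A a -> oball a rho z -> ulim U (fun n => e n i z) (f i z)) ->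
  (i < N)%N -> has_interior A [set q | exists2 b, A b & q = f i b] -> stable i.
Proof.
move=> rho0 SV bM lf iN [p [d [Ap d0 int]]].
pose r1 := rho / 16; have r10 : 0 < r1 by rewrite /r1; lra.
have [l [lA net]] := ucomp_net uA r10.
have VO n z : V z -> Om n z by have [_ _] := bigOm n; exact.
have hF n b : A b -> holo (oball b rho) (e n i).
  by move=> Ab z /(SV b Ab) /(VO n); exact: (@eholo n i iN z).
have hf b (Ab : A b) : holo (oball b rho) (f i).
  exact: (@ulim_holoW R U hU (fun n => e n i) (f i) _ rho M (fun n => hF n b Ab) (fun n z => bM n i b z iN Ab)
    (fun z => lf i b z iN Ab)).
have uK b : ucomp (A `&` cball b r1).
  move=> W hW x hx; have [lx Alx xlx] := uA hW (fun n => (hx n).1).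
  exists lx => //; split=> //; rewrite /cball /=; apply: (ulim_le hW xlx).
  by apply: (ultra_all hW) => n; exact: (hx n).2.
have cl b : List.In b l -> eps_closed [set q | exists2 z, (A `&` cball b r1) z & q = f i z].
  move=> bl; apply: eps_closed_image (uK b) _.
  apply: contin_sub (holo_contin (hf b (lA b bl))) => z [_]; rewrite /cball /oball /= /r1; lra.
have [|b bl [p' [d' [Ap' d'0 int']]]] := finite_union_interior cl Ap d0.
  move=> q Aq qp; have [z Az qE] := int q Aq qp.
  by have [b bl zb] := net z Az; exists b => //; exists z.
have Ab := lA b bl; have {}hf := hf b Ab.
have [a [Aa ab] p'E] : exists2 a, (A `&` cball b r1) a & p' = f i a.
  by apply: int'; rewrite ?subrr ?modc0.
rewrite /cball /= in ab.
have ao : oball b rho a by rewrite /oball /=; rewrite /r1 in ab; lra.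
(* A second value in the image shows that f i is not constant, as Hurwitz's theorem requires. *)
have [q [Aq qp' qd]] := perfA Ap' d'0.
have [a' [Aa' a'b] qE] := int' q Aq qd.
have a'o : oball b rho a' by move: a'b; rewrite /cball /oball /= /r1; lra.
have fi : inj_on (oball b rho) (f i).
  apply: (@hurwitz_inj R U hU (fun n => e n i) (f i) _ rho M (fun n => hF n b Ab) (fun n z => bM n i b z iN Ab)
    (fun z => lf i b z iN Ab) a' a _ a'o ao); last by rewrite -qE -p'E.
  by move=> n x y /(SV b Ab) /(VO n) Ox /(SV b Ab) /(VO n) Oy; exact: (@einj n i iN x y Ox Oy).
pose r := rho / 8; have rr : r < rho by rewrite /r; lra.
have rS : cball b r `<=` oball b rho by move=> z; rewrite /cball /oball /=; lra.
have [mu mu0 hmu] : exists2 mu : R, 0 < mu & forall x y, cball b r x -> cball b r y ->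
    mu * modc (x - y) <= modc (f i x - f i y).
  apply: (inj_lower_lipschitz (@opn_oball R b rho) hf rS (@ucomp_cball R b r)).
    by move=> x y /rS xo /rS yo; exact: fi.
  move=> z /rS zo; have [t t0 tS] := opn_oball zo.
  apply: (inj_der_neq0 hU t0 (holoS tS hf)).
  by move=> x y /tS xo /tS yo; exact: fi.
have [M1 M10 hM1] := holo_bounded (holo_der (@opn_oball R b rho) hf) rr.
have M1p : 0 < 4 * (M1 + 1) by lra.
have cm := mulr_gt0 c0 mu0; have mu2 : 0 < mu / 2 by lra.
have cm16 : 0 < c * mu / 16 by lra.
have [kap [kap0 h1 h2]] := exists_lt3 cm16 mu2 (divr_gt0 (exprn_gt0 2 mu0) M1p).
rewrite ltr_pdivlMr // => h3.
have [k1 k2 k3] : [/\ 8 * kap < c * mu, 2 * kap <= mu & 4 * M1 * kap <= mu ^+ 2].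
  by split; lra.
have ro4 : 0 < d' / 2 by lra.
have [d1 d10 hd1] := holo_contin hf ao ro4.
have r64 : 0 < rho / 64 by lra.
have d14 : 0 < d1 / 4 by lra.
have d'4 : 0 < d' / 4 by lra.
have [del [del0 de1 de2 de3]] := exists_lt3 r64 s00 d14.
(* One eps for three needs: the Lipschitz bound kap, the uniform bound kap del, and d' / 4 to keep
   [e n i x] within the open piece of A covered by f i. *)
have [eps [kd0 ep1 ep2 ep3]] := exists_lt3 kap0 (mulr_gt0 kap0 del0) d'4.
have small := @ulim_small R U hU (fun n => e n i) (f i) b rho M rho0 (fun n => hF n b Ab) (fun n z => bM n i b z iN Ab)
    (fun z => lf i b z iN Ab) eps kd0.
have ab4 : modc (a - b) + 4 * del <= r by rewrite /r1 in ab; rewrite /r; lra.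
have agree : U [set n | forall x, A x -> modc (x - a) <= del -> e n i x = f i x].
  apply: (ultraS hU) small => n [sm lip].
  apply: (local_rigidity ud hf (hF n b Ab) rr mu0 kap0 del0 (ltW de2) hM1 hmu _ _ ab4 _ k1 k2 k3).
  - move=> z w zc wc; apply: le_trans (lip z w zc wc) _.
    by rewrite ler_wpM2r ?modc_ge0 // ltW.
  - by move=> z zc; apply: le_trans (sm z zc) (ltW ep2).
  move=> x Ax xa; have xb : modc (x - b) <= r by have := modc_tri a x b; lra.
  have xo : oball b rho x by exact: rS.
  have [|y [Ay yb] yE] := int' (e n i x) (eA n iN Ax).
    rewrite p'E; have := sm x xb; have := hd1 x xo (_ : modc (x - a) < d1).
    have xd : modc (x - a) < d1 by lra.
    by move=> /(_ xd); have := modc_tri (f i x) (e n i x) (f i a); lra.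
  by exists y; split=> //; move: yb; rewrite /cball /= /r1 /r; lra.
(* Both [e n i] and [e m i] agree with f i on A near a, hence with each other on V by the identity
   theorem. *)
have [m hm] := ultra_ex hU agree; exists m.
apply: (ultraS hU) agree => n /= hn.
have hV k : holo V (e k i) by move=> z /(VO k); exact: (@eholo k i iN z).
apply: (identity_connected oV cV (hV n) (hV m) (AV Aa)) => t t0.
have m0 : 0 < Num.min t del by rewrite lt_min t0.
have [x [Ax xa]] := perfA Aa m0; rewrite lt_min => /andP[xt xd].
by exists x; split=> //; rewrite hn ?hm ?ltW.
Qed.

Lemma maps_repeat (j : nat -> nat) : (forall n, (j n < N)%N) ->
  exists n m, n <> m /\ forall z, V z -> e n (j n) z = e m (j m) z.
Proof.
move=> jN; have [rho [M [f [rho0 SV bM lf]]]] := limit_family.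
have VO n z : V z -> Om n z by have [_ _] := bigOm n; exact.
have ao a : A a -> oball a rho a by move=> _; exact: oball_center.
have lfA i a : (i < N)%N -> A a -> ulim U (fun n => e n i a) (f i a).
  by move=> iN Aa; exact: lf iN Aa (ao a Aa).
have cfA i : (i < N)%N -> contin A (f i).
  move=> iN a Aa t t0.
  have hf : holo (oball a rho) (f i).
    exact: (@ulim_holoW R U hU (fun n => e n i) (f i) _ rho M (fun n => holoS (fun z za => VO n z (SV a Aa z za)) (@eholo n i iN))
      (fun n z => bM n i a z iN Aa) (fun z => lf i a z iN Aa)).
  have [d d0 hd] := holo_contin hf (ao a Aa) t0.
  exists (Num.min d rho) => [|w Aw]; first by rewrite lt_min d0.
  by rewrite lt_min => /andP[wd wr]; exact: hd.
pose im i := [set q | exists2 b, A b & q = f i b].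
have clim i : (i < N)%N -> eps_closed (im i) by move=> iN; exact: eps_closed_image uA (cfA i iN).
(* The preimages of q under the n-th maps have an ultralimit l, and for the index i used most often
   f i l = q. *)
have cover q : A q -> exists2 i, List.In i index_list & im i q.
  move=> Aq; have h n : exists ib : nat * R[i], [/\ (ib.1 < N)%N, A ib.2 & q = e n ib.1 ib.2].
    by have [i [b [? ? ?]]] := Acover n Aq; exists (i, b).
  have [ib hib] := choice h; pose x n := (ib n).2.
  have Ax n : A (x n) by have [] := hib n.
  have [l Al xl] := uA hU Ax.
  have [n _|i il Ui] := @ultra_fin U hU nat index_list (fun i n => (ib n).1 = i) setT (ultra_all hU (fun _ => I)).
    by exists (ib n).1 => //; apply/index_listP; have [] := hib n.
  have iN := (index_listP i).1 il.
  exists i => //; exists l => //; apply/eqP; rewrite -subr_eq0; apply/eqP/modc_arch => t t0.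
  have t2 : 0 < t / 2 by lra.
  have r8 : 0 < rho / 8 by lra.
  have sm := @ulim_small R U hU (fun n => e n i) (f i) l rho M rho0
    (fun n => holoS (fun z za => VO n z (SV l Al z za)) (@eholo n i iN))
    (fun n z => bM n i l z iN Al) (fun z => lf i l z iN Al) _ t2.
  have [d d0 hd] := cfA i iN l Al _ t2.
  have [n [/= [[n1 n2] n3] [n4 _]]] := ultra_ex hU (ultraI hU (ultraI hU
    (ultraI hU Ui (xl _ d0)) (xl _ r8)) sm).
  have [_ _ qE] := hib n; rewrite n1 -/(x n) in qE.
  have := n4 (x n) (ltW n3); have := hd _ (Ax n) n2.
  by rewrite -qE; have := modc_tri (f i (x n)) q (f i l); lra.
have scover q : A q -> exists2 i, List.In i index_list /\ stable i & im i q.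
  move=> Aq; apply: contrapT => nq.
  (* Stable images are emptied out. If q avoided them, points of A near q would be covered by
     unstable images alone, one of which would have interior and so be stable. *)
  pose C i := if pselect (stable i) then set0 else im i.
  have clC i : List.In i index_list -> eps_closed (C i).
    move=> /index_listP iN; rewrite /C; case: pselect => h; last exact: clim.
    by move=> p /(_ 1 ltr01) [z []].
  have [d [d0 hd]] : exists d : R, 0 < d /\ forall i, List.In i index_list -> stable i ->
      forall z, modc (z - q) < d -> ~ im i z.
    have H : forall s : seq nat, (forall i, List.In i s -> List.In i index_list) ->
        exists d : R, 0 < d /\ forall i, List.In i s -> stable i ->
          forall z, modc (z - q) < d -> ~ im i z.
      elim=> [|i s IH] hs; first by exists 1.
      have [|d [d0 hd]] := IH; first by move=> k ks; apply: hs; right.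
      have il : List.In i index_list by apply: hs; left.
      have [si|nsi] := pselect (stable i); last first.
        by exists d; split=> // k [<- /nsi //|ks]; exact: hd.
      have [d' [d'0 hd']] : exists d' : R, 0 < d' /\ forall z, modc (z - q) < d' -> ~ im i z.
        apply: contrapT => ne; apply: nq; exists i => //.
        apply: (clim i ((index_listP i).1 il)) => t t0; apply: contrapT => nz; apply: ne.
        by exists t; split=> // z zq iz; apply: nz; exists z.
      exists (Num.min d d'); split; first by rewrite lt_min d0.
      move=> k [<-|ks] sk z; rewrite lt_min => /andP[z1 z2]; first exact: hd'.
      exact: hd.
    exact: (H index_list).
  have [z Az zq|i il] := finite_union_interior clC Aq d0.
    have [i il iz] := cover z Az; exists i => //; rewrite /C; case: pselect => // si.
    exact: hd i il si z zq iz.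
  rewrite /C; case: pselect => [si [p [d' [Ap d'0 h]]]|nsi hi].
    by apply: (h p Ap); rewrite subrr modc0.
  by apply: (nsi); apply: stable_of_interior rho0 SV bM lf ((index_listP i).1 il) hi.
have [n _|i il Ui] := @ultra_fin U hU nat index_list
  (fun i n => exists2 b, A b & stable i /\ e n (j n) a0 = f i b) setT (ultra_all hU (fun _ => I)).
  have [i [il si] [b Ab E]] := scover _ (eA n (jN n) Aa0).
  by exists i => //; exists b.
have iN := (index_listP i).1 il.
have [m hm] : stable i by have [n [b _ []]] := ultra_ex hU Ui.
(* Stability gives f i b = [e n i b] at such n. Thus two maps of the n-th system have meeting images
   of A, and strong separation identifies them. *)
have key n : (exists2 b, A b & stable i /\ e n (j n) a0 = f i b) ->
    (forall z, V z -> e n i z = e m i z) -> forall z, V z -> e n (j n) z = e m i z.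
  move=> [b Ab [_ E]] nm; suff -> : e n (j n) = e n i by [].
  apply: contrapT => ne; apply: (ssc (jN n) iN ne Aa0 Ab); rewrite E.
  apply: (ulim_uniq hU) (lfA i b iN Ab) _ => t t0.
  by apply: (ultraS hU) hm => k /= ->; [rewrite -nm ?subrr ?modc0 //; exact: AV|exact: AV].
have UU := ultraI hU Ui hm.
have [n [/= n1 n2]] := ultra_ex hU UU.
have [k [/= [k1 k2] nk]] := ultra_ex hU (ultraI hU UU (ultra_ge hU n.+1)).
exists n, k; split; first by move=> E; move: nk; rewrite E ltnn.
by move=> z Vz; rewrite (key n n1 n2 z Vz) (key k k1 k2 z Vz).
Qed.

End Repetition.

(** * The theorem *)

Section Assembly.
Variable R : realType.
Implicit Types (G : holomorphic_ifs R) (A V : set R[i]^o).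

Lemma ifs_dom_opn G : opn (ifs_dom G).
Proof. by have [_ oG _] := ifs_dom_domain G; exact: open_opn. Qed.

Lemma ifs_dom_modc G : exists2 B : R, 0 < B & forall z, ifs_dom G z -> modc z <= B.
Proof.
have [B hB] := bounded_modc (@ifs_dom_bounded _ G); exists (`|B| + 1).
  by have := normr_ge0 B; lra.
by move=> z /hB; have := ler_norm B; lra.
Qed.

Lemma ifs_map_holo G g : ifs_maps G g -> holo (ifs_dom G) g.
Proof. by move=> /ifs_maps_univalent[h _] z /h; exact: derivable_hasD. Qed.

Lemma ifs_map_inj G g : ifs_maps G g -> inj_on (ifs_dom G) g.
Proof.
move=> /ifs_maps_univalent[_ h] x y Gx Gy; apply: h; exact/mem_set.
Qed.

Lemma ifs_map_dom G g z : ifs_maps G g -> ifs_dom G z -> ifs_dom G (g z).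
Proof.
by move=> hg Gz; apply: (ifs_maps_closure hg); apply: subset_closure; exists z.
Qed.

(** The closure of the image is compact inside the open domain. The margin is written C^-1 so that a
    larger C serves several maps. *)
Lemma ifs_map_margin G g : ifs_maps G g ->
  exists C : R, 0 < C /\ forall z, ifs_dom G z -> oball (g z) C^-1 `<=` ifs_dom G.
Proof.
move=> hg; apply: contrapT => nC.
have bad (n : nat) : exists zy : R[i] * R[i], [/\ ifs_dom G zy.1, ~ ifs_dom G zy.2 &
    modc (zy.2 - g zy.1) < n.+1%:R^-1].
  apply: contrapT => nb; apply: nC; exists n.+1%:R; split=> // z Gz y yz.
  by apply: contrapT => nGy; apply: nb; exists (z, y).
have [x hx] := choice bad; have [U hU] := free_ultra_exists.
have Gx n : ifs_dom G (x n).1 by have [] := hx n.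
have [B _ hB] := ifs_dom_modc G.
have [l hl] := ulim_ex hU (fun n => hB _ (ifs_map_dom hg (Gx n))).
have Gl : ifs_dom G l.
  apply: (ifs_maps_closure hg); apply: closure_oball => e e0.
  have [n /= hn] := ultra_ex hU (hl e e0).
  by exists (g (x n).1) => //; exists (x n).1.
have [r r0 S] := ifs_dom_opn Gl; have r2 : 0 < r / 2 by lra.
have [n [/= h1 h2]] := ultra_ex hU (ultraI hU (hl _ r2) (ultra_inv_lt hU r2)).
have [_ nG h3] := hx n; apply: nG; apply: S; rewrite /oball /=.
have {h2}h3 := lt_trans h3 h2.
by have := modc_tri (g (x n).1) (x n).2 l; lra.
Qed.

(** Indices not taken by f receive an arbitrary map [g0] of the system, whence the repetitions. *)
Lemma ifs_enum G A (N : nat) (f : (R[i]^o -> R[i]^o) -> nat) : is_attractor G A ->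
  (forall g, ifs_maps G g -> (f g < N)%N) ->
  (forall g h, ifs_maps G g -> ifs_maps G h -> f g = f h -> g = h) ->
  exists e : nat -> R[i]^o -> R[i]^o, (forall i, ifs_maps G (e i)) /\
    forall g, ifs_maps G g -> exists2 i, (i < N)%N & g = e i.
Proof.
move=> [[a Aa] _ _ AE] fN finj.
have [g0 hg0] : exists g, ifs_maps G g.
  by move: Aa; rewrite {1}AE => -[g hg _]; exists g.
have pick (i : nat) : exists g, ifs_maps G g /\
    ((exists2 h, ifs_maps G h & f h = i) -> f g = i).
  have [[h hh fh]|nh] := pselect (exists2 h, ifs_maps G h & f h = i); first by exists h.
  by exists g0; split.
have [e he] := choice pick; exists e; split=> [i|g hg]; first by have [] := he i.
exists (f g); first exact: fN.
have [hm hf] := he (f g); apply: finj => //.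
by apply/esym/hf; exists g.
Qed.

Lemma In_map_iota (T : Type) (e : nat -> T) (N : nat) x :
  List.In x (map e (index_list N)) <-> exists2 i, (i < N)%N & x = e i.
Proof.
have H (s : seq nat) : List.In x (map e s) <-> exists2 i, List.In i s & x = e i.
  elim: s => [|i s IH] /=; first by split=> // -[].
  rewrite IH; split=> [[<-|[j js ->]]|[j [<-|js] ->]].
  - by exists i => //; left.
  - by exists j => //; right.
  - by left.
  - by right; exists j.
by rewrite H; split=> -[i hi ->]; exists i => //; exact/index_listP.
Qed.

Lemma ifs_uniformly_disconnected G A (N : nat) (e : nat -> R[i]^o -> R[i]^o) :
  is_attractor G A -> (exists x y, [/\ A x, A y & x != y]) ->
  (forall g h a b, ifs_maps G g -> ifs_maps G h -> g <> h -> A a -> A b -> g a <> h b) ->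
  (forall i, ifs_maps G (e i)) -> (forall g, ifs_maps G g -> exists2 i, (i < N)%N & g = e i) ->
  exists c s0 : R, [/\ 0 < c, 0 < s0 & uniformly_disconnected A c s0].
Proof.
move=> [_ cA AO AE] A2 ssc eG Ge; pose gs := map e (index_list N).
have gsP g : List.In g gs <-> ifs_maps G g.
  by rewrite In_map_iota; split=> [[i _ ->]|/Ge].
have [_ oO cO] := ifs_dom_domain G.
have [B B0 hB] := ifs_dom_modc G.
have [C hC] : exists C : R, forall g, List.In g gs ->
    0 < C /\ forall z, ifs_dom G z -> oball (g z) C^-1 `<=` ifs_dom G.
  apply: uniform_over_list => [g C C' [C0 hC] CC|g /gsP]; last exact: ifs_map_margin.
  have C'0 : 0 < C' by exact: lt_le_trans CC.
  split=> // z Gz; apply: subset_trans (hC z Gz); apply: oballS.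
  by rewrite subrr modc0 add0r lef_pV2.
have [a0 Aa0] : exists a, A a by have [x [_ [Ax _ _]]] := A2; exists x.
have [g0 g0G] : exists g, ifs_maps G g by move: Aa0; rewrite {1}AE => -[g hg _]; exists g.
have [C0 _] := hC g0 ((gsP g0).2 g0G).
apply: (@attractor_uniformly_disconnected R (ifs_dom G) A gs C^-1 B) => //.
- exact: compact_ucomp.
- by rewrite invr_gt0.
- by move=> g /gsP; exact: ifs_map_holo.
- by move=> g z /hC[_ h] Gz; exact: h.
- by move=> g /gsP; exact: ifs_map_inj.
- by move=> g a /gsP hg Aa; rewrite AE; exists g => //; exists a.
- by move=> a; rewrite {1}AE => -[g hg [b Ab <-]]; exists g, b; split=> //; exact/gsP.
- by move=> g h a b /gsP hg /gsP hh; exact: ssc.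
Qed.

End Assembly.

Theorem corollary3p6 (R : realType) (A V : set R[i]^o)
    (GG : set (holomorphic_ifs R))
    (A_cantor : is_cantor_set A)
    (V_open : open V) (V_connected : connected V) (AV : A `<=` V)
    (GG_attractor : forall G, GG G -> is_attractor G A /\ V `<=` ifs_dom G)
    (GG_separation :
      (exists2 r : R, 0 < r &
         forall G, GG G -> forall g h, ifs_maps G g -> ifs_maps G h ->
           g <> h -> r <= set_dist (g @` A) (h @` A))
      \/
      [/\ A `<=` real_line R,
          A `<=` V `&` real_line R,
          forall G, GG G -> real_ifs G,
          forall G, GG G -> strong_separation G A
        & exists N : nat, forall G, GG G -> (ifs_maps G #<= `I_N)%card]) :
  finite_set [set f : R[i]^o -> R[i]^o |
    exists G g, [/\ GG G, ifs_maps G g & f = g \_ V]].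
Proof.
have [[a0 Aa0] cA pA _] := A_cantor; have uA := compact_ucomp cA.
have perfA a (d : R) : A a -> 0 < d -> exists b, [/\ A b, b != a & modc (b - a) < d].
  exact: perfect_limit.
have dist (r : R) (g h : R[i]^o -> R[i]^o) a b : r <= set_dist (g @` A) (h @` A) -> A a -> A b -> r <= modc (g a - h b).
  move=> rd Aa Ab; apply: le_trans rd _; apply: ge_inf; last first.
    by exists (g a); [exists a|exists (h b) => //; exists b].
  by exists 0 => _ [x _ [y _ <-]]; exact: modc_ge0.
have ssc G (g h : R[i]^o -> R[i]^o) a b : GG G -> ifs_maps G g -> ifs_maps G h -> g <> h -> A a -> A b -> g a <> h b.
  move=> GGG hg hh gh Aa Ab E; case: GG_separation => [[r r0 hr]|[_ _ _ hs _]].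
    have := dist r g h a b (hr G GGG g h hg hh gh) Aa Ab.
    by rewrite E subrr modc0; lra.
  have : ((g @` A) `&` (h @` A)) (g a) by split; [exists a|exists b].
  by rewrite (hs G GGG g h hg hh gh).
have [N hN] : exists N : nat, forall G, GG G -> exists e : nat -> R[i]^o -> R[i]^o,
    (forall i, ifs_maps G (e i)) /\ forall g, ifs_maps G g -> exists2 i, (i < N)%N & g = e i.
  case: GG_separation => [[r r0 hr]|[_ _ _ _ [N hN]]]; last first.
    exists N => G GGG; have [hA _] := GG_attractor G GGG.
    have /pcard_leP/injfunPex[f fN fi] := hN G GGG.
    apply: (@ifs_enum R G A N f hA) => [g hg|g h hg hh].
      exact: fN.
    by apply: fi; exact: mem_set.
  (* Distinct maps send a0 to points at least r apart, so a point of an r / 4-net close to the image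
     determines the map, and the size of the net bounds their number. *)
  have r4 : 0 < r / 4 by lra.
  have [l [lA net]] := ucomp_net uA r4; exists (size l) => G GGG.
  have [hA _] := GG_attractor G GGG; have [_ _ _ AE] := hA.
  have idx g : exists k : nat, ifs_maps G g -> (k < size l)%N /\ modc (g a0 - nth 0 l k) <= r / 4.
    have [hg|ng] := pselect (ifs_maps G g); last by exists 0%N.
    have [|b bl gb] := net (g a0); first by rewrite AE; exists g => //; exists a0.
    have [k kl bE] : exists2 k, (k < size l)%N & nth 0 l k = b.
      elim: (l) bl => // x s IH /= [->|/IH[k ks <-]]; first by exists 0%N.
      by exists k.+1.
    by exists k => _; split=> //; rewrite bE.
  have [f hf] := choice idx.
  apply: (@ifs_enum R G A (size l) f hA) => [g hg|g h hg hh fE]; first by have [] := hf g hg.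
  apply: contrapT => gh; have := dist r g h a0 a0 (hr G GGG g h hg hh gh) Aa0 Aa0.
  have [_ h1] := hf g hg; have [_ h2] := hf h hh; rewrite -fE in h2.
  have := modc_tri (nth 0 l (f g)) (g a0) (h a0).
  by rewrite [modc (nth 0 l (f g) - _)]modcBC; lra.
(* An infinite set of restrictions contains an injective sequence F, which [maps_repeat]
   contradicts. *)
apply: contrapT => /infiniteP/pcard_leP/injfunPex[F FS Fi].
have hF n : exists Ge : holomorphic_ifs R * (R[i]^o -> R[i]^o),
    [/\ GG Ge.1, ifs_maps Ge.1 Ge.2 & F n = Ge.2 \_ V].
  by have [G [g h]] := FS n I; exists (G, g).
have [Gg hGg] := choice hF; pose G n := (Gg n).1.
have GGG n : GG (G n) by have [] := hGg n.
have [e he] := choice (fun n => hN (G n) (GGG n)).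
have eG n i : ifs_maps (G n) (e n i) by have [] := he n.
have jex n : exists i, (i < N)%N /\ (Gg n).2 = e n i.
  have [_ h] := he n; have [_ hg _] := hGg n.
  by have [i iN gE] := h _ hg; exists i.
have [j hj] := choice jex.
have attr n : is_attractor (G n) A by have [] := GG_attractor _ (GGG n).
have VG n : V `<=` ifs_dom (G n) by have [] := GG_attractor _ (GGG n).
have A2 : exists x y, [/\ A x, A y & x != y].
  by have [b [Ab ba _]] := perfA a0 1 Aa0 ltr01; exists b, a0.
(* Uniform disconnectedness concerns A only, so the system of index 0 provides the constants for all
   n. *)
have [c [s0 [c0 s00 ud]]] := ifs_uniformly_disconnected (attr 0%N) A2
  (fun g h a b => @ssc (G 0%N) g h a b (GGG 0%N)) (eG 0%N) (he 0%N).2.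
have [U hU] := free_ultra_exists.
have [n [m [nm E]]] : exists n m, n <> m /\ forall z, V z -> e n (j n) z = e m (j m) z.
  apply: (@maps_repeat R A V N (fun n => ifs_dom (G n)) e c s0 a0 V_open V_connected AV uA
    Aa0 perfA c0 s00 ud _ _ _ _ _ _ _ U hU j).
  - by move=> n; split; [exact: ifs_dom_opn|exact: ifs_dom_modc|exact: VG].
  - by move=> n i _; exact: ifs_map_holo.
  - by move=> n i z _; exact: ifs_map_dom (eG n i).
  - by move=> n i _; exact: ifs_map_inj.
  - by move=> n i a _ Aa; have [_ _ _ ->] := attr n; exists (e n i) => //; exists a.
  - move=> n a; have [_ _ _ AE] := attr n; rewrite {1}AE => -[g hg [b Ab <-]].
    by have [i iN ->] := (he n).2 g hg; exists i, b.
  - by move=> n i k a b _ _; exact: ssc.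
  - by move=> n; have [] := hj n.
apply: nm; apply: Fi; rewrite ?in_setT //.
have [_ _ ->] := hGg n; have [_ _ ->] := hGg m.
apply/funext => z; rewrite !patchE; case: ifPn => // /set_mem Vz.
by have [_ ->] := hj n; have [_ ->] := hj m; exact: E.
Qed.
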